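(* (i) There exists an operator $T\in\boldsymbol{S}_1$ such that $\mathcal{Q}T\notin\boldsymbol{S}_1$. (ii) $\mathcal{Q}$ has weak type $(1,1)$, i.e., $\mathcal{Q}$ maps $\boldsymbol{S}_1$ into $\boldsymbol{S}_{1,\infty}$, with $$s_n(\mathcal{Q}T)\le C\,(1+n)^{-1}\|T\|_{\boldsymbol{S}_1},\qquad T\in\boldsymbol{S}_1,\ n\ge0,$$ for some constant $C$ independent of $T$ and $n$.
   Context: $\mathbb{R}_+=(0,\infty)$; all operators act on $L^2(\mathbb{R}_+)$. Singular numbers: $s_n(T)=\inf\{\|T-R\|:\operatorname{rank}R\le n\}$, $n\ge0$. $\boldsymbol{S}_p$ ($p=1,2$) is the Schatten--von Neumann class with $\|T\|_{\boldsymbol{S}_p}=\bigl(\sum_{n\ge0}s_n(T)^p\bigr)^{1/p}<\infty$; $\boldsymbol{S}_{1,\infty}$ is the class of operators with $\sup_{n\ge0}(1+n)s_n(T)<\infty$. For a function $\varphi$ on $\mathbb{R}_+$, $Q_\varphi$ denotes the operator $(Q_\varphi f)(x)=\int_0^\infty\varphi(\max\{x,y\})f(y)\,dy$. The averaging projection $\mathcal{Q}$ is defined on $\boldsymbol{S}_2$ as follows: if $T\in\boldsymbol{S}_2$ has kernel function $k\in L^2(\mathbb{R}_+\times\mathbb{R}_+)$, put $$\varphi(x)=\frac1{2x}\Bigl(\int_0^xk(x,t)\,dt+\int_0^xk(s,x)\,ds\Bigr),\quad x>0,$$ and $\mathcal{Q}T=Q_\varphi$. It is the orthogonal projection of $\boldsymbol{S}_2$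 onto the set of operators in $\boldsymbol{S}_2$ of the form $Q_\psi$. Since $\boldsymbol{S}_1\subset\boldsymbol{S}_2$, $\mathcal{Q}$ is defined on $\boldsymbol{S}_1$. *)

(* Defs.v *)
From HB Require Import structures.
From mathcomp Require Import all_boot all_order all_algebra.
From mathcomp Require Import complex.
From mathcomp Require Import all_classical all_reals all_analysis.
Import Order.TTheory GRing.Theory Num.Theory.
Import numFieldNormedType.Exports.

Set Implicit Arguments.
Unset Strict Implicit.
Unset Printing Implicit Defensive.

Local Open Scope classical_set_scope.
Local Open Scope ring_scope.
Local Open Scope complex_scope.

(* The scalar field of L^2 is R[i], which carries no measure theory in the
   library: measurability and integration are taken componentwise. *)
Section complex_L2.
Context d (T : measurableType d) (R : realType).
Variable mu : {measure set T -> \bar R}.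

Definition measurable_cfun (D : set T) (f : T -> R[i]) : Prop :=
  measurable_fun D (fun x => complex.Re (f x)) /\
  measurable_fun D (fun x => complex.Im (f x)).

Definition cintegral (D : set T) (f : T -> R[i]) : R[i] :=
  Rintegral mu D (fun x => complex.Re (f x)) +i*
  Rintegral mu D (fun x => complex.Im (f x)).

Definition L2norm (D : set T) (f : T -> R[i]) : \bar R :=
  sqrte (\int[mu]_(x in D) ((Normc.normc (f x)) ^+ 2)%:E)%E.

Definition L2 (D : set T) : set (T -> R[i]) :=
  [set f | measurable_cfun D f /\ (L2norm D f < +oo)%E].

End complex_L2.

Section operators.
Variable R : realType.

Local Notation leb := (@lebesgue_measure R).

(* Only the values on Rplus (resp. on Rplus `*` Rplus for kernels) matter:
   every integral, norm and a.e. statement below is restricted to it. *)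
Definition Rplus : set (measurableTypeR R) := `]0, +oo[.

Definition cfun : Type := measurableTypeR R -> R[i].

(* Elements of L^2(Rplus) are represented by Borel functions; each class
   of Lebesgue measurable functions modulo a.e. equality contains one. *)
Definition L2p : set cfun := L2 leb Rplus.

Definition norm2 (f : cfun) : \bar R := L2norm leb Rplus f.

(* Operators act on representatives of the elements of L^2(Rplus). *)
Definition op : Type := cfun -> cfun.

Definition opnorm (A : op) : \bar R :=
  ereal_sup [set norm2 (A f) | f in [set f | L2p f /\ (norm2 f <= 1)%E]].

(* Bounded linear operators on L^2(Rplus).  Compatibility with a.e. equality
   is automatic: if f = g a.e. then c (f - g) is in the unit ball for all c,
   so |c| ||A (f - g)|| <= opnorm A for all c, and A f = A g a.e. *)
Definition bounded_op (A : op) : Prop :=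
  [/\ forall f, L2p f -> L2p (A f),
      forall (a : R[i]) (f g : cfun), L2p f -> L2p g ->
        ae_eq leb Rplus (A (fun x => a * f x + g x))
                        (fun x => a * A f x + A g x)
    & (opnorm A < +oo)%E].

Definition rank_le (n : nat) (A : op) : Prop :=
  exists e : 'I_n -> cfun,
    (forall i, L2p (e i)) /\
    forall f, L2p f -> exists c : 'I_n -> R[i],
      ae_eq leb Rplus (A f) (fun x => \sum_(i < n) c i * e i x).

Definition singular_number (A : op) (n : nat) : \bar R :=
  ereal_inf [set opnorm (fun f x => A f x - K f x)
            | K in [set K | bounded_op K /\ rank_le n K]].

Definition schatten_norm (p : R) (A : op) : \bar R :=
  ((\sum_(0 <= n <oo) singular_number A n `^ p) `^ p^-1)%E.

Definition schatten (p : R) : set op :=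
  [set A | bounded_op A /\ (schatten_norm p A < +oo)%E].

Definition weak_schatten1 : set op :=
  [set A | bounded_op A /\
     (ereal_sup (range (fun n : nat =>
        n.+1%:R%:E * singular_number A n)) < +oo)%E].

Definition Q_op (phi : cfun) : op :=
  fun f x => cintegral leb Rplus (fun y => phi (Num.max x y) * f y).

Definition is_L2_kernel (A : op)
    (k : measurableTypeR R * measurableTypeR R -> R[i]) : Prop :=
  L2 (leb \x leb)%E (Rplus `*` Rplus) k /\
  forall f, L2p f ->
    ae_eq leb Rplus (A f) (fun x => cintegral leb Rplus (fun y => k (x, y) * f y)).

(* An L^2 kernel is unique up to a.e. equality when it exists, and
   the operators with an L^2 kernel are exactly those of the class S_2, so the
   default value 0 is only taken outside of S_2. *)
Definition kernel_of (A : op) : measurableTypeR R * measurableTypeR R -> R[i] :=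
  xget (fun=> 0) [set k | is_L2_kernel A k].

Definition averaging_symbol
    (k : measurableTypeR R * measurableTypeR R -> R[i]) : cfun :=
  fun x => ((2 * x)^-1)%:C *
    (cintegral leb `]0, x[ (fun t => k (x, t)) +
     cintegral leb `]0, x[ (fun s => k (s, x))).

Definition averaging_projection (A : op) : op :=
  Q_op (averaging_symbol (kernel_of A)).

End operators.

(* Main.v *)
Require Import Defs.
From mathcomp Require Import all_boot all_order all_algebra.
From mathcomp Require Import complex.
From mathcomp Require Import all_classical all_reals all_analysis.
From mathcomp Require Import measurable_realfun zify ring lra.
Import Order.TTheory GRing.Theory Num.Theory.
Import numFieldNormedType.Exports.

(** Work on [L^2(0, oo)] with the bilinear pairing [<f, g> = int f g].  A trace
class operator [A] has a nuclear representation [A f = sum_k <f, g_k> u_k] with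
[|u_k|^2, |g_k|^2 <= p_k] and [sum_k p_k] at most a constant times the trace norm
([schatten_nuclear]): telescope approximants of rank about [2^j / 4], decompose
each difference into rank one terms, and condense the singular numbers.  Hence
[A] has the kernel [k = sum_k u_k(x) g_k(y)], dominated by
[sum_k |u_k(x)| |g_k(y)|] ([nuclear_L2_kernel]).

Weak type.  On the dyadic shell [[r, 2r[] the symbol [phi] of the averaged
operator is at most [(2 r)^-1] times the sum over [k] of
[|u_k(x)| int_0^(2r) |g_k| + |g_k(x)| int_0^(2r) |u_k|].  A dyadic Hardy inequality
turns this into [r int_shell |phi|^2 <= b_n^2] with [sum_n b_n <= C |A|_1]
([averaging_symbol_estimate]).  Any operator with kernel [phi(max(x, y))] whose
symbol has this summability has singular numbers [O(1/n)]
([Q_op_singular_number]).  Given [delta > 0], cut every shell with [b_n > delta]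
into at most [2 b_n / delta] cells [[c, d[] on which the length times the integral
of [|phi|^2] is at most [delta^2] ([cell_induction]).  For [x] in a cell, the part
[y < c] of [phi(x) 1_(y <= x)] has rank one; what remains is carried by the cell,
or, on the uncut shells, is of Hardy type.  So the operator is within
[9 delta] of one whose rank is at most [4 (sum_n b_n) / delta]
([gap_kernel_exists], [Q_op_residual]).

Unboundedness.  The rank one operator [h |-> (int_0^1 h) 2 x phi(x)] has averaged
symbol [phi] as soon as [phi] vanishes on [(0, 2 pi)].  Take
[phi(x) = c_i exp(- i N_i x)] on the [i]-th interval of length [2 pi].  Between the
orthogonal families [exp(- i j x)] and [exp(i (N_i + j) x)] restricted to that
interval, the entries of the averaged operator are
[2 pi i c_i (1/j - 1/(N_i + j))] ([cpair_Q_op_packet]).  Their moduli add up to at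
least [pi c_i] times a harmonic sum, whereas for a trace class operator such sums
are bounded uniformly in [i] ([nuclear_pairing_sum]).  Since the harmonic series
diverges, [N_i] can grow so fast that even small [c_i] contradict this. *)

Set Implicit Arguments.
Unset Strict Implicit.
Unset Printing Implicit Defensive.

Local Open Scope classical_set_scope.
Local Open Scope ring_scope.
Local Open Scope complex_scope.

Local Notation normc := Normc.normc.

(** * Cauchy-Schwarz and Minkowski inequalities for extended nonnegative functions *)

Section nonneg_integrals.
Context d (T : measurableType d) (R : realType).
Variables (mu : {measure set T -> \bar R}) (D : set T) (mD : measurable D).
Local Open Scope ereal_scope.

Lemma measurable_sqre (F : T -> \bar R) :
  measurable_fun D F -> measurable_fun D (fun x => F x ^+ 2).
Proof. by move=> mF; exact: emeasurable_funM. Qed.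

(** The parameter [t] keeps the inequality meaningful in the extended reals, where
the optimal [t] need not exist; it is optimized only after integration. *)
Lemma mul_le_half_sqr (t : R) (a b : \bar R) : (0 < t)%R -> 0 <= a -> 0 <= b ->
  a * b <= (t / 2)%:E * a ^+ 2 + (t^-1 / 2)%:E * b ^+ 2.
Proof.
move=> t0; case: a => [a| |] //; case: b => [b| |] //.
- move=> a0 b0; rewrite -!EFin_expe -!EFinM -EFinD lee_fin.
  have ti0 : (0 < t^-1)%R by rewrite invr_gt0.
  rewrite -subr_ge0.
  have -> : (t / 2 * a ^+ 2 + t^-1 / 2 * b ^+ 2 - a * b =
    t^-1 / 2 * (t * a - b) ^+ 2)%R by field; lra.
  by rewrite mulr_ge0 ?sqr_ge0// ltW// divr_gt0.
- move=> a0 _.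
  have -> : (t^-1 / 2)%:E * +oo ^+ 2 = +oo :> \bar R.
    by rewrite expe2 mulyy gt0_muley// lte_fin divr_gt0 ?invr_gt0.
  by rewrite addey ?leey// -EFin_expe -EFinM.
- move=> _ b0.
  have -> : (t / 2)%:E * +oo ^+ 2 = +oo :> \bar R.
    by rewrite expe2 mulyy gt0_muley// lte_fin divr_gt0.
  by rewrite addye ?leey// -EFin_expe -EFinM.
- move=> _ _.
  have -> : (t / 2)%:E * +oo ^+ 2 = +oo :> \bar R.
    by rewrite expe2 mulyy gt0_muley// lte_fin divr_gt0.
  by rewrite addye ?leey// expe2 mulyy gt0_muley// lte_fin divr_gt0 ?invr_gt0.
Qed.

Lemma sqr_le_mul_of_half_sqr (X Y Z : R) : (0 <= X)%R -> (0 <= Y)%R -> (0 <= Z)%R ->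
  (forall t, (0 < t)%R -> (Z <= t / 2 * X + t^-1 / 2 * Y)%R) -> (Z ^+ 2 <= X * Y)%R.
Proof.
move=> X0 Y0 Z0 H.
have key e : (0 < e)%R -> (Z ^+ 2 <= (X + e) * (Y + e))%R.
  move=> e0; have Xe : (0 < X + e)%R by lra.
  have Ye : (0 < Y + e)%R by lra.
  pose s := Num.sqrt ((Y + e) / (X + e)).
  have s0 : (0 < s)%R by rewrite sqrtr_gt0 divr_gt0.
  have ss : (s ^+ 2 = (Y + e) / (X + e))%R by rewrite sqr_sqrtr// ltW// divr_gt0.
  have Hs := H s s0.
  have E : (s^-1 * (Y + e) = s * (X + e))%R.
    apply: (@mulfI _ s); first by lra.
    by rewrite mulrA divff ?mul1r ?mulrA -?expr2 ?ss; [field; lra|lra].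
  have Z1 : (Z <= s * (X + e))%R.
    apply: (le_trans Hs).
    apply: (@le_trans _ _ (s / 2 * (X + e) + s^-1 / 2 * (Y + e)))%R.
      apply: lerD; rewrite ler_pM2l ?divr_gt0 ?invr_gt0//; lra.
    by rewrite [in X in (_ + X)%R]mulrAC E; lra.
  have -> : ((X + e) * (Y + e) = (s * (X + e)) ^+ 2)%R.
    by rewrite exprMn ss; field; lra.
  by rewrite ler_pXn2r// nnegrE; nra.
apply/ler_addgt0Pr => e e0.
pose q := (e / (X + Y + 1 + e))%R.
have S0 : (0 < X + Y + 1 + e)%R by lra.
have q0 : (0 < q)%R by rewrite divr_gt0.
have q1 : (q <= 1)%R by rewrite ler_pdivrMr//; lra.
apply: (le_trans (key q q0)).
have : (q * (X + Y + 1 + e) = e)%R by rewrite /q; field; lra.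
by move=> qe; nra.
Qed.

Lemma ae_eq0_of_int_sqr (F : T -> \bar R) : measurable_fun D F ->
  \int[mu]_(x in D) F x ^+ 2 = 0 -> ae_eq mu D F (cst 0).
Proof.
move=> mF iF.
have : \int[mu]_(x in D) `|F x ^+ 2| = 0.
  by rewrite -[RHS]iF; apply: eq_integral => x _; rewrite gee0_abs// sqre_ge0.
move/(ae_eq_integral_abs mu mD (measurable_sqre mF)).1.
by apply: filterS => x + Dx => /(_ Dx)/eqP; rewrite expe_eq0/= => /eqP.
Qed.

(** Stated in squared form, so that it holds with infinite values on either side. *)
Lemma cauchy_schwarz_ge0 (F G : T -> \bar R) :
  measurable_fun D F -> measurable_fun D G ->
  (forall x, D x -> 0 <= F x) -> (forall x, D x -> 0 <= G x) ->
  (\int[mu]_(x in D) (F x * G x)) ^+ 2 <=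
  (\int[mu]_(x in D) F x ^+ 2) * (\int[mu]_(x in D) G x ^+ 2).
Proof.
move=> mF mG F0 G0.
have mF2 := measurable_sqre mF; have mG2 := measurable_sqre mG.
have mFG : measurable_fun D (fun x => F x * G x) by exact: emeasurable_funM.
have FG0 x : D x -> 0 <= F x * G x by move=> Dx; rewrite mule_ge0 ?F0 ?G0.
have iF0 : 0 <= \int[mu]_(x in D) F x ^+ 2 by apply: integral_ge0 => x Dx; exact: sqre_ge0.
have iG0 : 0 <= \int[mu]_(x in D) G x ^+ 2 by apply: integral_ge0 => x Dx; exact: sqre_ge0.
have iFG0 : 0 <= \int[mu]_(x in D) (F x * G x) by apply: integral_ge0.
have zero H K : measurable_fun D H -> measurable_fun D K ->
    (forall x, D x -> 0 <= H x) ->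
    \int[mu]_(x in D) H x ^+ 2 = 0 -> \int[mu]_(x in D) (H x * K x) = 0.
  move=> mH mK H0 iH.
  have mHK : measurable_fun D (fun x => H x * K x) by exact: emeasurable_funM.
  rewrite (@ae_eq_integral _ _ _ mu D (cst 0) (fun x => H x * K x)) ?integral0//.
  by apply: filterS (ae_eq0_of_int_sqr mH iH) => x + Dx => /(_ Dx) ->; rewrite mul0e.
have half t : (0 < t)%R -> \int[mu]_(x in D) (F x * G x) <=
    (t / 2)%:E * (\int[mu]_(x in D) F x ^+ 2) + (t^-1 / 2)%:E * (\int[mu]_(x in D) G x ^+ 2).
  move=> t0.
  have ta : (0 <= t / 2)%R by rewrite divr_ge0// ltW.
  have tb : (0 <= t^-1 / 2)%R by rewrite divr_ge0// invr_ge0 ltW.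
  rewrite -!ge0_integralZl_EFin//; try by move=> x Dx; exact: sqre_ge0.
  rewrite -ge0_integralD//; first last.
  - exact: measurable_funeM.
  - by move=> x Dx; rewrite mule_ge0 ?sqre_ge0.
  - exact: measurable_funeM.
  - by move=> x Dx; rewrite mule_ge0 ?sqre_ge0.
  apply: ge0_le_integral => //; last first.
    by move=> x Dx; apply: mul_le_half_sqr; rewrite ?F0 ?G0.
  by apply: emeasurable_funD; exact: measurable_funeM.
have [/eqP X0|Xn0] := boolP (\int[mu]_(x in D) F x ^+ 2 == 0).
  by rewrite zero// X0 mul0e expe2 mul0e.
have [/eqP Y0|Yn0] := boolP (\int[mu]_(x in D) G x ^+ 2 == 0).
  under eq_integral do rewrite muleC.
  by rewrite zero// Y0 mule0 expe2 mul0e.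
move: half iF0 iG0 iFG0 Xn0 Yn0.
case: (\int[mu]_(x in D) F x ^+ 2) => [X| |] //; last first.
  move=> _ _ Y0 _ _ Yn0; rewrite gt0_mulye ?leey//.
  by rewrite lt_neqAle eq_sym Yn0.
case: (\int[mu]_(x in D) G x ^+ 2) => [Y| |] //; last first.
  move=> _ X0 _ _ Xn0 _; rewrite gt0_muley ?leey//.
  by rewrite lt_neqAle eq_sym Xn0.
case: (\int[mu]_(x in D) (F x * G x)) => [Z| |] //; last first.
  by move=> /(_ 1%R ltr01); rewrite -!EFinM -EFinD leye_eq.
move=> half X0 Y0 Z0 _ _.
rewrite -EFin_expe -EFinM lee_fin; apply: sqr_le_mul_of_half_sqr => // t t0.
Qed.

Lemma minkowski2 (F G : T -> \bar R) (v w : R) :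
  measurable_fun D F -> measurable_fun D G ->
  (forall x, D x -> 0 <= F x) -> (forall x, D x -> 0 <= G x) ->
  (0 <= v)%R -> (0 <= w)%R ->
  \int[mu]_(x in D) F x ^+ 2 <= (v ^+ 2)%:E -> \int[mu]_(x in D) G x ^+ 2 <= (w ^+ 2)%:E ->
  \int[mu]_(x in D) (F x + G x) ^+ 2 <= ((v + w) ^+ 2)%:E.
Proof.
move=> mF mG F0 G0 v0 w0 Fv Gw.
have mF2 := measurable_sqre mF; have mG2 := measurable_sqre mG.
have mFG : measurable_fun D (fun x => F x * G x) by exact: emeasurable_funM.
have FG0 x : D x -> 0 <= F x * G x by move=> Dx; rewrite mule_ge0 ?F0 ?G0.
have FGvw : \int[mu]_(x in D) (F x * G x) <= (v * w)%:E.
  rewrite -[leLHS]gee0_abs ?integral_ge0// -lee_sqr ?lee_fin ?mulr_ge0//.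
  rewrite gee0_abs ?integral_ge0//; apply: le_trans (cauchy_schwarz_ge0 _ _ _ _) _ => //.
  rewrite -EFin_expe exprMn EFinM; apply: lee_pmul => //;
    by apply: integral_ge0 => x Dx; exact: sqre_ge0.
have -> : \int[mu]_(x in D) (F x + G x) ^+ 2 = \int[mu]_(x in D) F x ^+ 2 +
   \int[mu]_(x in D) G x ^+ 2 + (\int[mu]_(x in D) (F x * G x) + \int[mu]_(x in D) (F x * G x)).
  rewrite -!ge0_integralD//;
    try (by move=> x Dx; rewrite ?adde_ge0 ?sqre_ge0 ?FG0);
    try exact: emeasurable_funD.
  apply: eq_integral => x /set_mem Dx.
  rewrite !expe2 ge0_muleDl ?F0 ?G0// !ge0_muleDr ?F0 ?G0//.
  by rewrite [G x * F x + _]addeC addeACA [G x * F x]muleC.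
rewrite (_ : ((v + w) ^+ 2 = v ^+ 2 + w ^+ 2 + (v * w + v * w))%R); last by ring.
by rewrite !EFinD !leeD.
Qed.

Lemma minkowski_sum (h : nat -> T -> \bar R) (w : nat -> R) (n : nat) :
  (forall k, measurable_fun D (h k)) -> (forall k x, D x -> 0 <= h k x) ->
  (forall k, (0 <= w k)%R) ->
  (forall k, \int[mu]_(x in D) h k x ^+ 2 <= (w k ^+ 2)%:E) ->
  \int[mu]_(x in D) (\sum_(0 <= k < n) h k x) ^+ 2 <= ((\sum_(0 <= k < n) w k) ^+ 2)%:E.
Proof.
move=> mh h0 w0 hw; elim: n => [|n IH].
  rewrite big_geq// integral0_eq ?expr0n// => x Dx.
  by rewrite big_geq// expe2 mule0.
under eq_integral do rewrite big_nat_recr//=.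
rewrite big_nat_recr//=; apply: minkowski2 => //.
- exact: emeasurable_sum.
- by move=> x Dx; apply: sume_ge0 => k _; exact: h0.
- exact: h0.
- by apply: sumr_ge0.
Qed.

Lemma cvg_sqre (u : nat -> \bar R) (l : \bar R) :
  u @ \oo --> l -> (fun n => u n ^+ 2) @ \oo --> l ^+ 2.
Proof.
move=> ul; under eq_fun do rewrite expe2; rewrite expe2; apply: cvgeM => //.
by rewrite /mule_def; case: l ul => [r| |] _ //=; rewrite andbF.
Qed.

(** The L2 norms of the terms are the [w k]; monotone convergence reduces the
series to its partial sums. *)
Lemma minkowski_series (h : nat -> T -> \bar R) (w : nat -> R) (W : R) :
  (forall k, measurable_fun D (h k)) -> (forall k x, D x -> 0 <= h k x) ->
  (forall k, (0 <= w k)%R) ->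
  (forall k, \int[mu]_(x in D) h k x ^+ 2 <= (w k ^+ 2)%:E) ->
  (forall n, \sum_(0 <= k < n) w k <= W)%R ->
  \int[mu]_(x in D) (\sum_(0 <= k <oo) h k x) ^+ 2 <= (W ^+ 2)%:E.
Proof.
move=> mh h0 w0 hw wW.
have -> : \int[mu]_(x in D) (\sum_(0 <= k <oo) h k x) ^+ 2 =
    \int[mu]_(x in D) limn (fun n => (\sum_(0 <= k < n) h k x) ^+ 2).
  apply: eq_integral => x /set_mem Dx; apply/esym/cvg_lim => //.
  by apply: cvg_sqre; apply: is_cvg_nneseries => k _ _; exact: h0.
rewrite monotone_convergence//; first last.
- move=> x Dx m n mn; rewrite lee_sqr ?sume_ge0//; try by move=> k _; exact: h0.
  by apply: lee_sum_nneg_natr => // k _ _; exact: h0.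
- by move=> n x Dx; exact: sqre_ge0.
- by move=> n; apply: measurable_sqre; exact: emeasurable_sum.
apply: lime_le.
  apply: ereal_nondecreasing_is_cvgn => m n mn; apply: ge0_le_integral => //.
  - by move=> x Dx; exact: sqre_ge0.
  - by apply: measurable_sqre; exact: emeasurable_sum.
  - by apply: measurable_sqre; exact: emeasurable_sum.
  move=> x Dx; rewrite lee_sqr ?sume_ge0//; try by move=> k _; exact: h0.
  by apply: lee_sum_nneg_natr => // k _ _; exact: h0.
apply: nearW => n; apply: le_trans (minkowski_sum n mh h0 w0 hw) _.
rewrite lee_fin ler_sqr ?nnegrE ?sumr_ge0//.
by apply: le_trans (wW n); rewrite sumr_ge0.
Qed.

End nonneg_integrals.

(** * Complex-valued square integrable functions *)

Section complex_modulus.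
Variable R : realType.
Implicit Types z w : R[i].

Lemma complex_ext z w : complex.Re z = complex.Re w -> complex.Im z = complex.Im w -> z = w.
Proof. by case: z => a b; case: w => c d /= -> ->. Qed.

Lemma cReD z w : complex.Re (z + w) = complex.Re z + complex.Re w.
Proof. by case: z; case: w. Qed.

Lemma cImD z w : complex.Im (z + w) = complex.Im z + complex.Im w.
Proof. by case: z; case: w. Qed.

Lemma cReN z : complex.Re (- z) = - complex.Re z.
Proof. by case: z. Qed.

Lemma cImN z : complex.Im (- z) = - complex.Im z.
Proof. by case: z. Qed.

Lemma cReM z w : complex.Re (z * w) =
  complex.Re z * complex.Re w - complex.Im z * complex.Im w.
Proof. by case: z; case: w. Qed.

Lemma cImM z w : complex.Im (z * w) =
  complex.Re z * complex.Im w + complex.Im z * complex.Re w.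
Proof. by case: z; case: w. Qed.

Lemma cRe_conj z : complex.Re (z^*) = complex.Re z.
Proof. by case: z. Qed.

Lemma cIm_conj z : complex.Im (z^*) = - complex.Im z.
Proof. by case: z. Qed.

Lemma cRe_sum (I : Type) (r : seq I) (P : pred I) (F : I -> R[i]) :
  complex.Re (\sum_(i <- r | P i) F i) = \sum_(i <- r | P i) complex.Re (F i).
Proof. by elim/big_rec2: _ => // i x y _ <-; rewrite cReD. Qed.

Lemma cIm_sum (I : Type) (r : seq I) (P : pred I) (F : I -> R[i]) :
  complex.Im (\sum_(i <- r | P i) F i) = \sum_(i <- r | P i) complex.Im (F i).
Proof. by elim/big_rec2: _ => // i x y _ <-; rewrite cImD. Qed.

Definition cReImE := (cReD, cImD, cReN, cImN, cReM, cImM, cRe_conj, cIm_conj).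

Lemma normc_sqr z : normc z ^+ 2 = complex.Re z ^+ 2 + complex.Im z ^+ 2.
Proof. by case: z => a b /=; rewrite sqr_sqrtr// addr_ge0 ?sqr_ge0. Qed.

Lemma normc_ge0 z : 0 <= normc z.
Proof. by case: z => a b /=; exact: sqrtr_ge0. Qed.

Lemma normcE z : normc z = Num.sqrt (complex.Re z ^+ 2 + complex.Im z ^+ 2).
Proof. by case: z. Qed.

Lemma abs_Re_le z : `|complex.Re z| <= normc z.
Proof.
rewrite -ler_sqr ?nnegrE ?normc_ge0// real_normK ?num_real// normc_sqr.
by rewrite lerDl sqr_ge0.
Qed.

Lemma abs_Im_le z : `|complex.Im z| <= normc z.
Proof.
rewrite -ler_sqr ?nnegrE ?normc_ge0// real_normK ?num_real// normc_sqr.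
by rewrite lerDr sqr_ge0.
Qed.

Lemma normc_conj z : normc (z^*) = normc z.
Proof. by rewrite !normcE !cReImE sqrrN. Qed.

Lemma normc_real (x : R) : normc (x%:C) = `|x|.
Proof. by rewrite normcE /= expr0n addr0 sqrtr_sqr. Qed.

Lemma normc_sum (I : Type) (r : seq I) (P : pred I) (F : I -> R[i]) :
  normc (\sum_(i <- r | P i) F i) <= \sum_(i <- r | P i) normc (F i).
Proof.
elim/big_rec2: _ => [|i y x _ h]; first by rewrite Normc.normc0.
by apply: le_trans (le_normcD _ _) _; rewrite lerD2l.
Qed.

End complex_modulus.

Section complex_measurability.
Context d (T : measurableType d) (R : realType) (D : set T).
Implicit Types f g : T -> R[i].

Lemma mcfunD f g : measurable_cfun D f -> measurable_cfun D g ->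
  measurable_cfun D (fun x => f x + g x).
Proof.
move=> [f1 f2] [g1 g2]; split.
- by under eq_fun do rewrite cReD; exact: measurable_funD.
- by under eq_fun do rewrite cImD; exact: measurable_funD.
Qed.

Lemma mcfunN f : measurable_cfun D f -> measurable_cfun D (fun x => - f x).
Proof.
move=> [f1 f2]; split.
- by under eq_fun do rewrite cReN; exact: measurableT_comp.
- by under eq_fun do rewrite cImN; exact: measurableT_comp.
Qed.

Lemma mcfunB f g : measurable_cfun D f -> measurable_cfun D g ->
  measurable_cfun D (fun x => f x - g x).
Proof. by move=> mf mg; apply: mcfunD => //; exact: mcfunN. Qed.

Lemma mcfunM f g : measurable_cfun D f -> measurable_cfun D g ->
  measurable_cfun D (fun x => f x * g x).
Proof.
move=> [f1 f2] [g1 g2]; split.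
- under eq_fun do rewrite cReM.
  by apply: measurable_funB; exact: measurable_funM.
- under eq_fun do rewrite cImM.
  by apply: measurable_funD; exact: measurable_funM.
Qed.

Lemma mcfun_conj f : measurable_cfun D f -> measurable_cfun D (fun x => (f x)^*).
Proof.
move=> [f1 f2]; split.
- by under eq_fun do rewrite cRe_conj.
- by under eq_fun do rewrite cIm_conj; exact: measurableT_comp.
Qed.

Lemma mcfun_cst (c : R[i]) : measurable_cfun D (fun=> c).
Proof. by split; exact: measurable_cst. Qed.

Lemma mcfun_sum (I : Type) (r : seq I) (P : pred I) (F : I -> T -> R[i]) :
  (forall i, measurable_cfun D (F i)) ->
  measurable_cfun D (fun x => \sum_(i <- r | P i) F i x).
Proof.
move=> mF; elim: r => [|i r IH].
  by under eq_fun do rewrite big_nil; exact: mcfun_cst.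
under eq_fun do rewrite big_cons; case: (P i) => //.
exact: mcfunD.
Qed.

Lemma mcfun_real (h : T -> R) : measurable_fun D h ->
  measurable_cfun D (fun x => (h x)%:C).
Proof. by move=> mh; split => //=; exact: measurable_cst. Qed.

Lemma measurable_normc_sqr f : measurable_cfun D f ->
  measurable_fun D (fun x => normc (f x) ^+ 2).
Proof.
move=> [f1 f2]; under eq_fun do rewrite normc_sqr.
by apply: measurable_funD; exact: measurable_funX.
Qed.

Lemma measurable_normc f : measurable_cfun D f ->
  measurable_fun D (fun x => normc (f x)).
Proof.
move=> mf; have -> : (fun x => normc (f x)) = Num.sqrt \o (fun x => normc (f x) ^+ 2).
  by apply/funext => x /=; rewrite sqrtr_sqr ger0_norm ?normc_ge0.
apply: measurableT_comp; last exact: measurable_normc_sqr.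
by apply: continuous_measurable_fun; exact: sqrt_continuous.
Qed.

Lemma eq_mcfun f g : (forall x, D x -> f x = g x) ->
  measurable_cfun D f -> measurable_cfun D g.
Proof.
move=> fg [f1 f2]; split.
- by apply: eq_measurable_fun f1 => x /set_mem Dx; rewrite fg.
- by apply: eq_measurable_fun f2 => x /set_mem Dx; rewrite fg.
Qed.

End complex_measurability.

Lemma mcfunS d (T : measurableType d) (R : realType) (D E : set T) (f : T -> R[i]) :
  measurable D -> E `<=` D -> measurable_cfun D f -> measurable_cfun E f.
Proof. by move=> mD ED [f1 f2]; split; exact: measurable_funS ED _. Qed.

Section L2_space.
Context d (T : measurableType d) (R : realType).
Variables (mu : {measure set T -> \bar R}) (D : set T) (mD : measurable D).
Implicit Types f g : T -> R[i].

(** Squared norms avoid square roots of extended reals throughout. *)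
Definition sqnorm f : \bar R := (\int[mu]_(x in D) (normc (f x) ^+ 2)%:E)%E.

Lemma sqnorm_ge0 f : (0 <= sqnorm f)%E.
Proof. by apply: integral_ge0 => x _; rewrite lee_fin sqr_ge0. Qed.

Lemma L2P f : L2 mu D f <-> measurable_cfun D f /\ (sqnorm f < +oo)%E.
Proof.
rewrite /L2/= /L2norm -/(sqnorm f).
have := sqrte_fin_num (sqnorm_ge0 f).
by rewrite !ge0_fin_numE ?sqnorm_ge0 ?sqrte_ge0// => ->.
Qed.

Lemma L2_measurable f : L2 mu D f -> measurable_cfun D f.
Proof. by case. Qed.

Lemma L2_sqnorm_fin f : L2 mu D f -> sqnorm f \is a fin_num.
Proof. by move/L2P => [_]; rewrite ge0_fin_numE ?sqnorm_ge0. Qed.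

Lemma L2norm_le f (M : R) : 0 <= M ->
  (L2norm mu D f <= M%:E)%E = (sqnorm f <= (M ^+ 2)%:E)%E.
Proof.
move=> M0; rewrite /L2norm -/(sqnorm f) -lee_sqr ?lee_fin ?sqrte_ge0//.
by rewrite sqr_sqrte ?sqnorm_ge0// EFin_expe.
Qed.

Lemma measurable_EFin_normc_sqr f : measurable_cfun D f ->
  measurable_fun D (fun x => (normc (f x) ^+ 2)%:E).
Proof. by move=> mf; apply/measurable_EFinP; exact: measurable_normc_sqr. Qed.

Lemma measurable_EFin_normc f : measurable_cfun D f ->
  measurable_fun D (fun x => (normc (f x))%:E).
Proof. by move=> mf; apply/measurable_EFinP; exact: measurable_normc. Qed.

Lemma sqnormE f : sqnorm f = (\int[mu]_(x in D) ((normc (f x))%:E ^+ 2))%E.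
Proof. by apply: eq_integral => x _; rewrite EFin_expe. Qed.

Lemma ae_eq_sqnorm f g : measurable_cfun D f -> measurable_cfun D g ->
  ae_eq mu D f g -> sqnorm f = sqnorm g.
Proof.
move=> mf mg fg; apply: ge0_ae_eq_integral => //.
- exact: measurable_EFin_normc_sqr.
- exact: measurable_EFin_normc_sqr.
- by move=> x _; rewrite lee_fin sqr_ge0.
- by move=> x _; rewrite lee_fin sqr_ge0.
- by apply: filterS fg => x + Dx => /(_ Dx) ->.
Qed.

Lemma sqnorm_eq0 f : measurable_cfun D f -> sqnorm f = 0%E -> ae_eq mu D f (cst 0).
Proof.
move=> mf; rewrite sqnormE => /(ae_eq0_of_int_sqr mD (measurable_EFin_normc mf)).
by apply: filterS => x + Dx => /(_ Dx)/= [] /Normc.eq0_normc.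
Qed.

Lemma sqnormZ (a : R[i]) f : measurable_cfun D f ->
  sqnorm (fun x => a * f x) = ((normc a ^+ 2)%:E * sqnorm f)%E.
Proof.
move=> mf; rewrite /sqnorm -ge0_integralZl_EFin ?sqr_ge0//.
- by apply: eq_integral => x _; rewrite Normc.normcM exprMn EFinM.
- by move=> x _; rewrite lee_fin sqr_ge0.
- exact: measurable_EFin_normc_sqr.
Qed.

Lemma sqnormN f : sqnorm (fun x => - f x) = sqnorm f.
Proof. by apply: eq_integral => x _; rewrite !normc_sqr !cReImE !sqrrN. Qed.

Lemma le_sqnorm f g : measurable_cfun D f -> measurable_cfun D g ->
  (forall x, D x -> normc (f x) <= normc (g x)) -> (sqnorm f <= sqnorm g)%E.
Proof.
move=> mf mg fg; apply: ge0_le_integral => //.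
- by move=> x _; rewrite lee_fin sqr_ge0.
- exact: measurable_EFin_normc_sqr.
- exact: measurable_EFin_normc_sqr.
- by move=> x Dx; rewrite lee_fin ler_sqr ?nnegrE ?normc_ge0// fg.
Qed.

Lemma sqnormD f g (v w : R) : measurable_cfun D f -> measurable_cfun D g ->
  0 <= v -> 0 <= w -> (sqnorm f <= (v ^+ 2)%:E)%E -> (sqnorm g <= (w ^+ 2)%:E)%E ->
  (sqnorm (fun x => (f x + g x)%R) <= ((v + w) ^+ 2)%:E)%E.
Proof.
move=> mf mg v0 w0; rewrite ![sqnorm _]sqnormE => fv gw.
have := @minkowski2 _ _ _ mu _ mD (fun x => (normc (f x))%:E)
  (fun x => (normc (g x))%:E) v w (measurable_EFin_normc mf) (measurable_EFin_normc mg)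
   (fun x _ => normc_ge0 (f x)) (fun x _ => normc_ge0 (g x)) v0 w0 fv gw.
apply: le_trans; apply: ge0_le_integral => //.
- by move=> x _; exact: sqre_ge0.
- by apply: measurable_sqre; apply: measurable_EFin_normc; exact: mcfunD.
- by apply: measurable_sqre; apply: emeasurable_funD; exact: measurable_EFin_normc.
- move=> x Dx; rewrite -EFinD lee_sqr ?lee_fin ?addr_ge0 ?normc_ge0//.
  exact: le_normcD.
Qed.

Lemma L2_sqnorm_le f : L2 mu D f -> exists2 v : R, 0 <= v & sqnorm f = (v ^+ 2)%:E.
Proof.
move=> /L2_sqnorm_fin fin; exists (Num.sqrt (fine (sqnorm f))); rewrite ?sqrtr_ge0//.
by rewrite sqr_sqrtr ?fineK// fine_ge0// sqnorm_ge0.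
Qed.

Lemma L2D f g : L2 mu D f -> L2 mu D g -> L2 mu D (fun x => f x + g x).
Proof.
move=> Lf Lg; have [v v0 fv] := L2_sqnorm_le Lf; have [w w0 gw] := L2_sqnorm_le Lg.
have mf := L2_measurable Lf; have mg := L2_measurable Lg.
apply/L2P; split; first exact: mcfunD.
by apply: le_lt_trans (sqnormD mf mg v0 w0 _ _) (ltry _); rewrite ?fv ?gw.
Qed.

Lemma L2Z (a : R[i]) f : L2 mu D f -> L2 mu D (fun x => a * f x).
Proof.
move=> /[dup] /L2_sqnorm_fin fin /L2P[mf fo]; apply/L2P; split.
  by apply: mcfunM => //; exact: mcfun_cst.
by rewrite sqnormZ// -ge0_fin_numE ?fin_numM// mule_ge0 ?sqnorm_ge0// lee_fin sqr_ge0.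
Qed.

Lemma L2N f : L2 mu D f -> L2 mu D (fun x => - f x).
Proof. by move=> /L2P[mf fo]; apply/L2P; rewrite sqnormN; split => //; exact: mcfunN. Qed.

Lemma L2B f g : L2 mu D f -> L2 mu D g -> L2 mu D (fun x => f x - g x).
Proof. by move=> Lf Lg; apply: L2D => //; exact: L2N. Qed.

Lemma L2_conj f : L2 mu D f -> L2 mu D (fun x => (f x)^*).
Proof.
move=> /L2P[mf fo]; apply/L2P; split; first exact: mcfun_conj.
by rewrite /sqnorm; under eq_integral do rewrite normc_conj.
Qed.

Lemma L2_0 : L2 mu D (fun=> 0).
Proof.
apply/L2P; split; first exact: mcfun_cst.
by rewrite /sqnorm integral0_eq// => x _; rewrite Normc.normc0 expr0n.
Qed.

Lemma L2_sum (I : Type) (r : seq I) (P : pred I) (F : I -> T -> R[i]) :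
  (forall i, L2 mu D (F i)) -> L2 mu D (fun x => \sum_(i <- r | P i) F i x).
Proof.
move=> LF; elim: r => [|i r IH].
  by under eq_fun do rewrite big_nil; exact: L2_0.
by under eq_fun do rewrite big_cons; case: (P i) => //; exact: L2D.
Qed.

End L2_space.

(** * Convergence of absolutely convergent series in L2 *)

Section complex_limit.
Variable R : realType.

(** Componentwise upper limits: defined for every sequence and measurable in
parameters, so no measurable choice of limits has to be made. *)
Definition climit (u : nat -> R[i]) : R[i] :=
  fine (limn_esup (fun n => (complex.Re (u n))%:E)) +i*
  fine (limn_esup (fun n => (complex.Im (u n))%:E)).

Lemma climitE (u : nat -> R[i]) (a b : R) :
  complex.Re (u n) @[n --> \oo] --> a -> complex.Im (u n) @[n --> \oo] --> b ->
  climit u = a +i* b.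
Proof.
have aux (v : nat -> R) (c : R) : v n @[n --> \oo] --> c ->
    fine (limn_esup (fun n => (v n)%:E)) = c.
  move=> vc; have vcE : (v n)%:E @[n --> \oo] --> c%:E by apply: cvg_EFin => //; exact: nearW.
  by rewrite is_cvg_limn_esupE ?(cvg_lim _ vcE)//; apply/cvg_ex; exists c%:E.
by move=> /aux ua /aux ub; rewrite /climit ua ub.
Qed.

Lemma cvg_series_of_abs (a : nat -> R) (B : R) :
  (forall n, \sum_(0 <= k < n) `|a k| <= B) ->
  cvgn (fun n => \sum_(0 <= k < n) a k).
Proof.
move=> aB; apply: (@normed_cvg _ _ a).
apply: nondecreasing_is_cvgn.
  by apply: nondecreasing_series => n _ _; exact: normr_ge0.
by exists B => _ [n _ <-]; exact: aB.
Qed.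

Lemma normc_climit_tail (z : nat -> R[i]) (n : nat) :
  (\sum_(0 <= k <oo) (normc (z k))%:E < +oo)%E ->
  ((normc (climit (fun m => \sum_(0 <= k < m) z k) - \sum_(0 <= k < n) z k)%R)%:E <=
   \sum_(n <= k <oo) (normc (z k))%:E)%E.
Proof.
move=> zoo.
have z0 k : (0 <= (normc (z k))%:E)%E by rewrite lee_fin normc_ge0.
have [B BE] : exists B : R, (\sum_(0 <= k <oo) (normc (z k))%:E = B%:E)%E.
  exists (fine (\sum_(0 <= k <oo) (normc (z k))%:E)%E).
  by rewrite fineK// ge0_fin_numE// nneseries_ge0.
have zB m : \sum_(0 <= k < m) normc (z k) <= B.
  rewrite -lee_fin -BE -sumEFin; apply: (nneseries_lim_ge m) => k _ _; exact: z0.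
have cRe : cvgn (fun m => complex.Re (\sum_(0 <= k < m) z k)).
  under eq_fun do rewrite cRe_sum.
  apply: (@cvg_series_of_abs _ B) => m; apply: le_trans (zB m).
  by apply: ler_sum => k _; exact: abs_Re_le.
have cIm : cvgn (fun m => complex.Im (\sum_(0 <= k < m) z k)).
  under eq_fun do rewrite cIm_sum.
  apply: (@cvg_series_of_abs _ B) => m; apply: le_trans (zB m).
  by apply: ler_sum => k _; exact: abs_Im_le.
rewrite (climitE cRe cIm).
set a := limn _; set b := limn _.
have tE : (\sum_(n <= k <oo) (normc (z k))%:E = (B - \sum_(0 <= k < n) normc (z k))%:E)%E.
  have := @nneseries_split _ (fun k => (normc (z k))%:E) 0 n (fun k _ => z0 k).
  rewrite BE add0n sumEFin EFinB => ->.
  by rewrite [X in (_ = X - _)%E]addeC addeK.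
rewrite tE lee_fin; set t := B - _.
have t0 : 0 <= t by rewrite subr_ge0.
rewrite -ler_sqr ?nnegrE ?normc_ge0// normc_sqr !cReImE/=.
set c := complex.Re _; set e := complex.Im _.
have lim2 : ((complex.Re (\sum_(0 <= k < m) z k) - c) ^+ 2 +
   (complex.Im (\sum_(0 <= k < m) z k) - e) ^+ 2) @[m --> \oo] -->
   ((a - c) ^+ 2 + (b - e) ^+ 2).
  by apply: cvgD; rewrite expr2; under eq_fun do rewrite expr2;
    apply: cvgM; (apply: cvgB; [done|exact: cvg_cst]).
rewrite -(cvg_lim _ lim2)//; apply: limr_le; first by apply/cvg_ex; eexists; exact: lim2.
near=> m.
have nm : (n <= m)%N by near: m; exists n.
have -> : (complex.Re (\sum_(0 <= k < m) z k) - c) ^+ 2 +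
   (complex.Im (\sum_(0 <= k < m) z k) - e) ^+ 2 =
   normc (\sum_(0 <= k < m) z k - \sum_(0 <= k < n) z k) ^+ 2.
  by rewrite normc_sqr !cReImE.
rewrite ler_sqr ?nnegrE ?normc_ge0//.
rewrite (@big_cat_nat _ _ _ n 0 m)//= addrAC subrr add0r.
apply: le_trans (normc_sum _ _ _) _.
rewrite lerBrDl; apply: le_trans (zB m).
by rewrite [leRHS](@big_cat_nat _ _ _ n 0 m)//= addrC.
Unshelve. all: by end_near. Qed.

End complex_limit.

Section L2_completeness.
Context d (T : measurableType d) (R : realType).
Variables (mu : {measure set T -> \bar R}) (D : set T) (mD : measurable D).

Lemma mcfun_climit (u : nat -> T -> R[i]) : (forall n, measurable_cfun D (u n)) ->
  measurable_cfun D (fun x => climit (fun n => u n x)).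
Proof.
move=> mu_; split => /=.
- apply: measurableT_comp => //; apply: measurable_fun_limn_esup => n.
  by apply/measurable_EFinP; case: (mu_ n).
- apply: measurableT_comp => //; apply: measurable_fun_limn_esup => n.
  by apply/measurable_EFinP; case: (mu_ n).
Qed.

(** The pointwise sum is a total function because of [climit]; Minkowski applied to
the tails of [sum_k |v_k|] gives both the rate and the almost everywhere bound. *)
Lemma L2_series (v : nat -> T -> R[i]) (w : nat -> R) (W : R) :
  (forall k, measurable_cfun D (v k)) -> (forall k, 0 <= w k) ->
  (forall k, (sqnorm mu D (v k) <= (w k ^+ 2)%:E)%E) ->
  (forall n, \sum_(0 <= k < n) w k <= W) ->
  exists s : T -> R[i], [/\ measurable_cfun D s,
    (forall n, (sqnorm mu D (fun x => s x - \sum_(0 <= k < n) v k x)%R <=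
       ((W - \sum_(0 <= k < n) w k) ^+ 2)%:E)%E) &
    {ae mu, forall x, D x ->
       ((normc (s x))%:E <= \sum_(0 <= k <oo) (normc (v k x))%:E)%E}].
Proof.
move=> mv w0 vw wW.
pose H k x := (normc (v k x))%:E.
have mH k : measurable_fun D (H k) by exact: measurable_EFin_normc.
have H0 k x : (0 <= H k x)%E by rewrite lee_fin normc_ge0.
have HN k : (\int[mu]_(x in D) (H k x ^+ 2) <= (w k ^+ 2)%:E)%E by rewrite /H -sqnormE.
have mHs : measurable_fun D (fun x => \sum_(0 <= k <oo) H k x)%E.
  by apply: ge0_emeasurable_sum => // k x _ _.
have aeH : {ae mu, forall x, D x -> (\sum_(0 <= k <oo) H k x < +oo)%E}.
  have := @minkowski_series _ _ _ mu D mD H w W mH (fun k x _ => H0 k x) w0 HN wW.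
  move=> intH.
  have /integrable_ae : mu.-integrable D (fun x => (\sum_(0 <= k <oo) H k x) ^+ 2)%E.
    apply/integrableP; split; first exact: measurable_sqre.
    apply: le_lt_trans (ltry (W ^+ 2)); apply: le_trans intH.
    by under eq_integral do rewrite gee0_abs ?sqre_ge0//.
  move=> /(_ mD); apply: filterS => x + Dx => /(_ Dx).
  have : (0 <= \sum_(0 <= k <oo) H k x)%E by exact: nneseries_ge0.
  by case: (limn _) => [r| |]//; rewrite ?ltry.
pose s x := climit (fun n => \sum_(0 <= k < n) v k x).
have ms : measurable_cfun D s by apply: mcfun_climit => n; exact: mcfun_sum.
exists s; split => //.
- move=> n.
  pose H' k x := H (k + n)%N x.
  have mSn : measurable_cfun D (fun x => s x - \sum_(0 <= k < n) v k x).
    by apply: mcfunB => //; exact: mcfun_sum.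
  apply: (@le_trans _ _ (\int[mu]_(x in D) ((\sum_(0 <= k <oo) H' k x) ^+ 2))%E).
    rewrite sqnormE; apply: ae_ge0_le_integral => //.
    + by move=> x _; exact: sqre_ge0.
    + by apply: measurable_sqre; exact: measurable_EFin_normc.
    + by move=> x _; exact: sqre_ge0.
    + apply: measurable_sqre; apply: ge0_emeasurable_sum => [k x Dx _|k _]; [exact: H0|exact: mH].
    apply: filterS aeH => x Hx Dx; have {}Hx := Hx Dx.
    rewrite lee_sqr ?lee_fin ?normc_ge0 ?nneseries_ge0//.
    rewrite /H' (@nneseries_addn _ (fun k => H k x) n)//.
      exact: normc_climit_tail.
    by move=> k _ _; exact: H0.
  apply: (@minkowski_series _ _ _ mu D mD H' (fun k => w (k + n)%N)
    (W - \sum_(0 <= k < n) w k)) => [k|k x _|k|k|m];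
    [exact: mH|exact: H0|exact: w0|exact: HN|].
  rewrite lerBrDl; apply: le_trans (wW (m + n)%N).
  rewrite (@big_cat_nat _ _ _ n 0 (m + n))//= ?leq_addl// lerD2l.
  by rewrite -{2}(add0n n) big_addn addnK.
- apply: filterS aeH => x Hx Dx; have {}Hx := Hx Dx.
  have := normc_climit_tail 0 Hx.
  by rewrite big_geq// subr0.
Qed.

End L2_completeness.

(** * Integration of complex functions and the bilinear pairing *)

Section complex_integral.
Context d (T : measurableType d) (R : realType).
Variables (mu : {measure set T -> \bar R}) (D : set T) (mD : measurable D).
Implicit Types f g : T -> R[i].

Definition cintegrable f : Prop :=
  measurable_cfun D f /\ (\int[mu]_(x in D) (normc (f x))%:E < +oo)%E.

Lemma cintegrable_Re f : cintegrable f ->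
  mu.-integrable D (EFin \o (fun x => complex.Re (f x))).
Proof.
move=> [[f1 f2] foo]; apply/integrableP; split; first exact/measurable_EFinP.
apply: le_lt_trans foo; apply: ge0_le_integral => //.
- by apply: measurableT_comp => //; exact/measurable_EFinP.
- exact: measurable_EFin_normc.
- by move=> x _ /=; rewrite lee_fin abs_Re_le.
Qed.

Lemma cintegrable_Im f : cintegrable f ->
  mu.-integrable D (EFin \o (fun x => complex.Im (f x))).
Proof.
move=> [[f1 f2] foo]; apply/integrableP; split; first exact/measurable_EFinP.
apply: le_lt_trans foo; apply: ge0_le_integral => //.
- by apply: measurableT_comp => //; exact/measurable_EFinP.
- exact: measurable_EFin_normc.
- by move=> x _ /=; rewrite lee_fin abs_Im_le.
Qed.

Lemma cintegrable_norm f : cintegrable f ->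
  mu.-integrable D (EFin \o (fun x => normc (f x))).
Proof.
move=> [mf foo]; apply/integrableP; split; first exact: measurable_EFin_normc.
by under eq_integral do rewrite gee0_abs ?lee_fin ?normc_ge0//.
Qed.

Lemma cintegrableD f g : cintegrable f -> cintegrable g ->
  cintegrable (fun x => f x + g x).
Proof.
move=> [mf foo] [mg goo]; split; first exact: mcfunD.
apply: le_lt_trans (lte_add_pinfty foo goo); rewrite -ge0_integralD//; first last.
- exact: measurable_EFin_normc.
- by move=> x _; rewrite lee_fin normc_ge0.
- exact: measurable_EFin_normc.
- by move=> x _; rewrite lee_fin normc_ge0.
apply: ge0_le_integral => //.
- by move=> x _; rewrite lee_fin normc_ge0.
- by apply: measurable_EFin_normc; exact: mcfunD.
- by apply: emeasurable_funD; exact: measurable_EFin_normc.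
- by move=> x _; rewrite -EFinD lee_fin le_normcD.
Qed.

Lemma cintegrableZ (a : R[i]) f : cintegrable f -> cintegrable (fun x => a * f x).
Proof.
move=> [mf foo]; split; first by apply: mcfunM => //; exact: mcfun_cst.
under eq_integral do rewrite Normc.normcM EFinM.
rewrite ge0_integralZl_EFin ?normc_ge0//.
- by rewrite lte_mul_pinfty// lee_fin normc_ge0.
- by move=> x _; rewrite lee_fin normc_ge0.
- exact: measurable_EFin_normc.
Qed.

Lemma cintegrable0 : cintegrable (fun=> 0).
Proof.
split; first exact: mcfun_cst.
by rewrite integral0_eq// => x _; rewrite Normc.normc0.
Qed.

Lemma cintegralD f g : cintegrable f -> cintegrable g ->
  cintegral mu D (fun x => f x + g x) = cintegral mu D f + cintegral mu D g.
Proof.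
move=> fi gi; rewrite /cintegral.
under [in LHS]eq_Rintegral do rewrite cReD.
under [X in _ +i* X]eq_Rintegral do rewrite cImD.
by rewrite !RintegralD//; [exact: cintegrable_Im|exact: cintegrable_Im|
  exact: cintegrable_Re|exact: cintegrable_Re].
Qed.

Lemma cintegralZ (a : R[i]) f : cintegrable f ->
  cintegral mu D (fun x => a * f x) = a * cintegral mu D f.
Proof.
move=> fi; have iRe := cintegrable_Re fi; have iIm := cintegrable_Im fi.
have iM (r : R) (h : T -> R) : mu.-integrable D (EFin \o h) ->
    mu.-integrable D (EFin \o (fun x => r * h x)).
  move=> ih; have := integrableZl mD r ih.
  by apply: eq_integrable => // x _ /=; rewrite EFinM.
apply: complex_ext; rewrite !cReImE/=.
- under eq_Rintegral do rewrite cReM.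
  rewrite RintegralB//; [|exact: iM..].
  by rewrite !RintegralZl.
- under eq_Rintegral do rewrite cImM.
  rewrite RintegralD//; [|exact: iM..].
  by rewrite !RintegralZl.
Qed.

Lemma cintegral0 : cintegral mu D (fun=> 0) = 0.
Proof. by apply: complex_ext; rewrite /= /Rintegral integral0. Qed.

Lemma cintegrable_sum (I : Type) (r : seq I) (F : I -> T -> R[i]) :
  (forall i, cintegrable (F i)) -> cintegrable (fun x => \sum_(i <- r) F i x).
Proof.
move=> iF; elim: r => [|i r IH].
  by under eq_fun do rewrite big_nil; exact: cintegrable0.
by under eq_fun do rewrite big_cons; exact: cintegrableD.
Qed.

Lemma cintegral_sum (I : Type) (r : seq I) (F : I -> T -> R[i]) :
  (forall i, cintegrable (F i)) ->
  cintegral mu D (fun x => \sum_(i <- r) F i x) = \sum_(i <- r) cintegral mu D (F i).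
Proof.
move=> iF; elim: r => [|i r IH].
  by under [in LHS]eq_fun do rewrite big_nil; rewrite big_nil cintegral0.
under [in LHS]eq_fun do rewrite big_cons.
by rewrite big_cons cintegralD ?IH//; exact: cintegrable_sum.
Qed.

Lemma cintegral_conj f : cintegrable f ->
  cintegral mu D (fun x => (f x)^*) = (cintegral mu D f)^*.
Proof.
move=> fi; apply: complex_ext; rewrite !cReImE/=.
  by apply: eq_Rintegral => x _; rewrite cRe_conj.
under eq_Rintegral do rewrite cIm_conj -mulN1r.
by rewrite RintegralZl ?mulN1r//; exact: cintegrable_Im.
Qed.

Lemma eq_cintegral f g : (forall x, D x -> f x = g x) ->
  cintegral mu D f = cintegral mu D g.
Proof.
by move=> fg; apply: complex_ext => /=; apply: eq_Rintegral => x /set_mem Dx;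
  rewrite fg.
Qed.

(** Multiplying by the conjugate of the integral reduces to real parts. *)
Lemma normc_cintegral_le f : cintegrable f ->
  normc (cintegral mu D f) <= fine (\int[mu]_(x in D) (normc (f x))%:E)%E.
Proof.
move=> fi; set z := cintegral mu D f; set B := fine _.
have B0 : 0 <= B.
  by apply: fine_ge0; apply: integral_ge0 => x _; rewrite lee_fin normc_ge0.
have : normc z ^+ 2 <= normc z * B.
  have -> : normc z ^+ 2 = complex.Re (z^* * z) by rewrite normc_sqr !cReImE; ring.
  rewrite -cintegralZ//= /B -/(Rintegral mu D (fun x => normc (f x))).
  rewrite -RintegralZl//; last exact: cintegrable_norm.
  apply: le_Rintegral => //.
  - exact: (cintegrable_Re (cintegrableZ _ fi)).
  - have := integrableZl mD (normc z) (cintegrable_norm fi).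
    by apply: eq_integrable => // x _ /=; rewrite EFinM.
  - move=> x _; apply: le_trans (ler_norm _) _; apply: le_trans (abs_Re_le _) _.
    by rewrite Normc.normcM normc_conj.
have := normc_ge0 z; rewrite le_eqVlt => /predU1P[<- _ //|z0].
by rewrite expr2 ler_pM2l.
Qed.

Lemma ae_eq_cintegral f g : measurable_cfun D f -> measurable_cfun D g ->
  ae_eq mu D f g -> cintegral mu D f = cintegral mu D g.
Proof.
move=> [f1 f2] [g1 g2] fg; apply: complex_ext => /=; congr fine;
  apply: ae_eq_integral => //; try exact/measurable_EFinP;
  by apply: filterS fg => x + Dx => /(_ Dx) ->.
Qed.

End complex_integral.

Section L2_pairing.
Context d (T : measurableType d) (R : realType).
Variables (mu : {measure set T -> \bar R}) (D : set T) (mD : measurable D).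
Implicit Types f g h : T -> R[i].

Local Notation sqn := (sqnorm mu D).
Local Notation L2 := (L2 mu D).

Lemma cintegrableM f g : L2 f -> L2 g -> cintegrable mu D (fun x => f x * g x).
Proof.
move=> /L2P[mf foo] /L2P[mg goo]; split; first exact: mcfunM.
apply: le_lt_trans (lte_add_pinfty foo goo); rewrite -ge0_integralD//; first last.
- exact: measurable_EFin_normc_sqr.
- by move=> x _; rewrite lee_fin sqr_ge0.
- exact: measurable_EFin_normc_sqr.
- by move=> x _; rewrite lee_fin sqr_ge0.
apply: ge0_le_integral => //.
- by move=> x _; rewrite lee_fin normc_ge0.
- by apply: measurable_EFin_normc; exact: mcfunM.
- by apply: emeasurable_funD; exact: measurable_EFin_normc_sqr.
- move=> x _; rewrite -EFinD lee_fin Normc.normcM.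
  by have := normc_ge0 (f x); have := normc_ge0 (g x); nra.
Qed.

(** Bilinear rather than sesquilinear: kernels act by [int k(x, y) f(y) dy], without
conjugation. *)
Definition cpair f g : R[i] := cintegral mu D (fun x => f x * g x).

Lemma cpairDl f g h : L2 f -> L2 g -> L2 h ->
  cpair (fun x => f x + g x) h = cpair f h + cpair g h.
Proof.
move=> Lf Lg Lh; rewrite /cpair; under eq_fun do rewrite mulrDl.
by rewrite cintegralD//; exact: cintegrableM.
Qed.

Lemma cpairZl (a : R[i]) f g : L2 f -> L2 g ->
  cpair (fun x => a * f x) g = a * cpair f g.
Proof.
move=> Lf Lg; rewrite /cpair; under eq_fun do rewrite -mulrA.
by rewrite cintegralZ//; exact: cintegrableM.
Qed.

Lemma cpairC f g : cpair f g = cpair g f.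
Proof. by rewrite /cpair; congr cintegral; apply/funext => x; rewrite mulrC. Qed.

Definition rip f g : R := complex.Re (cpair f (fun x => (g x)^*)).

Lemma ripC f g : L2 f -> L2 g -> rip f g = rip g f.
Proof.
move=> Lf Lg; rewrite /rip /cpair.
rewrite -[in RHS]cRe_conj -cintegral_conj//; last first.
  by apply: cintegrableM => //; exact: L2_conj.
congr complex.Re; congr cintegral; apply/funext => x.
by rewrite rmorphM /= conjcK mulrC.
Qed.

Lemma ripDl f g h : L2 f -> L2 g -> L2 h ->
  rip (fun x => f x + g x) h = rip f h + rip g h.
Proof. by move=> Lf Lg Lh; rewrite /rip cpairDl ?cReD//; exact: L2_conj. Qed.

Lemma ripZl (a : R) f g : L2 f -> L2 g ->
  rip (fun x => a%:C * f x) g = a * rip f g.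
Proof.
move=> Lf Lg; rewrite /rip cpairZl ?cReM/= ?mul0r ?subr0//; exact: L2_conj.
Qed.

Lemma rip_self f : L2 f -> rip f f = fine (sqn f).
Proof.
move=> Lf; rewrite /rip /cpair /= /Rintegral; congr fine; apply: eq_integral => x _.
by congr EFin; rewrite normc_sqr !cReImE; ring.
Qed.

Lemma rip_self_ge0 f : L2 f -> 0 <= rip f f.
Proof. by move=> Lf; rewrite rip_self// fine_ge0// sqnorm_ge0. Qed.

Lemma rip_sqrD (t : R) f g : L2 f -> L2 g ->
  rip (fun x => f x + t%:C * g x) (fun x => f x + t%:C * g x) =
  rip f f + 2 * t * rip f g + t ^+ 2 * rip g g.
Proof.
move=> Lf Lg; have Ltg : L2 (fun x => t%:C * g x) by exact: L2Z.
have Ls : L2 (fun x => f x + t%:C * g x) by exact: L2D.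
rewrite ripDl// ripZl// (ripC Lf Ls) (ripC Lg Ls) !ripDl// !ripZl//.
by rewrite (ripC Lg Lf); ring.
Qed.

Lemma rip_cauchy_schwarz f g : L2 f -> L2 g -> (rip f g) ^+ 2 <= rip f f * rip g g.
Proof.
move=> Lf Lg; rewrite -(real_normK (num_real (rip f g))) mulrC.
apply: sqr_le_mul_of_half_sqr; rewrite ?rip_self_ge0//.
move=> t t0; have H (s : R) : 0 <= rip f f + 2 * s * rip f g + s ^+ 2 * rip g g.
  by rewrite -rip_sqrD// rip_self_ge0//; apply: L2D => //; exact: L2Z.
have ti0 : 0 < t^-1 by rewrite invr_gt0.
have tt : t * t^-1 = 1 by rewrite divff// gt_eqF.
have H1 := H t; have H2 := H (- t).
have : 0 <= t^-1 * (rip f f + 2 * t * rip f g + t ^+ 2 * rip g g) by rewrite mulr_ge0// ltW.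
have : 0 <= t^-1 * (rip f f + 2 * - t * rip f g + (- t) ^+ 2 * rip g g) by rewrite mulr_ge0// ltW.
have -> : t^-1 * (rip f f + 2 * - t * rip f g + (- t) ^+ 2 * rip g g) =
   t^-1 * rip f f - 2 * rip f g * (t * t^-1) + t * (t * t^-1) * rip g g by ring.
have -> : t^-1 * (rip f f + 2 * t * rip f g + t ^+ 2 * rip g g) =
   t^-1 * rip f f + 2 * rip f g * (t * t^-1) + t * (t * t^-1) * rip g g by ring.
by rewrite tt !mulr1 ler_norml => A B; apply/andP; split; lra.
Qed.

End L2_pairing.

(** * Riesz representation *)

Lemma le0_of_le_half_pow (R : realType) (x C : R) :
  (forall n : nat, x <= C * 2^-1 ^+ n) -> x <= 0.
Proof.
move=> H; rewrite leNgt; apply/negP => x0.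
have C0 : 0 < C by have := H 0%N; rewrite expr0 mulr1; exact: lt_le_trans.
pose n := Num.truncn (C / x).
have nE : C / x < n.+1%:R by exact: truncnS_gt.
have := H n.+1; apply/negP; rewrite -ltNge exprVn ltr_pdivrMr ?exprn_gt0//.
rewrite ltr_pdivrMr// mulrC in nE; apply: lt_trans nE _.
by rewrite ltr_pM2l// -natrX ltr_nat ltn_expl.
Qed.

Lemma real_complexN1 (R : realType) : (-1)%:C = -1 :> R[i].
Proof. by apply: complex_ext; rewrite /= ?oppr0. Qed.

Section riesz.
Context d (T : measurableType d) (R : realType).
Variables (mu : {measure set T -> \bar R}) (D : set T) (mD : measurable D).
Implicit Types f g h : T -> R[i].

Local Notation sqn := (sqnorm mu D).
Local Notation L2 := (L2 mu D).
Local Notation ripm := (rip mu D).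

Variables (l : (T -> R[i]) -> R[i]) (M : R).
Hypothesis M0 : 0 <= M.
Hypothesis l_lin : forall (a : R[i]) f g, L2 f -> L2 g ->
  l (fun x => a * f x + g x) = a * l f + l g.
Hypothesis l_bnd : forall f, L2 f -> (((normc (l f)) ^+ 2)%:E <= (M ^+ 2)%:E * sqn f)%E.

Let J f := ripm f f - 2 * complex.Re (l f).

Let lB f : L2 f -> normc (l f) ^+ 2 <= M ^+ 2 * ripm f f.
Proof.
move=> Lf; rewrite rip_self// -lee_fin [leRHS]EFinM fineK ?l_bnd//.
exact: L2_sqnorm_fin Lf.
Qed.

Let J_ge f : L2 f -> - M ^+ 2 <= J f.
Proof.
move=> Lf; rewrite /J.
have r0 := rip_self_ge0 Lf.
have : complex.Re (l f) ^+ 2 <= M ^+ 2 * ripm f f.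
  by apply: le_trans (lB Lf); rewrite normc_sqr lerDl sqr_ge0.
move: (ripm f f) (complex.Re (l f)) r0 => A b A0 H.
have H2 : (2 * b) ^+ 2 <= (A + M ^+ 2) ^+ 2.
  have := sqr_ge0 (A - M ^+ 2); nra.
have : 2 * b <= A + M ^+ 2.
  apply: le_trans (ler_norm _) _.
  by rewrite -ler_sqr ?nnegrE ?addr_ge0 ?sqr_ge0// real_normK ?num_real.
lra.
Qed.

Let lD f g : L2 f -> L2 g -> l (fun x => f x + g x) = l f + l g.
Proof.
move=> Lf Lg; have := l_lin 1 Lf Lg; rewrite mul1r => <-.
by congr l; apply/funext => x; rewrite mul1r.
Qed.

Let l0 : l (fun=> 0) = 0.
Proof.
have := lD (L2_0 mu D) (L2_0 mu D).
rewrite (_ : (fun=> 0 + 0) = (fun=> 0 : R[i])); last by apply/funext => x; rewrite addr0.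
by move/eqP; rewrite -subr_eq0 opprD addrA subrr sub0r oppr_eq0 => /eqP.
Qed.

Let lZ a f : L2 f -> l (fun x => a * f x) = a * l f.
Proof.
move=> Lf; have := l_lin a Lf (L2_0 mu D); rewrite l0 addr0 => <-.
by congr l; apply/funext => x; rewrite addr0.
Qed.

Let m := inf [set J f | f in L2].

Let m_le f : L2 f -> m <= J f.
Proof.
move=> Lf; apply: ge_inf; last by exists f.
by exists (- M ^+ 2) => _ [g Lg <-]; exact: J_ge.
Qed.

Let minimizing (n : nat) : exists f, L2 f /\ J f <= m + 4^-1 ^+ n.
Proof.
have hinf : has_inf [set J f | f in L2].
  split; first by exists (J (fun=> 0)), (fun=> 0) => //; exact: L2_0.
  by exists (- M ^+ 2) => _ [g Lg <-]; exact: J_ge.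
have e0 : 0 < 4^-1 ^+ n :> R by rewrite exprn_gt0// invr_gt0.
have [_ [f Lf <-] Jf] := inf_adherent e0 hinf.
by exists f; split => //; exact: ltW.
Qed.

(** Parallelogram identity: almost minimizers are close to each other. *)
Let J_close f g e : L2 f -> L2 g -> J f <= m + e -> J g <= m + e ->
  ripm (fun x => g x + (-1)%:C * f x) (fun x => g x + (-1)%:C * f x) <= 4 * e.
Proof.
move=> Lf Lg Jf Jg.
have Lh : L2 (fun x => g x + f x) by exact: L2D.
have L2h : L2 (fun x => (2^-1)%:C * (g x + f x)) by exact: L2Z.
have := m_le L2h; rewrite /J lZ// lD// cReM/= mul0r subr0 cReD.
rewrite ripZl// ripC// ripZl//.
have -> : (fun x => g x + f x) = (fun x => g x + 1%:C * f x).
  by apply/funext => x; rewrite mul1r.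
rewrite !rip_sqrD//; rewrite /J in Jf Jg.
by set a := ripm g g; set b := ripm f f; set c := ripm g f; move=> H; lra.
Qed.

(** The representing function minimizes [|f|^2 - 2 Re l(f)].  Near minimizers form a
fast Cauchy sequence by the parallelogram identity, and the first variation at the
limit gives [Re l]; the imaginary part follows by applying this to [i f]. *)
Lemma riesz_representation : exists g, [/\ L2 g, (sqn g <= (M ^+ 2)%:E)%E &
  forall f, L2 f -> l f = cpair mu D f g].
Proof.
have [F FP] := @choice _ _ (fun n f => L2 f /\ J f <= m + 4^-1 ^+ n) minimizing.
have LF n : L2 (F n) by case: (FP n).
have JF n : J (F n) <= m + 4^-1 ^+ n by case: (FP n).
pose v k x := F k.+1 x + (-1)%:C * F k x.
have Lv k : L2 (v k) by apply: L2D => //; exact: L2Z.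
pose w k : R := 2 * 2^-1 ^+ k.
have w0 k : 0 <= w k by rewrite mulr_ge0// exprn_ge0// invr_ge0.
have quarter k : 4^-1 ^+ k = (2^-1 ^+ k) ^+ 2 :> R.
  by rewrite -exprM mulnC exprM; congr (_ ^+ _); lra.
have vw k : (sqn (v k) <= (w k ^+ 2)%:E)%E.
  rewrite -(fineK (L2_sqnorm_fin (Lv k))) lee_fin -rip_self//.
  apply: (le_trans (J_close (e := 4^-1 ^+ k) (LF k) (LF k.+1) (JF k) _)).
    apply: (le_trans (JF k.+1)); rewrite lerD2l exprS ler_piMl// ?exprn_ge0 ?invr_ge0//.
    by rewrite invf_le1 ?ler1n.
  by rewrite /w exprMn quarter expr2; lra.
have sumw n : \sum_(0 <= k < n) w k = 4 - 4 * 2^-1 ^+ n.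
  elim: n => [|n IH]; first by rewrite big_geq// expr0; lra.
  by rewrite big_nat_recr//= IH /w exprS; lra.
have wW n : \sum_(0 <= k < n) w k <= 4.
  by rewrite sumw lerBlDr lerDl mulr_ge0// exprn_ge0// invr_ge0.
have [s [ms sN _]] := L2_series mD (fun k => L2_measurable (Lv k)) w0 vw wW.
have telescope n x : \sum_(0 <= k < n) v k x = F n x - F 0%N x.
  elim: n => [|n IH]; first by rewrite big_geq// subrr.
  by rewrite big_nat_recr//= IH /v real_complexN1; ring.
pose g x := F 0%N x + s x.
have Ls : L2 s.
  apply/L2P; split => //; have := sN 0%N.
  rewrite big_geq// (_ : (fun x => _) = s); last first.
    by apply/funext => x; rewrite big_geq// subr0.
  by move=> /le_lt_trans; apply; exact: ltry.
have Lg : L2 g by exact: L2D.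
have gF n : ripm (fun x => g x + (-1)%:C * F n x) (fun x => g x + (-1)%:C * F n x) <=
    16 * 4^-1 ^+ n.
  have Ld : L2 (fun x => g x + (-1)%:C * F n x) by apply: L2D => //; exact: L2Z.
  rewrite rip_self// -lee_fin fineK ?(L2_sqnorm_fin Ld)//.
  have := sN n; rewrite sumw (_ : (fun x => s x - _) = (fun x => g x + (-1)%:C * F n x)).
    move=> /le_trans; apply; rewrite lee_fin quarter.
    by rewrite (_ : 4 - _ = 4 * 2^-1 ^+ n) ?exprMn//; [lra|ring].
  by apply/funext => x; rewrite telescope real_complexN1 /g; ring.
have key h : L2 h -> ripm g h = complex.Re (l h).
  move=> Lh; have A0 := rip_self_ge0 Lh; set A := ripm h h in A0.
  have dn n : (ripm (F n) h - complex.Re (l h)) ^+ 2 <= (A + 1) * 4^-1 ^+ n.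
    (* The step minimizing the quadratic in [t], up to the shift that avoids [A = 0]. *)
    set dd := _ - _; pose t := - dd / (A + 1).
    have Lt : L2 (fun x => F n x + t%:C * h x) by apply: L2D => //; exact: L2Z.
    have := m_le Lt; rewrite {1}/J lD//; last exact: L2Z.
    rewrite lZ// cReD cReM/= mul0r subr0 rip_sqrD//.
    have := JF n; rewrite /J -/A => H1 H2.
    have : 0 <= 2 * t * dd + t ^+ 2 * A + 4^-1 ^+ n by rewrite /dd; lra.
    have -> : 2 * t * dd + t ^+ 2 * A = - (dd ^+ 2 / (A + 1)) - (dd / (A + 1)) ^+ 2.
      by rewrite /t; field; lra.
    have := sqr_ge0 (dd / (A + 1)) => H3 H4.
    have : dd ^+ 2 / (A + 1) <= 4^-1 ^+ n by lra.
    by rewrite ler_pdivrMr; [rewrite mulrC|lra].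
  have gn n : (ripm g h - ripm (F n) h) ^+ 2 <= 16 * 4^-1 ^+ n * A.
    have Ld : L2 (fun x => g x + (-1)%:C * F n x) by apply: L2D => //; exact: L2Z.
    have -> : ripm g h - ripm (F n) h = ripm (fun x => g x + (-1)%:C * F n x) h.
      by rewrite ripDl//; [rewrite ripZl// mulN1r|exact: L2Z].
    apply: le_trans (rip_cauchy_schwarz mD Ld Lh) _.
    by rewrite ler_wpM2r.
  apply/eqP; rewrite -subr_eq0 -sqrf_eq0 eq_le sqr_ge0 andbT.
  apply: (@le0_of_le_half_pow _ _ (2 * (A + 1) + 32 * A)) => n.
  have q : 4^-1 ^+ n <= 2^-1 ^+ n :> R.
    by rewrite lerXn2r ?nnegrE ?invr_ge0//; lra.
  have := dn n; have := gn n.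
  have := sqr_ge0 ((ripm g h - ripm (F n) h) - (ripm (F n) h - complex.Re (l h))).
  have q0 : 0 <= 4^-1 ^+ n :> R by rewrite exprn_ge0// invr_ge0.
  move: (ripm g h) (ripm (F n) h) (complex.Re (l h)) q q0 => a b c.
  move: (4^-1 ^+ n) (2^-1 ^+ n) => q p qp q0 H1 H2 H3.
  apply: (@le_trans _ _ ((2 * (A + 1) + 32 * A) * q)).
    have -> : (a - c) ^+ 2 = ((a - b) + (b - c)) ^+ 2 by congr (_ ^+ 2); ring.
    by rewrite sqrrD; move: H1; rewrite sqrrB; lra.
  by rewrite ler_wpM2l//; lra.
exists (fun x => (g x)^*); split; first exact: L2_conj.
  rewrite (_ : sqn _ = sqn g); last by apply: eq_integral => x _; rewrite normc_conj.
  rewrite -(fineK (L2_sqnorm_fin Lg)) lee_fin -rip_self//.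
  have := lB Lg; have r0 := rip_self_ge0 Lg.
  have /(_ Lg) := key g; rewrite normc_sqr => <-.
  move: (ripm g g) r0 => r r0 H; have := sqr_ge0 (complex.Im (l g)) => H2.
  have [->|rn0] := eqVneq r 0; first exact: sqr_ge0.
  have rp : 0 < r by rewrite lt_neqAle eq_sym rn0.
  by rewrite -(ler_pM2r rp) -expr2; lra.
move=> f Lf; apply: complex_ext.
  by rewrite -key// ripC.
have Lif : L2 (fun x => 'i * f x) by exact: L2Z.
have := key _ Lif; rewrite ripC// lZ// /ripm cpairZl//; last exact: L2_conj.
by rewrite !cReM/= !mul0r !mul1r !sub0r => /oppr_inj.
Qed.

End riesz.

(** * Operators and finite rank decompositions *)

Section L2_projection.
Context d (T : measurableType d) (R : realType).
Variables (mu : {measure set T -> \bar R}) (D : set T) (mD : measurable D).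
Implicit Types f g h u : T -> R[i].

Local Notation sqn := (sqnorm mu D).
Local Notation L2 := (L2 mu D).

Lemma L2_rip_EFin f : L2 f -> (rip mu D f f)%:E = sqn f.
Proof. by move=> Lf; rewrite rip_self// fineK//; exact: L2_sqnorm_fin Lf. Qed.

Lemma cpair_cauchy_schwarz f g : L2 f -> L2 g ->
  (((normc (cpair mu D f g)) ^+ 2)%:E <= sqn f * sqn g)%E.
Proof.
move=> Lf Lg; have [mf mg] := (L2_measurable Lf, L2_measurable Lg).
have fgi := cintegrableM mD Lf Lg.
have := normc_cintegral_le mD fgi; rewrite -/(cpair mu D f g).
set I := (\int[mu]_(x in D) _)%E => cI.
have I0 : (0 <= I)%E by apply: integral_ge0 => x _; rewrite lee_fin normc_ge0.
have Ifin : I \is a fin_num by rewrite ge0_fin_numE//; case: fgi.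
apply: (@le_trans _ _ (I ^+ 2)%E).
  rewrite -(fineK Ifin) -EFin_expe lee_fin ler_sqr ?nnegrE ?normc_ge0//.
  exact: fine_ge0.
rewrite !sqnormE /I.
under eq_integral do rewrite Normc.normcM EFinM.
apply: cauchy_schwarz_ge0 => //.
- exact: measurable_EFin_normc.
- exact: measurable_EFin_normc.
- by move=> x _; rewrite lee_fin normc_ge0.
- by move=> x _; rewrite lee_fin normc_ge0.
Qed.

(** Thus splitting off the component along a unit vector keeps an operator bound,
which is what the induction on the rank relies on. *)
Lemma sqnorm_projection_le f u : L2 f -> L2 u -> sqn u = 1%E ->
  (sqn (fun x => f x - cpair mu D f (fun y => (u y)^*) * u x)%R <= sqn f)%E.
Proof.
move=> Lf Lu u1; set c := cpair _ _ _ _.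
have Lcu : L2 (fun x => c * u x) by exact: L2Z.
have -> : (fun x => f x - c * u x) = (fun x => f x + (-1)%:C * (c * u x)).
  by apply/funext => x; rewrite real_complexN1 mulN1r.
have Ld : L2 (fun x => f x + (-1)%:C * (c * u x)) by apply: L2D => //; exact: L2Z.
rewrite -!L2_rip_EFin// lee_fin rip_sqrD//.
have -> : rip mu D f (fun x => c * u x) = normc c ^+ 2.
  rewrite /rip cpairC (_ : (fun x => (c * u x)^*) = (fun x => c^* * (u x)^*)); last first.
    by apply/funext => x; rewrite rmorphM.
  rewrite cpairZl//; last exact: L2_conj.
  by rewrite cpairC -/c normc_sqr !cReImE; ring.
have -> : rip mu D (fun x => c * u x) (fun x => c * u x) = normc c ^+ 2.
  apply: EFin_inj; rewrite L2_rip_EFin// sqnormZ ?u1 ?mule1//.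
  exact: L2_measurable Lu.
by rewrite -subr_ge0; have := sqr_ge0 (normc c); lra.
Qed.

End L2_projection.

Section operators_on_L2.
Variable R : realType.

Local Notation leb := (@lebesgue_measure R).
Local Notation Rp := (@Rplus R).
Local Notation sqnormp := (sqnorm leb Rp).
Local Notation cpairp := (cpair leb Rp).

Lemma measurable_Rplus : measurable Rp.
Proof. exact: measurable_itv. Qed.

Local Notation mRp := measurable_Rplus.

Implicit Types (f g : cfun R) (A B K : op R).

(** [bounded_op] without the norm, which [op_bound] controls quantitatively. *)
Definition linear_op A : Prop :=
  (forall f, L2p f -> L2p (A f)) /\
  (forall (a : R[i]) f g, L2p f -> L2p g ->
     ae_eq leb Rp (A (fun x => a * f x + g x)) (fun x => a * A f x + A g x)).

(** Compared with [opnorm], a bound valid for every [f] and in squared form; the two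
are equivalent by homogeneity. *)
Definition op_bound A (M : R) : Prop :=
  forall f, L2p f -> (sqnormp (A f) <= (M ^+ 2)%:E * sqnormp f)%E.

Lemma L2p_measurable f : L2p f -> measurable_cfun Rp f.
Proof. by case. Qed.

Lemma ae_eq_cpair f f' g : L2p f -> L2p f' -> L2p g ->
  ae_eq leb Rp f f' -> cpairp f g = cpairp f' g.
Proof.
move=> Lf Lf' Lg ff'; apply: ae_eq_cintegral => //.
- exact: mRp.
- by apply: mcfunM; exact: L2p_measurable.
- by apply: mcfunM; exact: L2p_measurable.
- by apply: filterS ff' => x + Dx => /(_ Dx) ->.
Qed.

Lemma linear_op_zero A : linear_op A -> ae_eq leb Rp (A (fun=> 0)) (fun=> 0).
Proof.
move=> [_ lA]; have := lA 1 _ _ (L2_0 leb Rp) (L2_0 leb Rp).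
rewrite (_ : (fun x : measurableTypeR R => 1 * 0 + 0 : R[i]) = fun=> 0); last first.
  by apply/funext => x; rewrite mulr0 addr0.
apply: filterS => x + Dx => /(_ Dx) /eqP.
by rewrite mul1r -subr_eq0 opprD addrA subrr sub0r oppr_eq0 => /eqP.
Qed.

Lemma linear_opZ A (a : R[i]) f : linear_op A -> L2p f ->
  ae_eq leb Rp (A (fun x => a * f x)) (fun x => a * A f x).
Proof.
move=> lA Lf; have := lA.2 a _ _ Lf (L2_0 leb Rp).
rewrite (_ : (fun x : measurableTypeR R => a * f x + 0) = fun x => a * f x); last first.
  by apply/funext => x; rewrite addr0.
apply: filterS2 (linear_op_zero lA) => x A0 Af Dx.
by rewrite Af// A0// addr0.
Qed.

Lemma linear_opB A B : linear_op A -> linear_op B ->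
  linear_op (fun f x => A f x - B f x).
Proof.
move=> [LA lA] [LB lB]; split.
  by move=> f Lf; apply: L2B; [exact: mRp|exact: LA|exact: LB].
move=> a f g Lf Lg; apply: filterS2 (lA a f g Lf Lg) (lB a f g Lf Lg).
by move=> x Ax Bx Dx; rewrite Ax// Bx//; ring.
Qed.

Lemma op_bound_opnorm A (M : R) : 0 <= M -> op_bound A M -> (opnorm A <= M%:E)%E.
Proof.
move=> M0 AM; apply: ub_ereal_sup => _ [f [Lf f1] <-].
rewrite /norm2 L2norm_le//; apply: le_trans (AM f Lf) _.
move: f1; rewrite /norm2 L2norm_le// expr1n => f1.
by rewrite -[leRHS]mule1 lee_wpmul2l// lee_fin sqr_ge0.
Qed.

(** By homogeneity: [A] is tested on multiples of [f] in the unit ball. *)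
Lemma opnorm_op_bound A (M : R) : 0 <= M -> linear_op A -> (opnorm A <= M%:E)%E ->
  op_bound A M.
Proof.
move=> M0 lA AM f Lf.
have [LA _] := lA.
have unit_ball g : L2p g -> (sqnormp g <= 1)%E -> (sqnormp (A g) <= (M ^+ 2)%:E)%E.
  move=> Lg g1; rewrite -L2norm_le//; apply: le_trans AM.
  apply: ereal_sup_ubound; exists g => //; split => //.
  by rewrite /norm2 L2norm_le// expr1n.
have scale (c : R) : (sqnormp (A (fun x => c%:C * f x)%R) = (c ^+ 2)%:E * sqnormp (A f))%E.
  rewrite (ae_eq_sqnorm mRp _ _ (linear_opZ c%:C lA Lf)).
  - rewrite sqnormZ//; [|exact: mRp|exact: L2p_measurable (LA _ Lf)].
    by rewrite normc_real real_normK ?num_real.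
  - by apply: L2p_measurable; apply: LA; apply: L2Z => //; exact: mRp.
  - by apply: L2p_measurable; apply: L2Z; [exact: mRp|exact: LA].
have scalef (c : R) : (sqnormp (fun x => c%:C * f x)%R = (c ^+ 2)%:E * sqnormp f)%E.
  rewrite sqnormZ//; [|exact: mRp|exact: L2p_measurable Lf].
  by rewrite normc_real real_normK ?num_real.
have [v v0 fv] := L2_sqnorm_le Lf; have [w w0 Aw] := L2_sqnorm_le (LA _ Lf).
have test (c : R) : (c * v) ^+ 2 <= 1 -> (c * w) ^+ 2 <= M ^+ 2.
  move=> cv; rewrite -lee_fin exprMn EFinM -Aw -scale; apply: unit_ball.
    by apply: L2Z => //; exact: mRp.
  by rewrite scalef fv -EFinM -exprMn lee_fin.
rewrite Aw fv -EFinM lee_fin -exprMn ler_sqr ?nnegrE ?mulr_ge0//.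
have [v_eq0|vn0] := eqVneq v 0.
  rewrite v_eq0 mulr0; rewrite leNgt; apply/negP => wp.
  have := test ((M + 1) / w); rewrite v_eq0 mulr0 expr0n/= ler01 => /(_ isT).
  by rewrite divfK ?gt_eqF//; nra.
have vp : 0 < v by rewrite lt_neqAle eq_sym vn0.
have := test v^-1; rewrite mulVf// expr1n lexx => /(_ isT).
have vi : 0 < v^-1 by rewrite invr_gt0.
have viw : 0 <= v^-1 * w by rewrite mulr_ge0// ltW.
by rewrite ler_sqr ?nnegrE// mulrC ler_pdivrMr.
Qed.

Lemma bounded_linear_op A : bounded_op A -> linear_op A.
Proof. by case. Qed.

Lemma linear_bounded_op A (M : R) : 0 <= M -> linear_op A -> op_bound A M ->
  bounded_op A.
Proof.
move=> M0 [LA lA] AM; split => //.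
by apply: le_lt_trans (op_bound_opnorm M0 AM) _; exact: ltry.
Qed.

Lemma opnorm_ge0 A : linear_op A -> (0 <= opnorm A)%E.
Proof.
move=> _; apply: (@le_trans _ _ (norm2 (A (fun=> 0)))); first exact: sqrte_ge0.
apply: ereal_sup_ubound; exists (fun=> 0) => //; split; first exact: L2_0.
rewrite /norm2 L2norm_le// expr1n /sqnorm integral0_eq// => x _.
by rewrite Normc.normc0 expr0n.
Qed.

Lemma op_bound_le A (M M' : R) : 0 <= M -> M <= M' -> op_bound A M -> op_bound A M'.
Proof.
move=> M0 MM' AM f Lf; apply: le_trans (AM f Lf) _.
apply: lee_wpmul2r; first exact: sqnorm_ge0.
by rewrite lee_fin ler_sqr// nnegrE; lra.
Qed.

Lemma op_boundB A B (M M' : R) : linear_op A -> linear_op B -> 0 <= M -> 0 <= M' ->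
  op_bound A M -> op_bound B M' -> op_bound (fun f x => A f x - B f x) (M + M').
Proof.
move=> [LA _] [LB _] M0 M'0 AM BM f Lf; have [v v0 fv] := L2_sqnorm_le Lf.
have E (a b : R) : (a ^+ 2)%:E = ((a ^+ 2)%:E : \bar R) by [].
rewrite fv -EFinM -exprMn mulrDl; apply: sqnormD; rewrite ?mulr_ge0//.
- exact: mRp.
- exact: L2p_measurable (LA _ Lf).
- by apply: mcfunN; exact: L2p_measurable (LB _ Lf).
- by rewrite exprMn EFinM -fv; exact: AM.
- by rewrite sqnormN exprMn EFinM -fv; exact: BM.
Qed.

(** Families indexed by natural numbers make it possible to concatenate and extend
spanning families without dependent types. *)
Lemma rank_leP n A : rank_le n A <->
  exists e : nat -> cfun R, (forall i, L2p (e i)) /\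
    forall f, L2p f -> exists c : nat -> R[i],
      ae_eq leb Rp (A f) (fun x => \sum_(0 <= i < n) c i * e i x).
Proof.
split=> [[e [Le eA]]|[e [Le eA]]].
  exists (fun i => if insub i is Some j then e j else fun=> 0); split.
    by move=> i; case: insubP => // _; exact: L2_0.
  move=> f Lf; have [c cA] := eA f Lf.
  exists (fun i => if insub i is Some j then c j else 0).
  apply: filterS cA => x + Dx => /(_ Dx) ->.
  by rewrite big_mkord; apply: eq_bigr => i _; rewrite valK.
exists (fun i => e i); split => // f Lf; have [c cA] := eA f Lf.
exists (fun i => c i); apply: filterS cA => x + Dx => /(_ Dx) ->.
by rewrite big_mkord.
Qed.

Lemma rank_leB m n A B : rank_le m A -> rank_le n B ->
  rank_le (m + n) (fun f x => A f x - B f x).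
Proof.
move=> /rank_leP[e [Le eA]] /rank_leP[e' [Le' eB]]; apply/rank_leP.
exists (fun i => if (i < m)%N then e i else e' (i - m)%N); split.
  by move=> i; case: ifP.
move=> f Lf; have [c cA] := eA f Lf; have [c' cB] := eB f Lf.
exists (fun i => if (i < m)%N then c i else - c' (i - m)%N).
apply: filterS2 cA cB => x Ax Bx Dx; rewrite Ax// Bx//.
rewrite (@big_cat_nat _ _ _ m 0 (m + n))//= ?leq_addr//; congr (_ + _).
  by apply: eq_big_nat => i /andP[_ im]; rewrite im.
rewrite -{1}(add0n m) big_addn addKn -sumrN; apply: eq_bigr => i _.
by rewrite ltnNge leq_addl/= addnK mulNr.
Qed.

Lemma rank_le_mono m n A : (m <= n)%N -> rank_le m A -> rank_le n A.
Proof.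
move=> mn /rank_leP[e [Le eA]]; apply/rank_leP; exists e; split => // f Lf.
have [c cA] := eA f Lf; exists (fun i => if (i < m)%N then c i else 0).
apply: filterS cA => x + Dx => /(_ Dx) ->.
rewrite (@big_cat_nat _ _ _ m 0 n)//= [X in _ = _ + X]big1_seq ?addr0; last first.
  by move=> i; rewrite mem_index_iota => /andP[_ /andP[mi _]]; rewrite ltnNge mi/= mul0r.
by apply: eq_big_nat => i /andP[_ im]; rewrite im.
Qed.

End operators_on_L2.

Section finite_rank.
Variable R : realType.

Local Notation leb := (@lebesgue_measure R).
Local Notation Rp := (@Rplus R).
Local Notation sqnormp := (sqnorm leb Rp).
Local Notation cpairp := (cpair leb Rp).
Local Notation mRp := (@measurable_Rplus R).

Implicit Types (f g : cfun R) (A B K : op R).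

(** Induction on the rank: project the range onto the last spanning vector, represent
the coefficient functional by Riesz, and continue with the complementary part, whose
bound has not increased. *)
Lemma finite_rank_decomposition n K (M : R) : 0 <= M ->
  linear_op K -> op_bound K M -> rank_le n K ->
  exists u g : nat -> cfun R,
    [/\ forall i, L2p (u i) /\ (sqnormp (u i) <= 1)%E,
        forall i, L2p (g i) /\ (sqnormp (g i) <= (M ^+ 2)%:E)%E &
        forall f, L2p f -> ae_eq leb Rp (K f)
          (fun x => \sum_(0 <= i < n) cpairp f (g i) * u i x)].
Proof.
move=> M0; have sqnorm0 : sqnormp (fun=> 0) = 0%E.
  by rewrite /sqnorm integral0_eq// => x _; rewrite Normc.normc0 expr0n.
have LZ (a : R[i]) f : L2p f -> L2p (fun x => a * f x) by exact: (L2Z mRp).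
have zero : L2p (fun=> 0 : R[i]) by exact: L2_0.
elim: n K => [|n IH] K lK KM /rank_leP[e [Le eK]].
  exists (fun=> fun=> 0), (fun=> fun=> 0); split.
  - by move=> _; rewrite sqnorm0 lee01.
  - by move=> _; rewrite sqnorm0 lee_fin sqr_ge0.
  - move=> f /eK[c]; apply: filterS => x + Dx => /(_ Dx) ->.
    by rewrite !big_geq.
have [v v0 env] := L2_sqnorm_le (Le n).
(* A null last vector is dropped from the spanning family. *)
have [v_eq0|vn0] := eqVneq v 0.
  have [|u [g [uP gP Kug]]] := IH K lK KM.
    apply/rank_leP; exists e; split => // f Lf; have [c cK] := eK f Lf.
    exists c; have en0 : ae_eq leb Rp (e n) (cst 0).
      apply: (sqnorm_eq0 mRp (L2p_measurable (Le n))).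
      by rewrite env v_eq0 expr0n.
    apply: filterS2 cK en0 => x Kx ex Dx.
    by rewrite Kx// big_nat_recr//= ex// mulr0 addr0.
  exists (fun i => if (i < n)%N then u i else fun=> 0), g; split => //.
    by move=> i; case: ifP => // _; rewrite sqnorm0 lee01.
  move=> f Lf; apply: filterS (Kug f Lf) => x + Dx => /(_ Dx) ->.
  rewrite big_nat_recr//= ltnn mulr0 addr0.
  by apply: eq_big_nat => i /andP[_ im]; rewrite im.
have vp : 0 < v by rewrite lt_neqAle eq_sym vn0.
pose u0 : cfun R := fun x => (v^-1)%:C * e n x.
have vC : v%:C * (v^-1)%:C = 1 :> R[i].
  by apply: complex_ext; rewrite /= ?mulr0 ?mul0r ?subr0 ?addr0// divff.
have Lu0 : L2p u0 by exact: (L2Z mRp _ (Le n)).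
have u01 : sqnormp u0 = 1%E.
  rewrite sqnormZ//; [|exact: mRp|exact: L2p_measurable].
  rewrite env normc_real real_normK ?num_real// -EFinM -exprMn mulVf//.
  by rewrite expr1n.
have eE x : e n x = v%:C * u0 x by rewrite /u0 mulrA vC mul1r.
have LK := lK.1.
have Lcu0 : L2p (fun x => (u0 x)^*) by exact: L2_conj.
(* The coefficient of [K f] along the last spanning vector, normalized. *)
pose l f := cpairp (K f) (fun x => (u0 x)^*).
have l_lin (a : R[i]) f g : L2p f -> L2p g ->
    l (fun x => a * f x + g x) = a * l f + l g.
  move=> Lf Lg; rewrite /l.
  have LaKf : L2p (fun x => a * K f x) by apply: LZ; exact: LK.
  rewrite (ae_eq_cpair _ _ Lcu0 (lK.2 a f g Lf Lg)); first last.
  - by apply: L2D => //; [exact: mRp|exact: LK].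
  - by apply: LK; apply: L2D => //; [exact: mRp|exact: LZ].
  rewrite cpairDl//; [|exact: mRp|exact: LK].
  by rewrite cpairZl//; [exact: mRp|exact: LK].
have l_bnd f : L2p f -> ((normc (l f) ^+ 2)%:E <= (M ^+ 2)%:E * sqnormp f)%E.
  move=> Lf; apply: le_trans (cpair_cauchy_schwarz mRp (LK _ Lf) Lcu0) _.
  rewrite (_ : sqnormp (fun x => (u0 x)^*) = sqnormp u0); last first.
    by apply: eq_integral => x _; rewrite normc_conj.
  by rewrite u01 mule1; exact: KM.
have [g0 [Lg0 g0M lE]] := riesz_representation mRp l_lin l_bnd.
pose K' : op R := fun f x => K f x - l f * u0 x.
have LK' f : L2p f -> L2p (K' f).
  by move=> Lf; apply: L2B; [exact: mRp|exact: LK|apply: L2Z => //; exact: mRp].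
have lK' : linear_op K'.
  split => // a f g Lf Lg; apply: filterS (lK.2 a f g Lf Lg) => x Kx Dx.
  by rewrite /K' Kx// l_lin//; ring.
have K'M : op_bound K' M.
  move=> f Lf; apply: le_trans (KM f Lf).
  exact: (sqnorm_projection_le mRp (LK _ Lf) Lu0 u01).
pose c0 i := cpairp (e i) (fun x => (u0 x)^*).
have [|u [g [uP gP Kug]]] := IH K' lK' K'M.
  apply/rank_leP; exists (fun i x => e i x - c0 i * u0 x); split.
    by move=> i; apply: L2B => //; [exact: mRp|exact: Le|exact: LZ].
  move=> f Lf; have [c cK] := eK f Lf; exists c.
  have Lce i : L2p (fun x => c i * e i x) by exact: LZ.
  have lfE : l f = \sum_(0 <= i < n.+1) c i * c0 i.
    rewrite /l (ae_eq_cpair _ _ Lcu0 cK); [|exact: LK|apply: L2_sum => //; exact: mRp].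
    rewrite /cpair; under eq_fun do rewrite mulr_suml.
    rewrite cintegral_sum; [|exact: mRp|by move=> i; exact: (cintegrableM mRp (Lce i) Lcu0)].
    by apply: eq_bigr => i _; exact: (cpairZl mRp (c i) (Le i) Lcu0).
  have c0n : c0 n = v%:C.
    rewrite /c0 (_ : e n = fun x => v%:C * u0 x); last by apply/funext.
    rewrite cpairZl//; last exact: mRp.
    have -> : cpairp u0 (fun x => (u0 x)^*) = 1; last by rewrite mulr1.
    apply: complex_ext => /=.
      rewrite -[LHS]/(rip leb Rp u0 u0) rip_self// u01//.
    rewrite /Rintegral integral0_eq// => x _.
    by rewrite cImM cRe_conj cIm_conj; congr EFin; ring.
  apply: filterS cK => x Kx Dx; rewrite /K' Kx// lfE !big_nat_recr//=.
  under [in RHS]eq_bigr do rewrite mulrBr.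
  rewrite sumrB mulrDl mulr_suml c0n eE.
  under [X in _ = _ - X]eq_bigr do rewrite mulrA.
  ring.
exists (fun i => if (i < n)%N then u i else u0), (fun i => if (i < n)%N then g i else g0).
split.
- by move=> i; case: ifP => // _; rewrite u01.
- by move=> i; case: ifP.
- move=> f Lf; apply: filterS (Kug f Lf) => x Kx Dx.
  rewrite big_nat_recr//= ltnn -lE//.
  rewrite (_ : K f x = K' f x + l f * u0 x); last by rewrite /K' subrK.
  rewrite Kx//; congr (_ + _).
  by apply: eq_big_nat => i /andP[_ im]; rewrite im.
Qed.

End finite_rank.

(** * Nuclear representation of trace class operators *)

(** Lists the blocks [2^j] terms long one after the other: the term of index [k]
belongs to the block [trunc_log 2 k.+1]. *)
Lemma dyadic_sum (V : nmodType) (G : nat -> nat -> V) (J : nat) :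
  \sum_(0 <= k < 2 ^ J - 1) G (trunc_log 2 k.+1) (k.+1 - 2 ^ trunc_log 2 k.+1)%N =
  \sum_(0 <= j < J) \sum_(0 <= i < 2 ^ j) G j i.
Proof.
elim: J => [|J IH]; first by rewrite expn0 subnn !big_geq.
rewrite (@big_cat_nat _ _ _ (2 ^ J - 1))//=; last by rewrite leq_sub2r// leq_exp2l.
rewrite IH [RHS]big_nat_recr//=; congr (_ + _).
have p0 : (0 < 2 ^ J)%N by rewrite expn_gt0.
rewrite -{1}(add0n (2 ^ J - 1)%N) big_addn.
rewrite (_ : (2 ^ J.+1 - 1 - (2 ^ J - 1) = 2 ^ J)%N); last by rewrite expnS; lia.
apply: eq_big_nat => i /andP[_ iJ].
have -> : trunc_log 2 (i + (2 ^ J - 1)).+1 = J.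
  by apply: trunc_log_eq => //; rewrite expnS; lia.
by congr (G J _); lia.
Qed.

(** By monotonicity, [2^K] copies of the term of index [2^(K+1)] are dominated by the
terms of index [2^K + 1] to [2^(K+1)]. *)
Lemma condensation (R : realType) (a : nat -> R) (S : R) (J : nat) :
  (forall n, 0 <= a n) -> (forall m n, (m <= n)%N -> a n <= a m) ->
  (forall n, \sum_(0 <= i < n) a i <= S) ->
  \sum_(0 <= j < J) 2 ^+ j * a (2 ^ j %/ 4)%N <= 8 * S.
Proof.
move=> a0 a_noninc aS.
have H K : \sum_(0 <= j < K.+3) 2 ^+ j * a (2 ^ j %/ 4)%N <=
    8 * \sum_(0 <= i < (2 ^ K).+1) a i.
  elim: K => [|K IH].
    rewrite !big_nat_recr//= !big_geq// !expnS !expn0 !muln1.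
    by have := a0 0%N; have := a0 1%N; rewrite /divn/=; lra.
  rewrite big_nat_recr//= (_ : 2 ^ K.+3 %/ 4 = 2 ^ K.+1)%N; last first.
    by rewrite (_ : 2 ^ K.+3 = 2 ^ K.+1 * 4)%N ?mulnK// !expnS; lia.
  rewrite (@big_cat_nat _ _ _ (2 ^ K).+1 0 (2 ^ K.+1).+1)//=; last by rewrite ltnS leq_exp2l.
  rewrite mulrDr; apply: lerD => //.
  rewrite (_ : 2 ^+ K.+3 = 8 * 2 ^+ K :> R); last by rewrite !exprS; lra.
  rewrite -mulrA ler_pM2l//.
  have -> : 2 ^+ K * a (2 ^ K.+1)%N = \sum_((2 ^ K).+1 <= i < (2 ^ K.+1).+1) a (2 ^ K.+1)%N.
    rewrite big_const_nat subSS (_ : (2 ^ K.+1 - 2 ^ K = 2 ^ K)%N); last by rewrite expnS; lia.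
    by rewrite iter_addr addr0 -natrX mulr_natl.
  by apply: ler_sum_nat => i /andP[_ iK]; exact: a_noninc.
apply: (@le_trans _ _ (\sum_(0 <= j < J.+3) 2 ^+ j * a (2 ^ j %/ 4)%N)).
  rewrite [leRHS](@big_cat_nat _ _ _ J)//=; last by lia.
  by rewrite lerDl sumr_ge0// => j _; rewrite mulr_ge0// exprn_ge0.
by apply: le_trans (H J) _; rewrite ler_pM2l.
Qed.

Section nuclear_representation.
Variable R : realType.

Local Notation leb := (@lebesgue_measure R).
Local Notation Rp := (@Rplus R).
Local Notation sqnormp := (sqnorm leb Rp).
Local Notation cpairp := (cpair leb Rp).
Local Notation mRp := (@measurable_Rplus R).

Implicit Types (f g : cfun R) (A B K : op R).

(** The convergence is only asked along a subsequence of partial sums, since the terms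
come in blocks of size [2^j] and only complete blocks approximate [A] in norm. *)
Definition nuclear_rep A (u g : nat -> cfun R) (p : nat -> R) (P : R) : Prop :=
  [/\ forall k, 0 <= p k, forall k, L2p (u k) /\ (sqnormp (u k) <= (p k)%:E)%E,
      forall k, L2p (g k) /\ (sqnormp (g k) <= (p k)%:E)%E,
      forall n, \sum_(0 <= k < n) p k <= P &
      forall f (eta : R) m, L2p f -> 0 < eta -> exists2 n, (m <= n)%N &
        (sqnormp (fun x => A f x - \sum_(0 <= k < n) cpairp f (g k) * u k x)%R <= eta%:E)%E].

Lemma singular_number_ge0 A n : linear_op A -> (0 <= singular_number A n)%E.
Proof.
move=> lA; apply: le_ereal_inf_tmp => _ [K [/bounded_linear_op lK _] <-].
exact: opnorm_ge0 (linear_opB lA lK).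
Qed.

Lemma singular_number_noninc A m n : (m <= n)%N ->
  (singular_number A n <= singular_number A m)%E.
Proof.
move=> mn; apply: le_ereal_inf_tmp => _ [K [bK rK] <-].
apply: ereal_inf_lbound; exists K => //; split => //; exact: rank_le_mono mn rK.
Qed.

Lemma schatten1E A : linear_op A ->
  schatten_norm 1 A = (\sum_(0 <= n <oo) singular_number A n)%E.
Proof.
move=> lA; rewrite /schatten_norm invr1 poweRe1; last first.
  by apply: nneseries_ge0 => n _ _; rewrite poweR_ge0.
by apply: eq_eseriesr => n _; rewrite poweRe1// singular_number_ge0.
Qed.

(** With [K_j] a near optimal approximant of rank [2^j / 4], the difference
[K_(j+1) - K_j] has rank at most [2^j] and a norm about twice the singular number of
index [2^j / 4]; condensation bounds the sum of rank times norm. *)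
Lemma schatten_nuclear A (e : R) : schatten 1 A -> 0 < e ->
  exists (u g : nat -> cfun R) p, nuclear_rep A u g p (12 * (fine (schatten_norm 1 A) + e)).
Proof.
move=> [/[dup] bA /bounded_linear_op lA]; rewrite schatten1E// => Soo e0.
have LA := lA.1.
set S := fine _.
have s0 n : (0 <= singular_number A n)%E by exact: singular_number_ge0.
have SE : (\sum_(0 <= n <oo) singular_number A n)%E = S%:E.
  by rewrite fineK// ge0_fin_numE// nneseries_ge0.
have sfin n : singular_number A n \is a fin_num.
  rewrite ge0_fin_numE//; apply: le_lt_trans Soo.
  apply: le_trans (nneseries_lim_ge n.+1 (fun k _ _ => s0 k)).
  rewrite big_nat_recr//= leeDr//.
  by apply: sume_ge0 => k _; exact: s0.
pose a n := fine (singular_number A n).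
have aE n : (a n)%:E = singular_number A n by rewrite fineK.
have a0 n : 0 <= a n by rewrite fine_ge0.
have a_noninc m n : (m <= n)%N -> a n <= a m.
  by move=> mn; rewrite -lee_fin !aE; exact: singular_number_noninc.
have aS n : \sum_(0 <= i < n) a i <= S.
  rewrite -lee_fin -SE -sumEFin; apply: le_trans (nneseries_lim_ge n (fun k _ _ => s0 k)).
  by apply: lee_sum => k _; rewrite aE.
pose r j := (2 ^ j %/ 4)%N.
(* The errors are weighted by the ranks [2^j], hence the faster decay [4^-j]. *)
pose sg j : R := a (r j) + e * 4^-1 ^+ j.
have e4 j : 0 < e * 4^-1 ^+ j by rewrite mulr_gt0// exprn_gt0// invr_gt0.
have sg0 j : 0 < sg j by rewrite /sg ltr_wpDl.
have approx j : exists K, [/\ linear_op K, rank_le (r j) K &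
    op_bound (fun f x => A f x - K f x) (sg j)].
  have : (singular_number A (r j) < (sg j)%:E)%E.
    by rewrite -aE lte_fin /sg ltrDl.
  move=> /ereal_inf_lt[_ [K [/bounded_linear_op lK rK] <-] Kj].
  exists K; split => //; apply: opnorm_op_bound; [exact: ltW|exact: linear_opB|exact: ltW].
have [K KP] := choice approx.
have lK j : linear_op (K j) by case: (KP j).
have rK j : rank_le (r j) (K j) by case: (KP j).
have bK j : op_bound (fun f x => A f x - K j f x) (sg j) by case: (KP j).
pose D j : op R := fun f x => K j.+1 f x - K j f x.
pose M j := sg j.+1 + sg j.
have M0 j : 0 < M j by rewrite addr_gt0.
have lD j : linear_op (D j) by exact: linear_opB.
have rD j : rank_le (2 ^ j) (D j).
  apply: rank_le_mono (rank_leB (rK j.+1) (rK j)).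
  have := leq_divM (2 ^ j) 4; have := leq_divM (2 ^ j.+1) 4.
  by rewrite /r expnS; lia.
have bD j : op_bound (D j) (M j).
  move=> f Lf; rewrite /M addrC.
  have -> : sqnormp (D j f) = sqnormp (fun x => (A f x - K j f x) - (A f x - K j.+1 f x)).
    by apply: eq_integral => x _; congr ((normc _ ^+ 2)%:E); rewrite /D; ring.
  apply: (op_boundB (A := fun f x => A f x - K j f x)
    (B := fun f x => A f x - K j.+1 f x) _ _ _ _ (bK j) (bK j.+1)) => //;
    try exact: linear_opB; exact: ltW.
have decomp j : exists ug : (nat -> cfun R) * (nat -> cfun R),
    [/\ forall i, L2p (ug.1 i) /\ (sqnormp (ug.1 i) <= (M j)%:E)%E,
        forall i, L2p (ug.2 i) /\ (sqnormp (ug.2 i) <= (M j)%:E)%E &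
        forall f, L2p f -> ae_eq leb Rp (D j f)
          (fun x => \sum_(0 <= i < 2 ^ j) cpairp f (ug.2 i) * ug.1 i x)].
  have [u [g [uP gP Dug]]] := finite_rank_decomposition (ltW (M0 j)) (lD j) (bD j) (rD j).
  pose q := Num.sqrt (M j).
  have q0 : 0 < q by rewrite sqrtr_gt0.
  have qq : q ^+ 2 = M j by rewrite sqr_sqrtr// ltW.
  have LZ (b : R[i]) f : L2p f -> L2p (fun x => b * f x) by exact: (L2Z mRp).
  have NZ (b : R) f : L2p f -> (sqnormp (fun x => b%:C * f x)%R = (b ^+ 2)%:E * sqnormp f)%E.
    move=> Lf; rewrite sqnormZ; [|exact: mRp|exact: L2p_measurable Lf].
    by rewrite normc_real real_normK ?num_real.
  (* Balance the two factors of each rank one term. *)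
  exists (fun i x => q%:C * u i x, fun i x => (q^-1)%:C * g i x); split => /=.
  - move=> i; have [Lu Nu] := uP i; split; first exact: LZ.
    by rewrite NZ// qq -[leRHS]mule1 lee_wpmul2l// lee_fin ltW.
  - move=> i; have [Lg Ng] := gP i; split; first exact: LZ.
    rewrite NZ//; apply: (@le_trans _ _ ((q^-1 ^+ 2)%:E * (M j ^+ 2)%:E)%E).
      by rewrite lee_wpmul2l// lee_fin sqr_ge0.
    by rewrite -EFinM lee_fin exprVn qq expr2 mulKf// gt_eqF.
  - move=> f Lf; apply: filterS (Dug f Lf) => x + Dx => /(_ Dx) ->.
    apply: eq_bigr => i _.
    have qC : q%:C * (q^-1)%:C = 1 :> R[i].
      by apply: complex_ext; rewrite /= ?mulr0 ?mul0r ?subr0 ?addr0// divff ?gt_eqF.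
    rewrite (cpairC _ _ f (fun x => (q^-1)%:C * g i x)) cpairZl//; [|exact: mRp|by case: (gP i)].
    rewrite [cpairp (g i) f]cpairC.
    rewrite [RHS](_ : _ = q%:C * (q^-1)%:C * (cpairp f (g i) * u i x)); last by ring.
    by rewrite qC mul1r.
have [ug ugP] := choice decomp.
pose lv k := trunc_log 2 k.+1.
pose ix k := (k.+1 - 2 ^ lv k)%N.
pose u k := (ug (lv k)).1 (ix k).
pose g k := (ug (lv k)).2 (ix k).
pose p k := M (lv k).
have psum J : \sum_(0 <= k < 2 ^ J - 1) p k = \sum_(0 <= j < J) 2 ^+ j * M j.
  rewrite (dyadic_sum (fun j _ => M j)); apply: eq_bigr => j _.
  by rewrite big_const_nat subn0 iter_addr addr0 -natrX mulr_natl.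
have sgsum J : \sum_(0 <= j < J) 2 ^+ j * sg j <= 8 * S + 2 * e.
  under eq_bigr do rewrite mulrDr.
  rewrite big_split/=; apply: lerD; first exact: condensation.
  apply: (@le_trans _ _ (2 * e - 2 * e * 2^-1 ^+ J)); last first.
    by rewrite lerBlDr lerDl mulr_ge0// ?exprn_ge0 ?invr_ge0//; lra.
  elim: J => [|J IH]; first by rewrite big_geq// expr0; lra.
  rewrite big_nat_recr//=.
  have -> : 2 ^+ J * (e * 4^-1 ^+ J) = e * 2^-1 ^+ J :> R.
    rewrite mulrCA -exprMn; congr (_ * _ ^+ _); lra.
  by rewrite exprS; lra.
have Msum J : \sum_(0 <= j < J) 2 ^+ j * M j <= 12 * (S + e).
  have -> : \sum_(0 <= j < J) 2 ^+ j * M j =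
      2^-1 * (\sum_(0 <= j < J.+1) 2 ^+ j * sg j - sg 0%N) + \sum_(0 <= j < J) 2 ^+ j * sg j.
    rewrite big_nat_recl//= expr0 mul1r addrAC subrr add0r mulr_sumr -big_split/=.
    by apply: eq_bigr => j _; rewrite /M exprS; lra.
  have := sgsum J.+1; have := sgsum J; have := sg0 0%N; lra.
have Sge0 : 0 <= S by apply: le_trans (aS 0%N); rewrite big_geq.
exists u, g, p; split.
- by move=> k; exact: (ltW (M0 _)).
- by move=> k; have [uP _ _] := ugP (lv k); exact: uP.
- by move=> k; have [_ gP _] := ugP (lv k); exact: gP.
- move=> n; apply: le_trans (Msum n); rewrite -psum.
  rewrite [leRHS](@big_cat_nat _ _ _ n)//=.
    by rewrite lerDl sumr_ge0// => k _; exact: (ltW (M0 _)).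
  by have := ltn_expl n (isT : 1 < 2)%N; lia.
- move=> f eta m Lf eta0.
  have [v v0 fv] := L2_sqnorm_le Lf.
  have partial J : ae_eq leb Rp (fun x => K J f x)
      (fun x => \sum_(0 <= k < 2 ^ J - 1) cpairp f (g k) * u k x).
    elim: J => [|J IH].
      have /rank_leP[e' [Le' K0]] := rK 0%N; have [c Kc] := K0 f Lf.
      apply: filterS Kc => x + Dx => /(_ Dx) ->.
      by rewrite /r expn0 subnn !big_geq.
    have [_ _ /(_ f Lf) DJ] := ugP J.
    apply: filterS2 IH DJ => x IHx Dx Rx.
    have -> : K J.+1 f x = K J f x + D J f x by rewrite /D addrC subrK.
    rewrite Dx// IHx//.
    rewrite (dyadic_sum (fun j i => cpairp f ((ug j).2 i) * (ug j).1 i x)).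
    rewrite [in RHS](dyadic_sum (fun j i => cpairp f ((ug j).2 i) * (ug j).1 i x)).
    by rewrite big_nat_recr.
  have Mle J : M J <= 12 * (S + e) * 2^-1 ^+ J.
    rewrite exprVn ler_pdivlMr ?exprn_gt0// mulrC; apply: le_trans (Msum J.+1).
    rewrite big_nat_recr//= lerDr sumr_ge0// => j _.
    by rewrite mulr_ge0 ?exprn_ge0// ltW.
  have [J mJ Jeta] : exists2 J, (m <= J)%N & sg J ^+ 2 * v ^+ 2 <= eta.
    apply: contrapT => H.
    have HJ J : (m <= J)%N -> eta < sg J ^+ 2 * v ^+ 2.
      by move=> mJ; rewrite ltNge; apply/negP => ?; apply: H; exists J.
    suff : eta <= 0 by rewrite leNgt eta0.
    apply: (@le0_of_le_half_pow _ _ (144 * (S + e) ^+ 2 * v ^+ 2)) => n.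
    have mn : (m <= m + n)%N by rewrite leq_addr.
    apply: le_trans (ltW (HJ _ mn)) _.
    rewrite [leRHS]mulrAC ler_wpM2r ?sqr_ge0//.
    apply: (@le_trans _ _ ((12 * (S + e) * 2^-1 ^+ n) ^+ 2)).
      rewrite ler_sqr ?nnegrE ?mulr_ge0 ?exprn_ge0 ?invr_ge0//; [|exact: ltW|lra].
      apply: (@le_trans _ _ (M (m + n)%N)); first by rewrite lerDr ltW.
      apply: le_trans (Mle _) _; rewrite ler_wpM2l//; first lra.
      by rewrite ler_wiXn2l ?leq_addl ?invr_ge0 ?invf_le1 ?ler1n.
    rewrite exprMn exprMn (_ : 12 ^+ 2 = 144); last by rewrite -natrX.
    apply: ler_wpM2l; first by rewrite mulr_ge0// sqr_ge0.
    rewrite expr2 ler_piMl ?exprn_ge0 ?invr_ge0//.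
    by rewrite exprn_ile1 ?invr_ge0 ?invf_le1 ?ler1n.
  exists (2 ^ J - 1)%N.
    by have := ltn_expl J (isT : 1 < 2)%N; lia.
  rewrite (@ae_eq_sqnorm _ _ _ leb Rp mRp _ (fun x => A f x - K J f x)).
  + by apply: le_trans (bK J f Lf) _; rewrite fv -EFinM lee_fin.
  + apply: mcfunB; first exact: L2p_measurable (LA _ Lf).
    apply: mcfun_sum => k; apply: mcfunM; first exact: mcfun_cst.
    by have [uP _ _] := ugP (lv k); apply: L2p_measurable; case: (uP (ix k)).
  + by apply: L2p_measurable; exact: (linear_opB lA (lK J)).1.
  + by apply: filterS (partial J) => x + Dx => /(_ Dx) ->.
Qed.

End nuclear_representation.

(** * Integration over rectangles *)

Section tonelli_rectangle.
Context d1 d2 (T1 : measurableType d1) (T2 : measurableType d2) (R : realType).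
Variables (m1 : {sigma_finite_measure set T1 -> \bar R})
  (m2 : {sigma_finite_measure set T2 -> \bar R}).
Variables (D1 : set T1) (D2 : set T2).
Hypotheses (mD1 : measurable D1) (mD2 : measurable D2).

Let mD : measurable (D1 `*` D2).
Proof. exact: measurableX. Qed.

Lemma measurable_section1 d (U : measurableType d) (F : T1 * T2 -> U) x :
  measurable_fun (D1 `*` D2) F -> D1 x -> measurable_fun D2 (fun y => F (x, y)).
Proof.
move=> mF D1x; apply: (measurable_comp mD _ mF).
  by move=> _ [y D2y <-].
exact: measurable_funS (pair1_measurable x).
Qed.

Lemma measurable_section2 d (U : measurableType d) (F : T1 * T2 -> U) y :
  measurable_fun (D1 `*` D2) F -> D2 y -> measurable_fun D1 (fun x => F (x, y)).
Proof.
move=> mF D2y; apply: (measurable_comp mD _ mF).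
  by move=> _ [x D1x <-].
exact: measurable_funS (pair2_measurable y).
Qed.

Lemma mcfun_section1 (F : T1 * T2 -> R[i]) x :
  measurable_cfun (D1 `*` D2) F -> D1 x -> measurable_cfun D2 (fun y => F (x, y)).
Proof.
by move=> [F1 F2] D1x; split; [exact: (measurable_section1 F1)|exact: (measurable_section1 F2)].
Qed.

Lemma mcfun_section2 (F : T1 * T2 -> R[i]) y :
  measurable_cfun (D1 `*` D2) F -> D2 y -> measurable_cfun D1 (fun x => F (x, y)).
Proof.
by move=> [F1 F2] D2y; split; [exact: (measurable_section2 F1)|exact: (measurable_section2 F2)].
Qed.

Lemma measurable_comp_fst d (U : measurableType d) (f : T1 -> U) :
  measurable_fun D1 f -> measurable_fun (D1 `*` D2) (fun z => f z.1).
Proof.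
move=> mf; apply: (measurable_comp mD1 _ mf); first by move=> _ [z [z1 z2] <-].
exact: measurable_funS measurable_fst.
Qed.

Lemma measurable_comp_snd d (U : measurableType d) (f : T2 -> U) :
  measurable_fun D2 f -> measurable_fun (D1 `*` D2) (fun z => f z.2).
Proof.
move=> mf; apply: (measurable_comp mD2 _ mf); first by move=> _ [z [z1 z2] <-].
exact: measurable_funS measurable_snd.
Qed.

Lemma mcfun_fst (f : T1 -> R[i]) :
  measurable_cfun D1 f -> measurable_cfun (D1 `*` D2) (fun z => f z.1).
Proof. by move=> [f1 f2]; split; [exact: (measurable_comp_fst f1)|exact: (measurable_comp_fst f2)]. Qed.

Lemma mcfun_snd (f : T2 -> R[i]) :
  measurable_cfun D2 f -> measurable_cfun (D1 `*` D2) (fun z => f z.2).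
Proof. by move=> [f1 f2]; split; [exact: (measurable_comp_snd f1)|exact: (measurable_comp_snd f2)]. Qed.

Section nonneg.
Variable F : T1 * T2 -> \bar R.
Hypothesis mF : measurable_fun (D1 `*` D2) F.
Hypothesis F0 : forall z, (D1 `*` D2) z -> (0 <= F z)%E.
Local Open Scope ereal_scope.

Let G := F \_ (D1 `*` D2).

Let mG : measurable_fun setT G.
Proof. by apply/(measurable_restrictT _ _).1. Qed.

Let G0 z : 0 <= G z.
Proof. by rewrite /G; apply: erestrict_ge0. Qed.

Let inner1 x : \int[m2]_y G (x, y) = ((fun x => \int[m2]_(y in D2) F (x, y)) \_ D1) x.
Proof.
rewrite patchE; case: ifPn => [/set_mem D1x|/negP D1x].
  rewrite [RHS]integral_mkcond; apply: eq_integral => y _.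
  rewrite /G !patchE; congr (if _ then _ else _).
  by apply/idP/idP => /set_mem H; apply/mem_set => //; case: H.
rewrite integral0_eq// => y _; rewrite /G patchE ifF//.
by apply/negP => /set_mem[D1x' _]; apply: D1x; exact/mem_set.
Qed.

Let inner2 y : \int[m1]_x G (x, y) = ((fun y => \int[m1]_(x in D1) F (x, y)) \_ D2) y.
Proof.
rewrite patchE; case: ifPn => [/set_mem D2y|/negP D2y].
  rewrite [RHS]integral_mkcond; apply: eq_integral => x _.
  rewrite /G !patchE; congr (if _ then _ else _).
  by apply/idP/idP => /set_mem H; apply/mem_set => //; case: H.
rewrite integral0_eq// => x _; rewrite /G patchE ifF//.
by apply/negP => /set_mem[_ D2y']; apply: D2y; exact/mem_set.
Qed.

Lemma measurable_int_section1 : measurable_fun D1 (fun x => \int[m2]_(y in D2) F (x, y)).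
Proof.
apply/(measurable_restrictT _ mD1).
have <- : (fun x => \int[m2]_y G (x, y)) = (fun x => \int[m2]_(y in D2) F (x, y)) \_ D1.
  by apply/funext => x; rewrite inner1.
exact: (measurable_fun_fubini_tonelli_F G).
Qed.

Lemma measurable_int_section2 : measurable_fun D2 (fun y => \int[m1]_(x in D1) F (x, y)).
Proof.
apply/(measurable_restrictT _ mD2).
have <- : (fun y => \int[m1]_x G (x, y)) = (fun y => \int[m1]_(x in D1) F (x, y)) \_ D2.
  by apply/funext => y; rewrite inner2.
exact: (measurable_fun_fubini_tonelli_G G).
Qed.

Lemma tonelli_rectangle1 : \int[m1 \x m2]_(z in D1 `*` D2) F z =
  \int[m1]_(x in D1) \int[m2]_(y in D2) F (x, y).
Proof.
rewrite integral_mkcond -/G fubini_tonelli1// [RHS]integral_mkcond.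
by apply: eq_integral => x _; rewrite -inner1.
Qed.

Lemma tonelli_rectangle2 : \int[m1 \x m2]_(z in D1 `*` D2) F z =
  \int[m2]_(y in D2) \int[m1]_(x in D1) F (x, y).
Proof.
rewrite integral_mkcond -/G fubini_tonelli2// [RHS]integral_mkcond.
by apply: eq_integral => y _; rewrite -inner2.
Qed.

Lemma tonelli_swap : \int[m1]_(x in D1) \int[m2]_(y in D2) F (x, y) =
  \int[m2]_(y in D2) \int[m1]_(x in D1) F (x, y).
Proof. by rewrite -tonelli_rectangle1 tonelli_rectangle2. Qed.

End nonneg.

Lemma measurable_Rint_section1 (h : T1 * T2 -> R) : measurable_fun (D1 `*` D2) h ->
  measurable_fun D1 (fun x => \int[m2]_(y in D2) h (x, y)).
Proof.
move=> mh; apply: measurableT_comp => //=.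
under eq_fun do rewrite integralE.
apply: emeasurable_funB.
- under eq_fun do under eq_integral do rewrite funeposE.
  apply: (@measurable_int_section1 (fun z => maxe ((h z)%:E) 0)%E).
    by apply: measurable_maxe => //; exact/measurable_EFinP.
  by move=> z _; rewrite le_max lexx orbT.
- under eq_fun do under eq_integral do rewrite funenegE.
  apply: (@measurable_int_section1 (fun z => maxe (- (h z)%:E) 0)%E).
    apply: measurable_maxe => //; apply/measurable_EFinP.
    exact: measurableT_comp.
  by move=> z _; rewrite le_max lexx orbT.
Qed.

Lemma measurable_Rint_section2 (h : T1 * T2 -> R) : measurable_fun (D1 `*` D2) h ->
  measurable_fun D2 (fun y => \int[m1]_(x in D1) h (x, y)).
Proof.
move=> mh; apply: measurableT_comp => //=.
under eq_fun do rewrite integralE.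
apply: emeasurable_funB.
- under eq_fun do under eq_integral do rewrite funeposE.
  apply: (@measurable_int_section2 (fun z => maxe ((h z)%:E) 0)%E).
    by apply: measurable_maxe => //; exact/measurable_EFinP.
  by move=> z _; rewrite le_max lexx orbT.
- under eq_fun do under eq_integral do rewrite funenegE.
  apply: (@measurable_int_section2 (fun z => maxe (- (h z)%:E) 0)%E).
    apply: measurable_maxe => //; apply/measurable_EFinP.
    exact: measurableT_comp.
  by move=> z _; rewrite le_max lexx orbT.
Qed.

Lemma mcfun_cintegral1 (F : T1 * T2 -> R[i]) : measurable_cfun (D1 `*` D2) F ->
  measurable_cfun D1 (fun x => cintegral m2 D2 (fun y => F (x, y))).
Proof.
move=> [F1 F2]; split => /=; first exact: (measurable_Rint_section1 F1).
exact: (measurable_Rint_section1 F2).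
Qed.

Lemma mcfun_cintegral2 (F : T1 * T2 -> R[i]) : measurable_cfun (D1 `*` D2) F ->
  measurable_cfun D2 (fun y => cintegral m1 D1 (fun x => F (x, y))).
Proof.
move=> [F1 F2]; split => /=; first exact: (measurable_Rint_section2 F1).
exact: (measurable_Rint_section2 F2).
Qed.

Lemma sqnorm_section_fin (k : T1 * T2 -> R[i]) : L2 (m1 \x m2)%E (D1 `*` D2) k ->
  {ae m1, forall x, D1 x -> L2 m2 D2 (fun y => k (x, y))}.
Proof.
move=> /L2P[mk koo]; have mk2 := measurable_EFin_normc_sqr mk.
have k0 z : (D1 `*` D2) z -> (0 <= (normc (k z) ^+ 2)%:E)%E.
  by move=> _; rewrite lee_fin sqr_ge0.
move: koo; rewrite /sqnorm (tonelli_rectangle1 mk2 k0) => koo.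
have /integrable_ae : m1.-integrable D1 (fun x => \int[m2]_(y in D2) (normc (k (x, y)) ^+ 2)%:E)%E.
  apply/integrableP; split; first exact: (measurable_int_section1 mk2 k0).
  apply: le_lt_trans koo; apply: ge0_le_integral => //.
  - apply: measurableT_comp => //; exact: (measurable_int_section1 mk2 k0).
  - exact: (measurable_int_section1 mk2 k0).
  - by move=> x _; rewrite gee0_abs// integral_ge0// => y _; rewrite lee_fin sqr_ge0.
move=> /(_ mD1); apply: filterS => x kfin D1x; apply/L2P; split.
  exact: mcfun_section1.
have := kfin D1x; rewrite ge0_fin_numE//.
by apply: integral_ge0 => y _; rewrite lee_fin sqr_ge0.
Qed.

Lemma sqnorm_tensor (u : T1 -> R[i]) (g : T2 -> R[i]) :
  measurable_cfun D1 u -> measurable_cfun D2 g ->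
  sqnorm (m1 \x m2)%E (D1 `*` D2) (fun z => u z.1 * g z.2) =
  (sqnorm m1 D1 u * sqnorm m2 D2 g)%E.
Proof.
move=> mu_ mg; rewrite /sqnorm tonelli_rectangle1; first last.
- by move=> z _; rewrite lee_fin sqr_ge0.
- apply: measurable_EFin_normc_sqr; apply: mcfunM.
    exact: mcfun_fst.
  exact: mcfun_snd.
have g0 : (0 <= \int[m2]_(y in D2) (normc (g y) ^+ 2)%:E)%E.
  by apply: integral_ge0 => y _; rewrite lee_fin sqr_ge0.
rewrite [LHS](eq_integral (fun x => (normc (u x) ^+ 2)%:E *
    \int[m2]_(y in D2) (normc (g y) ^+ 2)%:E)%E); last first.
  move=> x _; rewrite -ge0_integralZl_EFin ?sqr_ge0//;
    [|by move=> y _; rewrite lee_fin sqr_ge0|exact: measurable_EFin_normc_sqr].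
  by apply: eq_integral => y _; rewrite Normc.normcM exprMn EFinM.
rewrite ge0_integralZr//.
- exact: measurable_EFin_normc_sqr.
- by move=> x _; rewrite lee_fin sqr_ge0.
Qed.

(** When the right-hand side is infinite the bound is trivial; otherwise [f] is
integrable. *)
Lemma normc_cintegral_lee (f : T2 -> R[i]) : measurable_cfun D2 f ->
  ((normc (cintegral m2 D2 f))%:E <= \int[m2]_(y in D2) (normc (f y))%:E)%E.
Proof.
move=> mf; have I0 : (0 <= \int[m2]_(y in D2) (normc (f y))%:E)%E.
  by apply: integral_ge0 => x _; rewrite lee_fin normc_ge0.
have [foo|] := ltP (\int[m2]_(y in D2) (normc (f y))%:E)%E +oo%E.
  rewrite -[leRHS]fineK ?ge0_fin_numE// lee_fin.
  by apply: normc_cintegral_le => //; split.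
by rewrite leye_eq => /eqP ->; exact: leey.
Qed.

Lemma sqnorm_kernel_le (k : T1 * T2 -> R[i]) (f : T2 -> R[i]) :
  measurable_cfun (D1 `*` D2) k -> measurable_cfun D2 f ->
  (sqnorm m1 D1 (fun x => cintegral m2 D2 (fun y => (k (x, y) * f y)%R)) <=
   \int[m1]_(x in D1) (\int[m2]_(y in D2) ((normc (k (x, y)))%:E * (normc (f y))%:E)) ^+ 2)%E.
Proof.
move=> mk mf.
have mkf : measurable_cfun (D1 `*` D2) (fun z => k z * f z.2).
  by apply: mcfunM => //; exact: mcfun_snd.
have mkfn : measurable_fun (D1 `*` D2) (fun z => (normc (k z))%:E * (normc (f z.2))%:E)%E.
  apply: emeasurable_funM; first exact: measurable_EFin_normc.
  by apply: measurable_EFin_normc; exact: mcfun_snd.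
have mC : measurable_cfun D1 (fun x => cintegral m2 D2 (fun y => k (x, y) * f y)).
  exact: (mcfun_cintegral1 mkf).
rewrite sqnormE; apply: ge0_le_integral => //.
- by move=> x _; exact: sqre_ge0.
- by apply: measurable_sqre; exact: measurable_EFin_normc.
- apply: measurable_sqre; apply: (measurable_int_section1 mkfn) => z _.
  by rewrite mule_ge0// lee_fin normc_ge0.
- move=> x D1x; rewrite lee_sqr ?lee_fin ?normc_ge0//; last first.
    by apply: integral_ge0 => y _; rewrite mule_ge0// lee_fin normc_ge0.
  apply: le_trans (normc_cintegral_lee _) _.
    by apply: mcfunM => //; exact: mcfun_section1.
  by under eq_integral do rewrite Normc.normcM EFinM.
Qed.

(** Cauchy-Schwarz on almost every section of the kernel. *)
Lemma sqnorm_kernel_le_HS (k : T1 * T2 -> R[i]) (f : T2 -> R[i]) :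
  measurable_cfun (D1 `*` D2) k -> measurable_cfun D2 f ->
  (sqnorm m1 D1 (fun x => cintegral m2 D2 (fun y => (k (x, y) * f y)%R)) <=
   sqnorm (m1 \x m2) (D1 `*` D2) k * sqnorm m2 D2 f)%E.
Proof.
move=> mk mf; apply: le_trans (sqnorm_kernel_le mk mf) _.
have mk2 := measurable_EFin_normc_sqr mk.
have k0 z : (D1 `*` D2) z -> (0 <= (normc (k z) ^+ 2)%:E)%E.
  by move=> _; rewrite lee_fin sqr_ge0.
have mkfn : measurable_fun (D1 `*` D2) (fun z => (normc (k z))%:E * (normc (f z.2))%:E)%E.
  apply: emeasurable_funM; first exact: measurable_EFin_normc.
  by apply: measurable_EFin_normc; exact: mcfun_snd.
rewrite {1}/sqnorm (tonelli_rectangle1 mk2 k0) -ge0_integralZr//; first last.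
- exact: sqnorm_ge0.
- by move=> x _; apply: integral_ge0 => y _; rewrite lee_fin sqr_ge0.
- exact: (measurable_int_section1 mk2 k0).
apply: ge0_le_integral => //.
- by move=> x _; exact: sqre_ge0.
- apply: measurable_sqre; apply: (measurable_int_section1 mkfn) => z _.
  by rewrite mule_ge0// lee_fin normc_ge0.
- apply: emeasurable_funM; first exact: (measurable_int_section1 mk2 k0).
  exact: measurable_cst.
move=> x D1x; rewrite sqnormE.
under [X in (_ <= X * _)%E]eq_integral do rewrite EFin_expe.
apply: cauchy_schwarz_ge0 => //.
- by apply: measurable_EFin_normc; exact: mcfun_section1.
- exact: measurable_EFin_normc.
- by move=> y _; rewrite lee_fin normc_ge0.
- by move=> y _; rewrite lee_fin normc_ge0.
Qed.

End tonelli_rectangle.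

(** * Uniqueness and existence of kernels *)

Section vanishing_primitive.
Variable R : realType.
Local Notation leb := (@lebesgue_measure R).

(** A derivative can be computed along rational points, where the function vanishes. *)
Lemma derivative_eq0_on_rat (F : R -> R) (x L e : R) : 0 < e ->
  (forall q : rat, x < ratr q < x + e -> F (ratr q) = 0) ->
  derivable F x 1 -> derive1 F x = L -> L = 0.
Proof.
move=> e0 Fq dF FL.
have cF : {for x, continuous F} by apply: differentiable_continuous; exact/derivable1_diffP.
have rat_near (P : set R) : (\forall y \near x, P y) ->
    exists q : rat, [/\ x < ratr q, ratr q < x + e & P (ratr q)].
  move=> [r /= r0 rP]; have xr : x < x + Num.min e r by rewrite ltrDl lt_min e0.
  have [q] := rat_in_itvoo xr; rewrite in_itv/= => /andP[xq qr]; exists q; split => //.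
    by apply: lt_le_trans qr _; rewrite lerD2l ge_min lexx.
  apply: rP => /=; rewrite ltr0_norm ?subr_lt0// opprB ltrBlDl.
  by apply: lt_le_trans qr _; rewrite lerD2l ge_min lexx orbT.
have Fx : F x = 0.
  apply: contrapT => /eqP Fx0.
  have [q [xq qe]] : exists q : rat, [/\ x < ratr q, ratr q < x + e & F (ratr q) != 0].
    apply: (rat_near [set y | F y != 0]); apply: (cF [set y | y != 0]).
    apply: open_nbhs_nbhs; split => //; exact: open_neq.
  by rewrite Fq ?eqxx// xq.
apply: contrapT => /eqP L0.
have : h^-1 *: (F (h *: 1 + x) - F x) @[h --> 0^'] --> L.
  by move: dF FL; rewrite derive1E /derive => /cvg_ex[l lF]; rewrite (cvg_lim _ lF)// => <-.
move/(_ [set y | y != 0]) => /=.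
have L0n : nbhs L [set y | y != 0] by apply: open_nbhs_nbhs; split => //; exact: open_neq.
move=> /(_ L0n)[r /= r0 rP].
have [q [xq qe /= qr]] : exists q : rat, [/\ x < ratr q, ratr q < x + e & ratr q < x + r].
  apply: (rat_near [set y | y < x + r]); exists r => //= y; rewrite /ball_/= distrC => /(le_lt_trans (ler_norm _)).
  by rewrite ltrBlDl.
have := rP (ratr q - x); rewrite /= sub0r normrN gtr0_norm ?subr_gt0// ltrBlDl qr.
rewrite subr_eq0 gt_eqF// => /(_ isT isT).
rewrite /GRing.scale/= mulr1 subrK Fq ?xq// Fx subr0.
by rewrite mulr0 eqxx.
Qed.

(** The primitive of [h] vanishes at the rational points, and almost everywhere it is
differentiable with derivative [h]. *)
Lemma ae_eq0_of_int_rat (h : R -> R) :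
  (forall n : nat, leb.-integrable `]0, n%:R] (EFin \o h)) ->
  (forall q : rat, 0 < ratr q :> R -> \int[leb]_(y in `]0, ratr q]) h y = 0) ->
  {ae leb, forall x, 0 < x -> h x = 0}.
Proof.
move=> ih h0.
have step n : {ae leb, forall x, 0 < x -> x < n%:R -> h x = 0}.
  pose f := h \_ `]0, n%:R].
  have iT : leb.-integrable setT (EFin \o f).
    by rewrite /f -restrict_EFin; apply/(integrable_mkcond _ _).1 => //; exact: ih.
  have iS (y : R) : leb.-integrable [set` Interval (BRight 0) (BRight y)] (EFin \o f).
    by apply: integrableS iT.
  have := FTC1 iS (integrable_locally (measurable_itv _) (ih n)).
  apply: filterS; first exact: (ae_filter_ringOfSetsType leb).
  move=> x /= Fx x0 xn.
  have [dF FL] := Fx x0.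
  have fx : f x = h x by rewrite /f patchE ifT// inE/= in_itv/= x0 ltW.
  rewrite -fx.
  apply: (@derivative_eq0_on_rat _ x _ (n%:R - x)) dF FL; first by rewrite subr_gt0.
  move=> q; rewrite addrC subrK => /andP[xq qn].
  rewrite -[RHS](h0 q); last exact: lt_trans xq.
  apply: eq_Rintegral => y; rewrite inE/= in_itv/= => /andP[y0 yq].
  by rewrite /f patchE ifT// inE/= in_itv/= y0/= (le_trans yq)// ltW.
have := ae_foralln (fun n => step n).
apply: filterS => x hx x0; apply: (hx (Num.truncn x).+1) => //.
exact: truncnS_gt.
Qed.

End vanishing_primitive.

Section kernels.
Variable R : realType.

Local Notation leb := (@lebesgue_measure R).
Local Notation Rp := (@Rplus R).
Local Notation sqnormp := (sqnorm leb Rp).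
Local Notation cpairp := (cpair leb Rp).
Local Notation mRp := (@measurable_Rplus R).
Local Notation leb2 := (leb \x leb)%E.
Local Notation Rp2 := (Rp `*` Rp).

Implicit Types (f : cfun R) (A K : op R).

Definition kernel_op (k : measurableTypeR R * measurableTypeR R -> R[i]) : op R :=
  fun f x => cintegral leb Rp (fun y => k (x, y) * f y).

Lemma measurable_Rp2 : measurable Rp2.
Proof. by apply: measurableX; exact: mRp. Qed.

Lemma mcfun_kernel_op k f : measurable_cfun Rp2 k -> L2p f ->
  measurable_cfun Rp (kernel_op k f).
Proof.
move=> mk Lf; apply: (mcfun_cintegral1 leb mRp mRp (F := fun z => k z * f z.2)).
by apply: mcfunM => //; exact: (mcfun_snd _ mRp (L2p_measurable Lf)).
Qed.

Lemma L2_kernel_op k f : L2 leb2 Rp2 k -> L2p f -> L2p (kernel_op k f).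
Proof.
move=> Lk Lf; apply/L2P; split; first by apply: mcfun_kernel_op => //; exact: L2_measurable Lk.
apply: le_lt_trans (sqnorm_kernel_le_HS leb leb mRp mRp (L2_measurable Lk) (L2p_measurable Lf)) _.
have [v _ ->] := L2_sqnorm_le Lk; have [w _ ->] := L2_sqnorm_le Lf.
by rewrite -EFinM ltry.
Qed.

Lemma kernel_opB_ae k k' f : L2 leb2 Rp2 k -> L2 leb2 Rp2 k' -> L2p f ->
  ae_eq leb Rp (kernel_op (fun z => k z - k' z) f)
    (fun x => kernel_op k f x - kernel_op k' f x).
Proof.
move=> Lk Lk' Lf.
apply: filterS2 (sqnorm_section_fin mRp mRp Lk) (sqnorm_section_fin mRp mRp Lk') => x kx k'x Dx.
have ik := cintegrableM mRp (kx Dx) Lf; have ik' := cintegrableM mRp (k'x Dx) Lf.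
rewrite /kernel_op -mulN1r -(cintegralZ mRp _ ik').
rewrite -(cintegralD mRp ik (cintegrableZ mRp (-1) ik')).
by congr cintegral; apply/funext => y; ring.
Qed.

(** Testing on the indicators of the countably many intervals [(0, q]] with [q]
rational, off one null set of [x] all primitives of the section [k(x, .)] vanish at
rational points. *)
Lemma L2_kernel_eq0 k : L2 leb2 Rp2 k ->
  (forall f, L2p f -> ae_eq leb Rp (kernel_op k f) (fun=> 0)) ->
  ae_eq leb2 Rp2 k (cst 0).
Proof.
move=> Lk k0.
have mk := L2_measurable Lk.
pose one (q : R) : cfun R := fun y => (\1_(`]0, q]%classic : set R) y)%:C.
have Lone q : L2p (one q).
  apply/L2P; split.
    by apply: mcfun_real; exact: measurable_indic.
  rewrite /sqnorm; apply: (@le_lt_trans _ _ (\int[leb]_(y in Rp) (\1_(`]0, q]%classic : set R) y)%:E)%E).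
    apply: ge0_le_integral => //.
    - exact: mRp.
    - by move=> y _; rewrite lee_fin sqr_ge0.
    - apply: measurable_EFin_normc_sqr; apply: mcfun_real; exact: measurable_indic.
    - by apply/measurable_EFinP; exact: measurable_indic.
    - by move=> y _; rewrite normc_real lee_fin indicE; case: (_ \in _); rewrite /= ?normr1 ?normr0 ?expr1n ?expr0n.
  rewrite integral_indic//; last exact: mRp.
  apply: (@le_lt_trans _ _ (leb `]0, q]%classic)).
    apply: le_measure; rewrite ?inE//; apply: measurableI => //; exact: mRp.
  by rewrite lebesgue_measure_itv/=; case: ifP => // _; rewrite -EFinB ltry.
(* Enumerating the rationals collects countably many null sets into one. *)
pose rn (n : nat) : R := if unpickle n is Some q then ratr (q : rat) else 1.
have aeq : {ae leb, forall x, Rp x -> forall n, kernel_op k (one (rn n)) x = 0}.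
  have := ae_foralln (fun n => k0 _ (Lone (rn n))).
  by apply: filterS => x kx Dx n; exact: kx.
have ae0 : {ae leb, forall x, Rp x -> sqnormp (fun y => k (x, y)) = 0%E}.
  apply: filterS2 aeq (sqnorm_section_fin mRp mRp Lk) => x kx Lkx Dx.
  have {}Lkx := Lkx Dx.
  have intq (q : rat) : 0 < ratr q :> R ->
      cintegral leb `]0, (ratr q : R)] (fun y => k (x, y)) = 0.
    move=> q0; have := kx Dx (pickle q); rewrite /rn pickleK => <-.
    have sub : `]0, (ratr q : R)]%classic = Rp `&` `]0, (ratr q : R)]%classic.
      apply/seteqP; split => y /=; last by case.
      by rewrite /Rplus /= !in_itv/= andbT => /andP[y0 ->]; rewrite y0.
    apply: complex_ext => /=; rewrite /Rintegral sub integral_mkcondr; congr fine;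
      apply: eq_integral => y _; rewrite patchE /one indicE.
    + by rewrite cReM/= mulr0 subr0; case: (y \in _); rewrite /= ?mulr1 ?mulr0.
    + by rewrite cImM/= mulr0 add0r; case: (y \in _); rewrite /= ?mulr1 ?mulr0.
  have loc n : cintegrable leb `]0, n%:R : R] (fun y => k (x, y)).
    have := cintegrableM mRp Lkx (Lone n%:R) => -[_ foo].
    have sub : `]0, n%:R : R]%classic `<=` Rp.
      by move=> y /=; rewrite /Rplus/= !in_itv/= andbT => /andP[].
    split; first by apply: mcfunS sub _; [exact: mRp|exact: L2_measurable Lkx].
    apply: le_lt_trans foo; rewrite [leRHS]integral_mkcond [leLHS]integral_mkcond.
    rewrite le_eqVlt; apply/orP; left; apply/eqP; apply: eq_integral => y _.
    rewrite !patchE; case: ifPn => [|/negP ny].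
      move=> /set_mem yn; rewrite ifT; last by rewrite inE; exact: sub.
      by rewrite /one indicE mem_set//= Normc.normcM normc_real normr1 mulr1.
    case: ifP => // _; rewrite /one indicE (_ : (y \in _) = false) ?mulr0 ?Normc.normc0//.
    exact/negP.
  have Re0 : {ae leb, forall y, 0 < y -> complex.Re (k (x, y)) = 0}.
    apply: ae_eq0_of_int_rat => [n|q q0]; first exact: (cintegrable_Re _ (loc n)).
    by have := intq q q0 => /(congr1 (@complex.Re _)).
  have Im0 : {ae leb, forall y, 0 < y -> complex.Im (k (x, y)) = 0}.
    apply: ae_eq0_of_int_rat => [n|q q0]; first exact: (cintegrable_Im _ (loc n)).
    by have := intq q q0 => /(congr1 (@complex.Im _)).
  rewrite (ae_eq_sqnorm mRp (L2_measurable Lkx) (mcfun_cst Rp (0 : R[i]))).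
    by rewrite /sqnorm integral0_eq// => y _; rewrite Normc.normc0 expr0n.
  move: Re0 Im0; apply: filterS2; first exact: (ae_filter_ringOfSetsType leb).
  move=> y Rey Imy; rewrite /Rplus/= in_itv/= andbT => y0.
  by apply: complex_ext => /=; [exact: Rey|exact: Imy].
apply: sqnorm_eq0; [exact: measurable_Rp2|exact: mk|].
rewrite /sqnorm (tonelli_rectangle1 leb leb mRp mRp); first last.
- by move=> z _; rewrite lee_fin sqr_ge0.
- exact: measurable_EFin_normc_sqr.
have -> : (0 = \int[leb]_(x in Rp) cst 0 x)%E by rewrite integral0.
apply: ge0_ae_eq_integral => //.
- exact: mRp.
- apply: (measurable_int_section1 leb mRp mRp (measurable_EFin_normc_sqr mk)).
  by move=> z _; rewrite lee_fin sqr_ge0.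
- by move=> x _; apply: integral_ge0 => y _; rewrite lee_fin sqr_ge0.
Qed.

Lemma L2_kernel_unique A k k' : is_L2_kernel A k -> is_L2_kernel A k' ->
  ae_eq leb2 Rp2 k k'.
Proof.
move=> [Lk Ak] [Lk' Ak'].
have Ld : L2 leb2 Rp2 (fun z => k z - k' z) by apply: L2B => //; exact: measurable_Rp2.
have : ae_eq leb2 Rp2 (fun z => k z - k' z) (cst 0).
  apply: L2_kernel_eq0 => // f Lf.
  apply: filterS3 (kernel_opB_ae Lk Lk' Lf) (Ak f Lf) (Ak' f Lf).
  by move=> x kx Akx Akx' Dx; rewrite kx// /kernel_op -Akx// -Akx'// subrr.
by apply: filterS => z kz Dz; apply/eqP; rewrite -subr_eq0; apply/eqP; exact: kz.
Qed.

(** The tensors of the representation have L2 norms at most [p_k], so their series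
converges absolutely in L2 of the quadrant. *)
Lemma nuclear_L2_kernel A (u g : nat -> cfun R) p P :
  (forall f, L2p f -> L2p (A f)) -> nuclear_rep A u g p P ->
  exists s, is_L2_kernel A s /\ {ae leb2, forall z, Rp2 z ->
     ((normc (s z))%:E <= \sum_(0 <= k <oo) (normc (u k z.1) * normc (g k z.2))%:E)%E}.
Proof.
move=> LA [p0 uP gP pP AP].
have mu_ k : measurable_cfun Rp (u k) by apply: L2p_measurable; case: (uP k).
have mg k : measurable_cfun Rp (g k) by apply: L2p_measurable; case: (gP k).
pose v k (z : measurableTypeR R * measurableTypeR R) := u k z.1 * g k z.2.
have mv k : measurable_cfun Rp2 (v k).
  by apply: mcfunM; [exact: (mcfun_fst _ mRp)|exact: (mcfun_snd _ mRp)].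
have vp k : (sqnorm leb2 Rp2 (v k) <= (p k ^+ 2)%:E)%E.
  rewrite /v sqnorm_tensor//; [|exact: mRp|exact: mRp].
  rewrite expr2 EFinM; apply: lee_pmul; rewrite ?sqnorm_ge0//; [by case: (uP k)|by case: (gP k)].
have p_cvg : cvgn (fun n => \sum_(0 <= k < n) p k).
  apply: (@cvg_series_of_abs _ _ P) => n; apply: le_trans (pP n).
  by under eq_bigr do rewrite ger0_norm//.
pose W := limn (fun n => \sum_(0 <= k < n) p k).
have pW n : \sum_(0 <= k < n) p k <= W.
  apply: nondecreasing_cvgn_le => //; apply/nondecreasing_seqP => m.
  by rewrite big_nat_recr//= lerDl.
have [s [ms sN sle]] := L2_series measurable_Rp2 mv p0 vp pW.
have Ls : L2 leb2 Rp2 s.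
  apply/L2P; split => //; have := sN 0%N; rewrite big_geq//.
  have -> : (fun z => s z - \sum_(0 <= k < 0) v k z) = s.
    by apply/funext => z; rewrite big_geq// subr0.
  by move=> /le_lt_trans; apply; exact: ltry.
exists s; split; last first.
  apply: filterS sle => z sz Dz; apply: le_trans (sz Dz) _.
  apply: lee_nneseries => k _ *; first by rewrite lee_fin normc_ge0.
  by rewrite Normc.normcM.
split => // f Lf.
rewrite -[X in ae_eq _ _ _ X]/(kernel_op s f).
have Lsf := L2_kernel_op Ls Lf.
have Lv k : L2 leb2 Rp2 (v k).
  by apply/L2P; split => //; apply: le_lt_trans (vp k) _; exact: ltry.
have Lvn n : L2 leb2 Rp2 (fun z => \sum_(0 <= k < n) v k z).
  by apply: L2_sum => //; exact: measurable_Rp2.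
have vnE n x : kernel_op (fun z => \sum_(0 <= k < n) v k z) f x =
    \sum_(0 <= k < n) cpairp f (g k) * u k x.
  rewrite /kernel_op /v/=; under eq_cintegral do rewrite mulr_suml.
  have Lgf k : cintegrable leb Rp (fun y => g k y * f y).
    by apply: cintegrableM => //; [exact: mRp|case: (gP k)].
  have E k : (fun y => u k x * g k y * f y) = (fun y => u k x * (g k y * f y)).
    by apply/funext => y; rewrite mulrA.
  rewrite cintegral_sum//; [|exact: mRp|].
    apply: eq_bigr => k _; rewrite E cintegralZ//; last exact: mRp.
    by rewrite mulrC -/(cpairp (g k) f) cpairC.
  by move=> k; rewrite E; exact: (cintegrableZ mRp _ (Lgf k)).
have [w w0 fw] := L2_sqnorm_le Lf.
have Ld : L2p (fun x => A f x - kernel_op s f x).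
  by apply: L2B => //; [exact: mRp|exact: LA].
have small (e : R) : 0 < e -> (sqnormp (fun x => A f x - kernel_op s f x)%R <= ((e + e) ^+ 2)%:E)%E.
  move=> e0.
  have [m mE] : exists m, forall n, (m <= n)%N ->
      (W - \sum_(0 <= k < n) p k) ^+ 2 * w ^+ 2 <= e ^+ 2.
    have : (fun n => W - \sum_(0 <= k < n) p k) @ \oo --> W - W.
      by apply: cvgB => //; exact: cvg_cst.
    rewrite subrr.
    have ew : 0 < e / (w + 1) by rewrite divr_gt0//; lra.
    move/cvgr_dist_le => /(_ _ ew)[m _ mP]; exists m => n mn.
    have := mP n mn; rewrite sub0r normrN ger0_norm ?subr_ge0// => H.
    have w1 : 0 < w + 1 by lra.
    have D0 : 0 <= W - \sum_(0 <= k < n) p k by rewrite subr_ge0.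
    rewrite -exprMn ler_sqr ?nnegrE ?mulr_ge0//; last exact: ltW.
    move: H; rewrite ler_pdivlMr// => H; nra.
  have ee0 : 0 < e ^+ 2 by rewrite exprn_gt0.
  have [n mn An] := AP f (e ^+ 2) m Lf ee0.
  have -> : (fun x => A f x - kernel_op s f x) =
      (fun x => (A f x - \sum_(0 <= k < n) cpairp f (g k) * u k x) +
        - (kernel_op s f x - \sum_(0 <= k < n) cpairp f (g k) * u k x)).
    by apply/funext => x; ring.
  have mS : measurable_cfun Rp (fun x => \sum_(0 <= k < n) cpairp f (g k) * u k x).
    by apply: mcfun_sum => k; apply: mcfunM => //; exact: mcfun_cst.
  have mAf := L2p_measurable (LA _ Lf); have msf := L2p_measurable Lsf.
  apply: sqnormD; rewrite ?(ltW e0)//.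
  - exact: mRp.
  - exact: mcfunB.
  - by apply: mcfunN; exact: mcfunB.
  rewrite sqnormN; have Lsn : L2 leb2 Rp2 (fun z => s z - \sum_(0 <= k < n) v k z).
    by apply: L2B => //; exact: measurable_Rp2.
  rewrite -(@ae_eq_sqnorm _ _ _ leb Rp mRp
     (kernel_op (fun z => s z - \sum_(0 <= k < n) v k z) f)); first last.
  - by apply: filterS (kernel_opB_ae Ls (Lvn n) Lf) => x kx Dx; rewrite kx// vnE.
  - exact: mcfunB.
  - by apply: mcfun_kernel_op => //; exact: L2_measurable Lsn.
  apply: le_trans (sqnorm_kernel_le_HS leb leb mRp mRp (L2_measurable Lsn) (L2p_measurable Lf)) _.
  rewrite fw; apply: (@le_trans _ _ (((W - \sum_(0 <= k < n) p k) ^+ 2)%:E * (w ^+ 2)%:E)%E).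
    by apply: lee_wpmul2r; rewrite ?lee_fin ?sqr_ge0.
  by rewrite -EFinM lee_fin mE.
have : sqnormp (fun x => A f x - kernel_op s f x) = 0%E.
  have [c c0 cE] := L2_sqnorm_le Ld; rewrite cE.
  have [->|cn0] := eqVneq c 0; first by rewrite expr0n.
  have cp : 0 < c by rewrite lt_neqAle eq_sym cn0.
  have := small (c / 4); rewrite cE lee_fin divr_gt0// => /(_ isT).
  have -> : c / 4 + c / 4 = c / 2 by lra.
  rewrite ler_sqr ?nnegrE ?divr_ge0 // => H; exfalso; clear -H cp; lra.
move=> /(sqnorm_eq0 mRp (L2p_measurable Ld)); apply: filterS => x H Dx.
by apply/eqP; rewrite -subr_eq0; apply/eqP; exact: H.
Qed.

End kernels.

(** * Dyadic shells and a Hardy inequality *)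

Section dyadic_blocks.
Variable R : realType.
Implicit Types (x y : R) (n k : nat).

Let zindex n : int := if odd n then Negz n./2 else Posz n./2.

Let zindex_inj : injective zindex.
Proof.
rewrite /zindex => m n H; rewrite -(odd_double_half m) -(odd_double_half n).
by move: H; case: (odd m); case: (odd n) => // -[->].
Qed.

Let zindex_surj (z : int) : exists n, zindex n = z.
Proof.
case: z => k; [exists k.*2|exists k.*2.+1]; rewrite /zindex /=.
  by rewrite odd_double doubleK.
by rewrite odd_double/= uphalf_double.
Qed.

(** Enumerating all scales, small and large, by the natural numbers makes sums over the
scales ordinary series. *)
Definition dyad n : R := 2 ^ zindex n.

Lemma dyad_gt0 n : 0 < dyad n.
Proof. by rewrite exprz_gt0. Qed.

Let double_expz (z : int) : 2 * 2 ^ z = 2 ^ (z + 1) :> R.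
Proof. by rewrite expfzDr// expr1z mulrC. Qed.

Lemma dyad_inj m n x : dyad m <= x < 2 * dyad m -> dyad n <= x < 2 * dyad n -> m = n.
Proof.
rewrite /dyad !double_expz; move=> /andP[m1 m2] /andP[n1 n2]; apply: zindex_inj.
have := le_lt_trans m1 n2; rewrite ltr_eXz2l ?ltr1n// => h1.
have := le_lt_trans n1 m2; rewrite ltr_eXz2l ?ltr1n// => h2.
by lia.
Qed.

Lemma pow2_bracket x : 1 <= x -> exists k, 2 ^+ k <= x < 2 ^+ k.+1.
Proof.
move=> x1; pose N := Num.truncn x; have /andP[Nx xN] : N%:R <= x < N.+1%:R.
  by apply: truncn_itv; lra.
have N0 : (0 < N)%N.
  by rewrite lt0n; apply/eqP => N0; move: xN; rewrite N0; lra.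
have /andP[k1 k2] := trunc_log_bounds (isT : 1 < 2)%N N0.
exists (trunc_log 2 N); apply/andP; split.
  by apply: le_trans Nx; rewrite -natrX ler_nat.
by apply: lt_le_trans xN _; rewrite -natrX ler_nat.
Qed.

Lemma dyad_cover x : 0 < x -> exists n, dyad n <= x < 2 * dyad n.
Proof.
move=> x0.
suff [z zx] : exists z : int, (2 : R) ^ z <= x < 2 ^ (z + 1).
  have [n nz] := zindex_surj z; exists n.
  by rewrite /dyad nz double_expz.
have [x1|x1] := leP 1 x.
  by have [k kx] := pow2_bracket x1; exists k; rewrite -PoszD addn1.
have xi1 : 1 <= x^-1 by rewrite invf_ge1// ltW.
have [k /andP[k1 k2]] := pow2_bracket xi1.
have p0 j : 0 < (2 : R) ^+ j by rewrite exprn_gt0.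
have [kx|kx] := eqVneq x ((2 ^+ k)^-1).
  exists (- k%:Z); rewrite -double_expz -exprnN -kx lexx/=; lra.
exists (- k.+1%:Z); apply/andP; split.
  by rewrite -exprnN -[leRHS]invrK lef_pV2 ?posrE ?invr_gt0// ltW.
rewrite (_ : - k.+1%:Z + 1 = - k%:Z); last by lia.
rewrite -exprnN lt_neqAle kx/= -[leLHS]invrK lef_pV2 ?posrE ?invr_gt0//.
Qed.

Lemma geometric_half_cover x y : 0 < y -> y < 2 * x ->
  exists k, 2^-1 ^+ k * x <= y < 2 * (2^-1 ^+ k * x).
Proof.
move=> y0 yx; have x0 : 0 < x by lra.
have [xy|xy] := leP x y; first by exists 0%N; rewrite expr0 mul1r xy.
have p0 j : 0 < (2 : R) ^+ j by rewrite exprn_gt0.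
have xy1 : 1 <= x / y by rewrite ler_pdivlMr// mul1r ltW.
have [k /andP[k1 k2]] := pow2_bracket xy1.
move: k1 k2; rewrite ler_pdivlMr// ltr_pdivrMr// => k1 k2.
have [E|E] := eqVneq (2 ^+ k * y) x.
  exists k; rewrite exprVn -E mulKf ?gt_eqF// lexx/=; lra.
exists k.+1; rewrite exprVn; apply/andP; split.
  by rewrite mulrC ler_pdivrMr ?p0// [leRHS]mulrC ltW.
rewrite exprS invfM !mulrA divff// mul1r mulrC ltr_pdivlMr// mulrC.
by rewrite lt_neqAle E.
Qed.

End dyadic_blocks.

Section dyadic_hardy.
Variable R : realType.
Local Notation leb := (@lebesgue_measure R).
Local Notation Rp := (@Rplus R).
Local Notation mRp := (@measurable_Rplus R).
Local Notation dyad := (@dyad R).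

Definition shell (x : R) : set (measurableTypeR R) := `[x, 2 * x[%classic.
Definition below (x : R) : set (measurableTypeR R) := `]0, x[%classic.

Lemma measurable_shell x : measurable (shell x).
Proof. exact: measurable_itv. Qed.

Lemma measurable_below x : measurable (below x).
Proof. exact: measurable_itv. Qed.

Lemma below_Rplus x : below x `<=` Rp.
Proof. by move=> y; rewrite /below/= /Rplus/= !in_itv/= andbT => /andP[]. Qed.

Lemma shell_Rplus x : 0 < x -> shell x `<=` Rp.
Proof.
move=> x0 y; rewrite /shell/= /Rplus/= !in_itv/= andbT => /andP[xy _].
exact: lt_le_trans xy.
Qed.

Lemma shell_dyad_trivIset (c : R) : 0 < c -> trivIset setT (fun n => shell (c * dyad n)).
Proof.
move=> c0; apply/trivIsetP => m n _ _ mn; apply/seteqP; split => y //=.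
rewrite /shell/= !in_itv/= => -[/andP[m1 m2] /andP[n1 n2]]; move/eqP: mn; apply.
apply: (@dyad_inj R m n (y / c)); rewrite ler_pdivlMr// ltr_pdivrMr//.
  by rewrite mulrC m1/= -mulrA [dyad m * c]mulrC.
by rewrite mulrC n1/= -mulrA [dyad n * c]mulrC.
Qed.

Lemma shell_dyad_cover : \bigcup_n shell (dyad n) = Rp.
Proof.
apply/seteqP; split => [y [n _]|y]; first exact: (shell_Rplus (dyad_gt0 R n)).
rewrite /Rplus/= in_itv/= andbT => /dyad_cover[n ny].
by exists n => //; rewrite /shell/= in_itv.
Qed.

Lemma shell_trivIset1 : trivIset setT (fun n => shell (dyad n)).
Proof.
have := shell_dyad_trivIset (@ltr01 R); congr (trivIset _ _).
by apply/funext => n; rewrite mul1r.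
Qed.

Lemma half_pow_gt0 k : 0 < 2^-1 ^+ k :> R.
Proof. by rewrite exprn_gt0// invr_gt0. Qed.

Lemma shell_half_trivIset (x : R) : 0 < x -> trivIset setT (fun k => shell (2^-1 ^+ k * x)).
Proof.
move=> x0.
have lt_half (m n : nat) y : (m < n)%N -> 2^-1 ^+ m * x <= y -> y < 2 * (2^-1 ^+ n * x) -> False.
  move=> mn my yn; have := le_lt_trans my yn.
  rewrite mulrA ltr_pM2r//.
  rewrite (_ : 2 * 2^-1 ^+ n = 2^-1 ^+ n.-1 :> R); last first.
    by case: n mn yn => // n _ _; rewrite exprS mulrA divff// mul1r.
  rewrite ltNge; move/negP; apply.
  by rewrite ler_wiXn2l ?invr_ge0 ?invf_le1 ?ler1n//; case: n mn yn.
apply/trivIsetP => m n _ _ mn; apply/seteqP; split => y //=.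
rewrite /shell/= !in_itv/= => -[/andP[m1 m2] /andP[n1 n2]].
move: mn; rewrite neq_ltn => /orP[mn|mn].
  exact: lt_half mn m1 n2.
exact: lt_half mn n1 m2.
Qed.

Lemma below_shells (x : R) : 0 < x -> \bigcup_k shell (2^-1 ^+ k * x) = below (2 * x).
Proof.
move=> x0; apply/seteqP; split => [y [k _]|y].
  rewrite /shell /below/= !in_itv/= => /andP[ky yk].
  rewrite (lt_le_trans _ ky) ?mulr_gt0 ?half_pow_gt0//=.
  apply: lt_le_trans yk _; rewrite ler_pM2l// ler_piMl// ?(ltW x0)//.
  by rewrite exprn_ile1 ?invr_ge0 ?invf_le1 ?ler1n.
rewrite /below/= in_itv/= => /andP[y0 yx].
have [k ky] := geometric_half_cover y0 yx.
by exists k => //; rewrite /shell/= in_itv.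
Qed.

Local Open Scope ereal_scope.

Lemma sum_shells_le (g : measurableTypeR R -> \bar R) (c : R) :
  measurable_fun Rp g -> (forall x, Rp x -> 0 <= g x) -> (0 < c)%R ->
  \sum_(0 <= n <oo) \int[leb]_(x in shell (c * dyad n)) g x <= \int[leb]_(x in Rp) g x.
Proof.
move=> mg g0 c0; have sub : \bigcup_n shell (c * dyad n) `<=` Rp.
  by move=> x [n _]; apply: shell_Rplus; rewrite mulr_gt0// dyad_gt0.
have mU : measurable (\bigcup_n shell (c * dyad n)).
  by apply: bigcup_measurable => n _; exact: measurable_shell.
rewrite -ge0_integral_bigcup//.
- by apply: ge0_subset_integral => //; exact: mRp.
- by move=> n; exact: measurable_shell.
- by apply: measurable_funS sub mg; exact: mRp.
- by move=> x /sub /g0.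
- exact: shell_dyad_trivIset.
Qed.

Variable h : measurableTypeR R -> \bar R.
Hypothesis mh : measurable_fun Rp h.
Hypothesis h0 : forall x, Rp x -> (0 <= h x)%E.

Lemma integral_shells : \int[leb]_(x in Rp) h x =
  \sum_(0 <= n <oo) \int[leb]_(x in shell (dyad n)) h x.
Proof.
rewrite -shell_dyad_cover ge0_integral_bigcup ?shell_dyad_cover//.
- by move=> n; exact: measurable_shell.
- exact: shell_trivIset1.
Qed.

Lemma integral_below (x : R) : (0 < x)%R -> \int[leb]_(y in below (2 * x)) h y =
  \sum_(0 <= k <oo) \int[leb]_(y in shell (2^-1 ^+ k * x)) h y.
Proof.
move=> x0; rewrite -below_shells// ge0_integral_bigcup ?below_shells//.
- by move=> n; exact: measurable_shell.
- by apply: measurable_funS mh; [exact: mRp|exact: below_Rplus].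
- by move=> y /below_Rplus /h0.
- exact: shell_half_trivIset.
Qed.

Lemma sqr_integral_le (A : set (measurableTypeR R)) : measurable A -> A `<=` Rp ->
  (\int[leb]_(x in A) h x) ^+ 2 <= leb A * \int[leb]_(x in A) h x ^+ 2.
Proof.
move=> mA sub.
have mhA : measurable_fun A h by apply: measurable_funS sub mh; exact: mRp.
have := @cauchy_schwarz_ge0 _ _ _ leb A mA (cst 1) h (measurable_cst _) mhA
  (fun _ _ => lee01) (fun x Ax => h0 (sub _ Ax)).
under eq_integral do rewrite mul1e.
move=> /le_trans; apply; rewrite (_ : \int[leb]_(x in A) cst 1 x ^+ 2 = leb A)//.
under eq_integral do rewrite /cst expe2 mule1.
by rewrite integral_cst// mul1e.
Qed.

Lemma lebesgue_shell (x : R) : (0 < x)%R -> leb (shell x) = x%:E.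
Proof.
move=> x0; rewrite /shell lebesgue_measure_itv/= lte_fin ltr_pMl// ltr1n -EFinB.
by congr EFin; lra.
Qed.

(** Minkowski over the scales.  The interval [(0, 2 r[] is the union of the shells
[2^-k r]; for fixed [k], Cauchy-Schwarz on each of these shells gives a total of at most
[2^-k] times the square integral, and [2^-(k/2) <= (3/4)^k] is summable with sum 4. *)
Lemma dyadic_hardy (X : R) : (0 <= X)%R -> \int[leb]_(x in Rp) h x ^+ 2 <= X%:E ->
  \sum_(0 <= n <oo) ((dyad n)^-1)%:E * (\int[leb]_(x in below (2 * dyad n)) h x) ^+ 2
    <= (16 * X)%:E.
Proof.
move=> X0 hX.
have d0 n : (0 < dyad n)%R by exact: dyad_gt0.
have s0 n : (0 <= (Num.sqrt (dyad n))^-1)%R by rewrite invr_ge0 sqrtr_ge0.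
have ss n : ((Num.sqrt (dyad n))^-1 ^+ 2 = (dyad n)^-1)%R.
  by rewrite exprVn sqr_sqrtr// ltW.
have int0 (A : set (measurableTypeR R)) : A `<=` Rp -> 0 <= \int[leb]_(x in A) h x.
  by move=> sub; apply: integral_ge0 => x /sub /h0.
have rsub k n : shell (2^-1 ^+ k * dyad n) `<=` Rp.
  by apply: shell_Rplus; rewrite mulr_gt0// half_pow_gt0.
pose H (k n : nat) := ((Num.sqrt (dyad n))^-1)%:E * \int[leb]_(x in shell (2^-1 ^+ k * dyad n)) h x.
have H0 k n : 0 <= H k n by rewrite mule_ge0 ?lee_fin// int0.
have hsqr0 x : Rp x -> 0 <= h x ^+ 2 by move=> _; exact: sqre_ge0.
have mh2 : measurable_fun Rp (fun x => h x ^+ 2) by exact: measurable_sqre.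
(* [3 / 4] is a rational upper bound of [sqrt (1 / 2)]. *)
pose w k := ((3 / 4) ^+ k * Num.sqrt X)%R.
have Hw k : \int[counting]_(n in setT) (H k n ^+ 2) <= ((w k) ^+ 2)%:E.
  rewrite ge0_integral_count; last by move=> n; exact: sqre_ge0.
  apply: (@le_trans _ _ (\sum_(0 <= n <oo) (2^-1 ^+ k)%:E *
      \int[leb]_(x in shell (2^-1 ^+ k * dyad n)) h x ^+ 2)).
    apply: lee_nneseries => n _ *; first exact: sqre_ge0.
    rewrite /H !expe2 muleACA -EFinM -expr2 ss.
    apply: (@le_trans _ _ (((dyad n)^-1)%:E * ((2^-1 ^+ k * dyad n)%:E *
        \int[leb]_(x in shell (2^-1 ^+ k * dyad n)) h x ^+ 2))).
      apply: lee_wpmul2l; first by rewrite lee_fin invr_ge0 ltW.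
      rewrite -expe2; apply: le_trans (sqr_integral_le (measurable_shell _) (rsub k n)) _.
      by rewrite lebesgue_shell// mulr_gt0// half_pow_gt0.
    by rewrite muleA -EFinM mulrCA mulVf ?mulr1// gt_eqF.
  rewrite nneseriesZl; last first.
    by move=> n _; apply: integral_ge0 => x _; exact: sqre_ge0.
  apply: (@le_trans _ _ ((2^-1 ^+ k)%:E * X%:E)).
    apply: lee_wpmul2l; first by rewrite lee_fin ltW// half_pow_gt0.
    exact: le_trans (sum_shells_le mh2 hsqr0 (half_pow_gt0 k)) hX.
  rewrite -EFinM lee_fin /w exprMn sqr_sqrtr// ler_wpM2r// -exprM mulnC exprM.
  by rewrite lerXn2r ?nnegrE ?invr_ge0//; lra.
have w0 k : (0 <= w k)%R by rewrite mulr_ge0 ?exprn_ge0 ?sqrtr_ge0// divr_ge0.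
have wW n : (\sum_(0 <= k < n) w k <= 4 * Num.sqrt X)%R.
  have -> : (\sum_(0 <= k < n) w k = (4 - 4 * (3 / 4) ^+ n) * Num.sqrt X)%R.
    elim: n => [|n IH]; first by rewrite big_geq// expr0; lra.
    by rewrite big_nat_recr//= IH /w exprS; lra.
  rewrite ler_wpM2r ?sqrtr_ge0// lerBlDr lerDl mulr_ge0// exprn_ge0//; lra.
have mH k : measurable_fun [set: nat] (H k) by [].
have := @minkowski_series _ _ R counting setT measurableT H w _ mH
  (fun k n _ => H0 k n) w0 Hw wW.
rewrite ge0_integral_count; last by move=> n; exact: sqre_ge0.
rewrite exprMn sqr_sqrtr// (_ : (4 ^+ 2 = 16)%R); last by rewrite -natrX.
apply: le_trans; rewrite le_eqVlt; apply/orP; left; apply/eqP.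
apply: eq_eseriesr => n _; rewrite integral_below//.
rewrite /H nneseriesZl; last by move=> k _; exact: int0.
by rewrite !expe2 muleACA -EFinM -expr2 ss.
Qed.

End dyadic_hardy.

(** * Estimate of the averaging symbol *)

Section ae_sections.
Context d1 d2 (T1 : measurableType d1) (T2 : measurableType d2) (R : realType).
Variables (m1 : {sigma_finite_measure set T1 -> \bar R})
  (m2 : {sigma_finite_measure set T2 -> \bar R}).
Variables (P : T1 * T2 -> Prop).
Hypothesis aeP : {ae (m1 \x m2)%E, forall z, P z}.

Let null : exists N, [/\ measurable N, (m1 \x m2)%E N = 0%E & ~` [set z | P z] `<=` N].
Proof. by have [N [mN N0 PN]] := aeP; exists N. Qed.

Let zero1 d (T : measurableType d) (m : {measure set T -> \bar R}) (A : set T) :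
  measurable A -> (\int[m]_(x in setT) (\1_A x)%:E = 0)%E -> m A = 0%E.
Proof. by move=> mA; rewrite integral_indic// setIT. Qed.

Lemma ae_product_section1 : {ae m1, forall x, {ae m2, forall y, P (x, y)}}.
Proof.
have [N [mN N0 PN]] := null.
have mF : measurable_fun (setT `*` setT) (fun z : T1 * T2 => (\1_N z : R)%:E).
  by rewrite setXTT; apply/measurable_EFinP; exact: measurable_indic.
have F0 z : (setT `*` setT) z -> (0 <= (\1_N z : R)%:E)%E by rewrite lee_fin.
have := tonelli_rectangle1 m1 m2 measurableT measurableT mF F0.
rewrite setXTT integral_indic// setIT => H; have I0 := etrans (esym H) N0.
have mI : measurable_fun setT (fun x => \int[m2]_(y in setT) (\1_N (x, y) : R)%:E)%E.
  exact: (measurable_int_section1 m2 measurableT measurableT mF F0).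
have /(ae_eq_integral_abs m1 measurableT mI).1 :
    (\int[m1]_(x in setT) `|\int[m2]_(y in setT) (\1_N (x, y) : R)%:E| = 0)%E.
  rewrite -[RHS]I0; apply: eq_integral => x _; rewrite gee0_abs//.
  by apply: integral_ge0 => y _; rewrite lee_fin.
apply: filterS => x /(_ I) /= x0; exists (xsection N x); split.
- exact: measurable_xsection.
- apply: zero1; first exact: measurable_xsection.
  by rewrite -[RHS]x0; apply: eq_integral => y _; rewrite !indicE mem_xsection.
- by move=> y /= Py; apply/xsectionP; exact: PN.
Qed.

Lemma ae_product_section2 : {ae m2, forall y, {ae m1, forall x, P (x, y)}}.
Proof.
have [N [mN N0 PN]] := null.
have mF : measurable_fun (setT `*` setT) (fun z : T1 * T2 => (\1_N z : R)%:E).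
  by rewrite setXTT; apply/measurable_EFinP; exact: measurable_indic.
have F0 z : (setT `*` setT) z -> (0 <= (\1_N z : R)%:E)%E by rewrite lee_fin.
have := tonelli_rectangle2 m1 m2 measurableT measurableT mF F0.
rewrite setXTT integral_indic// setIT => H; have I0 := etrans (esym H) N0.
have mI : measurable_fun setT (fun y => \int[m1]_(x in setT) (\1_N (x, y) : R)%:E)%E.
  exact: (measurable_int_section2 m1 measurableT measurableT mF F0).
have /(ae_eq_integral_abs m2 measurableT mI).1 :
    (\int[m2]_(y in setT) `|\int[m1]_(x in setT) (\1_N (x, y) : R)%:E| = 0)%E.
  rewrite -[RHS]I0; apply: eq_integral => y _; rewrite gee0_abs//.
  by apply: integral_ge0 => x _; rewrite lee_fin.
apply: filterS => y /(_ I) /= y0; exists (ysection N y); split.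
- exact: measurable_ysection.
- apply: zero1; first exact: measurable_ysection.
  by rewrite -[RHS]y0; apply: eq_integral => x _; rewrite !indicE mem_ysection.
- by move=> x /= Px; apply/ysectionP; exact: PN.
Qed.

End ae_sections.

Lemma cintegral_restrict d (T : measurableType d) (R : realType)
    (mu : {measure set T -> \bar R}) (A D : set T) (f : T -> R[i]) : A `<=` D ->
  cintegral mu A f = cintegral mu D (fun x => (\1_A x : R)%:C * f x).
Proof.
move=> AD; rewrite (_ : A = D `&` A); last by apply/seteqP; split => [x Ax|x []//]; split => //; exact: AD.
apply: complex_ext => /=; rewrite /Rintegral integral_mkcondr; congr fine;
  apply: eq_integral => x xD; rewrite patchE !indicE in_setI xD/=;
  case: (x \in A) => /=; rewrite ?cReM ?cImM/= ?mul1r ?mul0r ?subr0 ?addr0//.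
Qed.

Section averaging_symbol.
Variable R : realType.
Local Notation leb := (@lebesgue_measure R).
Local Notation Rp := (@Rplus R).
Local Notation mRp := (@measurable_Rplus R).
Local Notation Rp2 := (Rp `*` Rp).

Lemma measurable_lt_set : measurable [set z : measurableTypeR R * measurableTypeR R | z.1 < z.2].
Proof.
rewrite -[X in measurable X]setTI.
have := @measurable_fun_ltr _ _ R setT (fst : measurableTypeR R * measurableTypeR R -> R) snd
   measurable_fst measurable_snd measurableT [set true].
by apply.
Qed.

Lemma measurable_gt_set : measurable [set z : measurableTypeR R * measurableTypeR R | z.2 < z.1].
Proof.
rewrite -[X in measurable X]setTI.
have := @measurable_fun_ltr _ _ R setT (snd : measurableTypeR R * measurableTypeR R -> R) fst
   measurable_snd measurable_fst measurableT [set true].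
by apply.
Qed.

Lemma measurable_inv_Rplus : measurable_fun Rp (fun x => x^-1).
Proof.
apply: open_continuous_measurable_fun; first exact: interval_open.
move=> x; rewrite inE /Rplus/= in_itv/= andbT => x0.
by apply: inv_continuous; rewrite gt_eqF.
Qed.

Lemma in_below (t x : R) : 0 < t -> (t \in below x) = (t < x).
Proof.
move=> t0; apply/idP/idP => [/set_mem|tx]; first by rewrite /below/= in_itv/= => /andP[].
by apply/mem_set; rewrite /below/= in_itv/= t0.
Qed.

Lemma mcfun_averaging_symbol k : measurable_cfun Rp2 k ->
  measurable_cfun Rp (averaging_symbol k).
Proof.
move=> mk; apply: mcfunM.
  apply: mcfun_real; under eq_fun do rewrite invfM.
  by apply: measurable_funM => //; exact: measurable_inv_Rplus.
have mD : measurable Rp2 by exact: measurable_Rp2.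
apply: mcfunD.
  apply: (@eq_mcfun _ _ _ _ (fun x => cintegral leb Rp
    (fun t => (\1_[set z : measurableTypeR R * measurableTypeR R | z.2 < z.1] (x, t) : R)%:C * k (x, t)))).
    move=> x Dx; rewrite (@cintegral_restrict _ _ _ leb (below x) Rp); last exact: below_Rplus.
    apply: eq_cintegral => t; rewrite /Rplus/= in_itv/= andbT => t0.
    congr ((_)%:C * _); rewrite !indicE; congr ((_ : bool)%:R).
    by rewrite in_below//; apply/idP/idP => H; [exact: (set_mem H)|exact: mem_set].
  apply: (mcfun_cintegral1 leb mRp mRp (F := fun z => (\1_[set z : measurableTypeR R * measurableTypeR R | z.2 < z.1] z : R)%:C * k z)).
  apply: mcfunM => //; apply: mcfun_real; apply: measurable_indic; exact: measurable_gt_set.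
apply: (@eq_mcfun _ _ _ _ (fun x => cintegral leb Rp
  (fun t => (\1_[set z : measurableTypeR R * measurableTypeR R | z.1 < z.2] (t, x) : R)%:C * k (t, x)))).
  move=> x Dx; rewrite (@cintegral_restrict _ _ _ leb (below x) Rp); last exact: below_Rplus.
  apply: eq_cintegral => t; rewrite /Rplus/= in_itv/= andbT => t0.
  congr ((_)%:C * _); rewrite !indicE; congr ((_ : bool)%:R).
  by rewrite in_below//; apply/idP/idP => H; [exact: (set_mem H)|exact: mem_set].
apply: (mcfun_cintegral2 leb mRp mRp (F := fun z => (\1_[set z : measurableTypeR R * measurableTypeR R | z.1 < z.2] z : R)%:C * k z)).
apply: mcfunM => //; apply: mcfun_real; apply: measurable_indic; exact: measurable_lt_set.
Qed.

End averaging_symbol.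

Section scalar_inequalities.
Variable R : realType.

Lemma scaled_sqr_le (r s t a c : R) : 0 < r ->
  ((2 * r)^-1 * (s * c + t * a)) ^+ 2 <=
  (2 * r ^+ 2)^-1 * c ^+ 2 * s ^+ 2 + (2 * r ^+ 2)^-1 * a ^+ 2 * t ^+ 2.
Proof.
move=> r0; rewrite exprMn (_ : (2 * r)^-1 ^+ 2 = (2 * r ^+ 2)^-1 * 2^-1); last by field; lra.
rewrite -!mulrA -mulrDr ler_pM2l ?invr_gt0 ?mulr_gt0 ?exprn_gt0//.
by have := sqr_ge0 (s * c - t * a); nra.
Qed.

Lemma scaled_sum_eq (r a c x y : R) : 0 < r ->
  (2 * r ^+ 2)^-1 * c ^+ 2 * x + (2 * r ^+ 2)^-1 * a ^+ 2 * y =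
  2^-1 * (r^-1 * c ^+ 2 * x + r^-1 * a ^+ 2 * y) * r^-1.
Proof. by move=> r0; field; lra. Qed.

Lemma half_products_le (x y z t : R) : 0 <= x -> 0 <= y -> 0 <= z -> 0 <= t ->
  2^-1 * (t * x + z * y) <= (x + y + (z + t)) ^+ 2.
Proof.
move=> x0 y0 z0 t0.
have := mulr_ge0 x0 t0; have := mulr_ge0 y0 z0; have := mulr_ge0 x0 y0.
have := mulr_ge0 x0 z0; have := mulr_ge0 y0 t0; have := mulr_ge0 z0 t0.
by have := sqr_ge0 x; have := sqr_ge0 y; have := sqr_ge0 z; have := sqr_ge0 t; nra.
Qed.

End scalar_inequalities.

Section averaging_symbol_estimate.
Variable R : realType.
Local Notation leb := (@lebesgue_measure R).
Local Notation Rp := (@Rplus R).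
Local Notation mRp := (@measurable_Rplus R).
Local Notation leb2 := (leb \x leb)%E.
Local Notation Rp2 := (Rp `*` Rp).
Local Notation dyad := (@dyad R).
Local Notation sqnormp := (sqnorm leb Rp).

Implicit Types (v : cfun R) (x : R) (n m : nat).

Definition head_integral v x : \bar R := (\int[leb]_(y in below x) (normc (v y))%:E)%E.

Lemma head_integral_ge0 v x : (0 <= head_integral v x)%E.
Proof. by apply: integral_ge0 => y _; rewrite lee_fin normc_ge0. Qed.

Lemma head_integral_le v x y : measurable_cfun Rp v -> x <= y -> (head_integral v x <= head_integral v y)%E.
Proof.
move=> mv xy; apply: ge0_subset_integral.
- exact: measurable_below.
- exact: measurable_below.
- apply: measurable_EFin_normc; apply: mcfunS mv; [exact: mRp|exact: below_Rplus].
- by move=> z _; rewrite lee_fin normc_ge0.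
- by move=> z; rewrite /below/= !in_itv/= => /andP[-> zx]; exact: lt_le_trans xy.
Qed.

Lemma sqnorm_shell_le v n : measurable_cfun Rp v -> (sqnorm leb (shell (dyad n)) v <= sqnormp v)%E.
Proof.
move=> mv; apply: ge0_subset_integral.
- exact: measurable_shell.
- exact: mRp.
- exact: measurable_EFin_normc_sqr.
- by move=> z _; rewrite lee_fin sqr_ge0.
- exact: shell_Rplus (dyad_gt0 _ n).
Qed.

Lemma sum_sqnorm_shell v : measurable_cfun Rp v ->
  sqnormp v = (\sum_(0 <= n <oo) sqnorm leb (shell (dyad n)) v)%E.
Proof.
move=> mv; apply: integral_shells; first exact: measurable_EFin_normc_sqr.
by move=> x _; rewrite lee_fin sqr_ge0.
Qed.

Lemma sum_head_integral v (q : R) : measurable_cfun Rp v -> 0 <= q -> (sqnormp v <= q%:E)%E ->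
  (\sum_(0 <= n <oo) ((dyad n)^-1)%:E * head_integral v (2 * dyad n) ^+ 2 <= (16 * q)%:E)%E.
Proof.
move=> mv q0 vq; apply: dyadic_hardy => //; first exact: measurable_EFin_normc.
- by move=> x _; rewrite lee_fin normc_ge0.
Qed.

Variables (k : measurableTypeR R * measurableTypeR R -> R[i]) (u g : nat -> cfun R).
Hypothesis mk : measurable_cfun Rp2 k.
Hypothesis mu_ : forall m, measurable_cfun Rp (u m).
Hypothesis mg : forall m, measurable_cfun Rp (g m).
Hypothesis kle : {ae leb2, forall z, Rp2 z ->
  ((normc (k z))%:E <= \sum_(0 <= m <oo) (normc (u m z.1) * normc (g m z.2))%:E)%E}.

(** The domination of the kernel passes to almost every horizontal and vertical
section, which are the two that the symbol averages. *)
Lemma averaging_symbol_ae_le :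
  {ae leb, forall x : measurableTypeR R, Rp x -> ((normc (averaging_symbol k x))%:E <=
     \sum_(0 <= m <oo) ((2 * x)^-1)%:E *
       ((normc (u m x))%:E * head_integral (g m) x + (normc (g m x))%:E * head_integral (u m) x))%E}.
Proof.
apply: filterS2 (ae_product_section1 kle) (ae_product_section2 kle) => x kx1 kx2 Dx.
have x0 : 0 < x by move: Dx; rewrite /Rplus/= in_itv/= andbT.
have mb : measurable (below x) by exact: measurable_below.
have bsub : below x `<=` Rp by exact: below_Rplus.
have mhead v : measurable_cfun Rp v -> measurable_fun (below x) (fun y => (normc (v y))%:E).
  by move=> mv; apply: measurable_EFin_normc; apply: mcfunS mv; [exact: mRp|exact: below_Rplus].
have series_int (c : nat -> R) (v : nat -> cfun R) (f : cfun R) : (forall m, 0 <= c m) ->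
    (forall m, measurable_cfun Rp (v m)) -> measurable_cfun Rp f ->
    {ae leb, forall y, below x y -> ((normc (f y))%:E <= \sum_(0 <= m <oo) (c m * normc (v m y))%:E)%E} ->
    ((normc (cintegral leb (below x) f))%:E <=
      \sum_(0 <= m <oo) (c m)%:E * head_integral (v m) x)%E.
  move=> c0 mv mf fle.
  have mfb : measurable_cfun (below x) f by apply: mcfunS mf; [exact: mRp|].
  have cv0 m y : (0 <= (c m * normc (v m y))%:E)%E by rewrite lee_fin mulr_ge0 ?normc_ge0.
  have mcv m : measurable_fun (below x) (fun y => (c m * normc (v m y))%:E).
    under eq_fun do rewrite EFinM.
    by apply: measurable_funeM; exact: mhead.
  apply: le_trans (normc_cintegral_lee leb mb mfb) _.
  apply: (@le_trans _ _ (\int[leb]_(y in below x) \sum_(0 <= m <oo) (c m * normc (v m y))%:E)%E).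
    apply: ae_ge0_le_integral => //.
    - by move=> y _; rewrite lee_fin normc_ge0.
    - exact: measurable_EFin_normc.
    - by move=> y _; apply: nneseries_ge0 => m _ _; exact: cv0.
    - by apply: ge0_emeasurable_sum => [m y _ _|m _]; [exact: cv0|exact: mcv].
  rewrite integral_nneseries//; apply: lee_nneseries => m _ *.
    by apply: integral_ge0 => y _; exact: cv0.
  under eq_integral do rewrite EFinM.
  rewrite ge0_integralZl_EFin//; first by move=> y _; rewrite lee_fin normc_ge0.
  exact: mhead.
have I1 : ((normc (cintegral leb (below x) (fun t => k (x, t))))%:E <=
    \sum_(0 <= m <oo) (normc (u m x))%:E * head_integral (g m) x)%E.
  apply: series_int => //; first by move=> m; exact: normc_ge0.
    exact: (mcfun_section1 mRp mRp mk Dx).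
  by apply: filterS kx1 => y ky by_; apply: ky; split => //=; exact: bsub.
have I2 : ((normc (cintegral leb (below x) (fun t => k (t, x))))%:E <=
    \sum_(0 <= m <oo) (normc (g m x))%:E * head_integral (u m) x)%E.
  apply: series_int => //; first by move=> m; exact: normc_ge0.
    exact: (mcfun_section2 mRp mRp mk Dx).
  apply: filterS kx2 => y ky by_; have := ky (conj (bsub _ by_) Dx).
  by move=> /le_trans; apply; apply: lee_nneseries => m _ *;
    rewrite ?lee_fin ?mulr_ge0 ?normc_ge0//= mulrC.
have t0 (a : R) v : 0 <= a -> (0 <= a%:E * head_integral v x)%E.
  by move=> a0; rewrite mule_ge0 ?lee_fin// head_integral_ge0.
rewrite nneseriesZl; last by move=> m _; rewrite adde_ge0// t0// normc_ge0.
rewrite nneseriesD; [|by move=> m _ _; rewrite t0// normc_ge0..].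
rewrite /averaging_symbol Normc.normcM normc_real ger0_norm ?invr_ge0; last by lra.
rewrite EFinM; apply: lee_wpmul2l; first by rewrite lee_fin invr_ge0; lra.
apply: le_trans (leeD I1 I2); rewrite -EFinD lee_fin.
exact: le_normcD.
Qed.

Variables (p : nat -> R) (P : R).
Hypothesis p0 : forall m, 0 <= p m.
Hypothesis up : forall m, (sqnormp (u m) <= (p m)%:E)%E.
Hypothesis gp : forall m, (sqnormp (g m) <= (p m)%:E)%E.
Hypothesis pP : forall n, \sum_(0 <= m < n) p m <= P.

Let A v n := fine (sqnorm leb (shell (dyad n)) v).
Let B v n := fine (((dyad n)^-1)%:E * head_integral v (2 * dyad n) ^+ 2)%E.

Let d0 n : 0 < dyad n. Proof. exact: dyad_gt0. Qed.

Let B0 v n : (0 <= ((dyad n)^-1)%:E * head_integral v (2 * dyad n) ^+ 2)%E.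
Proof. by rewrite mule_ge0 ?sqre_ge0// lee_fin invr_ge0 ltW. Qed.

Let AE v n (q : R) : measurable_cfun Rp v -> (sqnormp v <= q%:E)%E ->
  sqnorm leb (shell (dyad n)) v = (A v n)%:E.
Proof.
move=> mv vq; rewrite fineK// ge0_fin_numE ?sqnorm_ge0//.
by apply: le_lt_trans (sqnorm_shell_le n mv) _; apply: le_lt_trans vq (ltry _).
Qed.

Let BE v n (q : R) : measurable_cfun Rp v -> 0 <= q -> (sqnormp v <= q%:E)%E ->
  (((dyad n)^-1)%:E * head_integral v (2 * dyad n) ^+ 2 = (B v n)%:E)%E.
Proof.
move=> mv q0 vq; rewrite fineK// ge0_fin_numE//.
apply: le_lt_trans (ltry (16 * q)); apply: le_trans (sum_head_integral mv q0 vq).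
apply: le_trans (nneseries_lim_ge n.+1 (fun j _ _ => B0 v j)).
rewrite big_nat_recr//= leeDr//.
by apply: sume_ge0 => j _; exact: B0.
Qed.

Let w m n := A (u m) n + A (g m) n + (B (u m) n + B (g m) n).

Let w0 m n : 0 <= w m n.
Proof. by rewrite !addr_ge0// fine_ge0// sqnorm_ge0. Qed.

Let wE m n : ((w m n)%:E = sqnorm leb (shell (dyad n)) (u m) + sqnorm leb (shell (dyad n)) (g m) +
  (((dyad n)^-1)%:E * head_integral (u m) (2 * dyad n) ^+ 2 + ((dyad n)^-1)%:E * head_integral (g m) (2 * dyad n) ^+ 2))%E.
Proof.
rewrite (AE n (mu_ m) (up m)) (AE n (mg m) (gp m)).
by rewrite (BE n (mu_ m) (p0 m) (up m)) (BE n (mg m) (p0 m) (gp m)).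
Qed.

(** Each square integral over the shells adds up to at most [p m], and each Hardy term to
at most [16 * p m]; there are two of each. *)
Let sum_w m : (\sum_(0 <= n <oo) (w m n)%:E <= (34 * p m)%:E)%E.
Proof.
pose a v n := sqnorm leb (shell (dyad n)) v.
pose c v n := (((dyad n)^-1)%:E * head_integral v (2 * dyad n) ^+ 2)%E.
have a0 v n : (0 <= a v n)%E by exact: sqnorm_ge0.
have c0 v n : (0 <= c v n)%E by exact: B0.
under eq_eseriesr do rewrite wE -![sqnorm leb _ _]/(a _ _) -![X in (_ + X)%E]/(c _ _ + c _ _)%E.
rewrite (@nneseriesD _ (fun n => a (u m) n + a (g m) n)%E (fun n => c (u m) n + c (g m) n)%E);
  [|by move=> n _ _; rewrite adde_ge0..].
rewrite (@nneseriesD _ (a (u m)) (a (g m))) //.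
rewrite (@nneseriesD _ (c (u m)) (c (g m))) //.
rewrite /a /c.
rewrite -!sum_sqnorm_shell//.
rewrite (_ : 34 * p m = (p m + p m) + (16 * p m + 16 * p m)); last by lra.
rewrite !EFinD; apply: leeD; first exact: leeD.
by apply: leeD; exact: sum_head_integral.
Qed.

Let P0 : 0 <= P. Proof. by have := pP 0%N; rewrite big_geq. Qed.

Let b n := fine (\sum_(0 <= m <oo) (w m n)%:E)%E.

Let sum_sum_w N : (\sum_(0 <= n < N) \sum_(0 <= m <oo) (w m n)%:E <= (34 * P)%:E)%E.
Proof.
rewrite -nneseries_sum_nat; last by move=> m n; rewrite lee_fin.
apply: (@le_trans _ _ (\sum_(0 <= m <oo) (34 * p m)%:E)%E).
  apply: lee_nneseries => m _ *; first by apply: sume_ge0 => n _; rewrite lee_fin.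
  by apply: le_trans (sum_w m); apply: nneseries_lim_ge => n _ _; rewrite lee_fin.
apply: lime_le; first by apply: is_cvg_nneseries => m _ _; rewrite lee_fin mulr_ge0.
by apply: nearW => n; rewrite sumEFin lee_fin -mulr_sumr ler_pM2l.
Qed.

Let bE n : (\sum_(0 <= m <oo) (w m n)%:E = (b n)%:E)%E.
Proof.
rewrite fineK// ge0_fin_numE; last by apply: nneseries_ge0 => m _ _; rewrite lee_fin.
apply: le_lt_trans (ltry (34 * P)); apply: le_trans (sum_sum_w n.+1).
rewrite big_nat_recr//= leeDr//.
by apply: sume_ge0 => j _; apply: nneseries_ge0 => m _ _; rewrite lee_fin.
Qed.

Let H n m x : \bar R := (((2 * dyad n)^-1)%:E *
  ((normc (u m x))%:E * head_integral (g m) (2 * dyad n) + (normc (g m x))%:E * head_integral (u m) (2 * dyad n)))%E.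

Let H0 n m x : (0 <= H n m x)%E.
Proof.
rewrite mule_ge0//; first by rewrite lee_fin invr_ge0 mulr_ge0// ltW.
by rewrite adde_ge0// mule_ge0 ?head_integral_ge0// lee_fin normc_ge0.
Qed.

Let shell_mc n v : measurable_cfun Rp v -> measurable_cfun (shell (dyad n)) v.
Proof. by move=> mv; apply: mcfunS mv; [exact: mRp|exact: shell_Rplus]. Qed.

Let mH n m : measurable_fun (shell (dyad n)) (H n m).
Proof.
apply: measurable_funeM; apply: emeasurable_funD;
  by apply: emeasurable_funM; [apply: measurable_EFin_normc; exact: shell_mc|exact: measurable_cst].
Qed.

Let int_H n m :
  (\int[leb]_(x in shell (dyad n)) H n m x ^+ 2 <= ((w m n / Num.sqrt (dyad n)) ^+ 2)%:E)%E.
Proof.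
have hfin v (q : R) : measurable_cfun Rp v -> 0 <= q -> (sqnormp v <= q%:E)%E ->
    head_integral v (2 * dyad n) = (fine (head_integral v (2 * dyad n)))%:E.
  move=> mv q0 vq; rewrite fineK// ge0_fin_numE ?head_integral_ge0//.
  have := BE n mv q0 vq; case: (head_integral v _) (head_integral_ge0 v (2 * dyad n)) => [r| |] //; first by rewrite ltry.
  have -> : (+oo ^+ 2 = +oo :> \bar R)%E by rewrite expe2 mulyy.
  by rewrite gt0_muley ?lte_fin ?invr_gt0.
have hB v : head_integral v (2 * dyad n) = (fine (head_integral v (2 * dyad n)))%:E ->
    B v n = (dyad n)^-1 * fine (head_integral v (2 * dyad n)) ^+ 2.
  by move=> E; rewrite /B E -EFin_expe -EFinM.
have Eu := hfin _ _ (mu_ m) (p0 m) (up m); have Eg := hfin _ _ (mg m) (p0 m) (gp m).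
have Bu := hB _ Eu; have Bg := hB _ Eg.
set a := fine (head_integral (u m) _) in Eu Bu; set c := fine (head_integral (g m) _) in Eg Bg.
have a0 : 0 <= a by rewrite fine_ge0// head_integral_ge0.
have c0 : 0 <= c by rewrite fine_ge0// head_integral_ge0.
have d := d0 n; set r := dyad n in d *.
have Au := AE n (mu_ m) (up m); have Ag := AE n (mg m) (gp m).
have ms v : measurable_cfun Rp v -> measurable_fun (shell r) (fun x => (normc (v x) ^+ 2)%:E).
  by move=> mv; apply: measurable_EFin_normc_sqr; exact: shell_mc.
have q0 : 0 <= (2 * r ^+ 2)^-1 by rewrite invr_ge0 mulr_ge0 ?sqr_ge0.
apply: (@le_trans _ _ (\int[leb]_(x in shell r)
    (((2 * r ^+ 2)^-1 * c ^+ 2)%:E * (normc (u m x) ^+ 2)%:E +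
     ((2 * r ^+ 2)^-1 * a ^+ 2)%:E * (normc (g m x) ^+ 2)%:E))%E).
  apply: ge0_le_integral.
  - exact: measurable_shell.
  - by move=> x _; exact: sqre_ge0.
  - by apply: measurable_sqre; exact: mH.
  - by apply: emeasurable_funD; apply: measurable_funeM; exact: ms.
  - move=> x _; rewrite /H -/r Eu Eg.
    set s := normc (u m x); set t := normc (g m x).
    rewrite (_ : (2 * r)^-1%:E * (s%:E * c%:E + t%:E * a%:E) =
      ((2 * r)^-1 * (s * c + t * a))%:E)%E//.
    rewrite (_ : _ + _ = ((2 * r ^+ 2)^-1 * c ^+ 2 * s ^+ 2 +
      (2 * r ^+ 2)^-1 * a ^+ 2 * t ^+ 2)%:E)%E// -EFin_expe lee_fin.
    exact: scaled_sqr_le.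
rewrite ge0_integralD; first last.
- by apply: measurable_funeM; exact: ms.
- by move=> x _; rewrite -EFinM lee_fin mulr_ge0 ?sqr_ge0// mulr_ge0 ?sqr_ge0.
- by apply: measurable_funeM; exact: ms.
- by move=> x _; rewrite -EFinM lee_fin mulr_ge0 ?sqr_ge0// mulr_ge0 ?sqr_ge0.
- exact: measurable_shell.
rewrite !ge0_integralZl_EFin ?mulr_ge0 ?sqr_ge0//;
  try (by move=> x _; rewrite lee_fin sqr_ge0); try exact: measurable_shell; try exact: ms.
rewrite -/(sqnorm leb (shell r) (u m)) -/(sqnorm leb (shell r) (g m)) Au Ag.
rewrite -!EFinM -EFinD lee_fin exprMn exprVn sqr_sqrtr ?(ltW d)// -/r.
have A0 v : 0 <= A v n by rewrite fine_ge0// sqnorm_ge0.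
have B0' v : 0 <= B v n by rewrite fine_ge0.
have -> : (2 * r ^+ 2)^-1 * c ^+ 2 * A (u m) n + (2 * r ^+ 2)^-1 * a ^+ 2 * A (g m) n =
  (2^-1 * (B (g m) n * A (u m) n + B (u m) n * A (g m) n)) * r^-1.
  by rewrite Bu Bg -/r; exact: scaled_sum_eq.
by rewrite ler_pM2r ?invr_gt0// /w; exact: half_products_le.
Qed.

(** On a shell, the term of index [m] is a product of a local square integral and a
Hardy average; the mean inequality bounds it by their sum [w m n], and Minkowski adds
the terms up. *)
Lemma averaging_symbol_estimate : exists b : nat -> R,
  [/\ forall n, 0 <= b n,
      forall n, ((dyad n)%:E * sqnorm leb (shell (dyad n)) (averaging_symbol k) <= (b n ^+ 2)%:E)%E &
      forall N, \sum_(0 <= n < N) b n <= 34 * P].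
Proof.
exists b; split.
- by move=> n; rewrite fine_ge0//; apply: nneseries_ge0 => m _ _; rewrite lee_fin.
- move=> n; have d := d0 n; have s0 : 0 < Num.sqrt (dyad n) by rewrite sqrtr_gt0.
  suff Hb : (sqnorm leb (shell (dyad n)) (averaging_symbol k) <=
      ((b n / Num.sqrt (dyad n)) ^+ 2)%:E)%E.
    apply: (@le_trans _ _ ((dyad n)%:E * ((b n / Num.sqrt (dyad n)) ^+ 2)%:E)%E).
      by apply: lee_wpmul2l => //; rewrite lee_fin ltW.
    by rewrite -EFinM lee_fin exprMn exprVn sqr_sqrtr ?(ltW d)// mulrCA divff ?mulr1// gt_eqF.
  have mphi : measurable_cfun (shell (dyad n)) (averaging_symbol k).
    by apply: shell_mc; exact: mcfun_averaging_symbol.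
  have wb N : \sum_(0 <= m < N) (w m n / Num.sqrt (dyad n)) <= b n / Num.sqrt (dyad n).
    rewrite -mulr_suml ler_pM2r ?invr_gt0// -lee_fin -bE -sumEFin.
    by apply: nneseries_lim_ge => m _ _; rewrite lee_fin.
  have wn0 m : 0 <= w m n / Num.sqrt (dyad n) by rewrite divr_ge0// ltW.
  have Hn := @minkowski_series _ _ _ leb _ (measurable_shell (dyad n)) (H n) _ _
    (@mH n) (fun m x _ => @H0 n m x) wn0 (@int_H n) wb.
  apply: (le_trans _ Hn).
  rewrite sqnormE; apply: ae_ge0_le_integral.
  + exact: measurable_shell.
  + by move=> x _; exact: sqre_ge0.
  + by apply: measurable_sqre; exact: measurable_EFin_normc.
  + by move=> x _; exact: sqre_ge0.
  + apply: measurable_sqre.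
    by apply: ge0_emeasurable_sum => [m x _ _|m _]; [exact: H0|exact: mH].
  apply: filterS averaging_symbol_ae_le => x phix rx.
  have Dx := shell_Rplus d rx.
  rewrite lee_sqr ?lee_fin ?normc_ge0//; last by apply: nneseries_ge0 => m _ _; exact: H0.
  apply: le_trans (phix Dx) _.
  move: rx; rewrite /shell/= in_itv/= => /andP[dx xd].
  have x0 : 0 < x by exact: lt_le_trans dx.
  apply: lee_nneseries => m _ *.
    by rewrite mule_ge0 ?lee_fin ?invr_ge0 ?mulr_ge0 ?(ltW x0)// adde_ge0// mule_ge0 ?head_integral_ge0// lee_fin normc_ge0.
  apply: lee_pmul.
  + by rewrite lee_fin invr_ge0 mulr_ge0// ltW.
  + by rewrite adde_ge0// mule_ge0 ?head_integral_ge0// lee_fin normc_ge0.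
  + by rewrite lee_fin lef_pV2 ?posrE ?mulr_gt0// ler_pM2l.
  + by apply: leeD; apply: lee_wpmul2l; rewrite ?lee_fin ?normc_ge0//; apply: head_integral_le => //; exact: ltW.
- move=> N; rewrite -lee_fin -sumEFin; apply: le_trans (sum_sum_w N).
  by apply: lee_sum => n _; rewrite bE.
Qed.

End averaging_symbol_estimate.

(** * Bounds for kernels and cutting shells into cells *)

Section cell_induction.
Variable R : realType.
Local Notation leb := (@lebesgue_measure R).
Variables (psi : R -> R) (delta : R).
Hypothesis ipsi : leb.-integrable setT (EFin \o psi).
Hypothesis psi0 : forall x, 0 <= psi x.
Hypothesis delta0 : 0 < delta.

Definition mass (c d : R) : R := \int[leb]_(x in `[c, d[) psi x.

Lemma mass_ge0 c d : 0 <= mass c d.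
Proof. by apply: Rintegral_ge0. Qed.

Lemma integrable_mass (A : set R) : measurable A -> leb.-integrable A (EFin \o psi).
Proof. by move=> mA; apply: integrableS ipsi. Qed.

Lemma massD c t d : c <= t -> t <= d -> mass c d = mass c t + mass t d.
Proof.
move=> ct td; rewrite /mass.
have -> : `[c, d[%classic = `[c, t[%classic `|` `[t, d[%classic :> set R.
  apply/seteqP; split => x /=.
    rewrite in_itv/= => /andP[cx xd]; have [xt|tx] := ltP x t.
      by left; rewrite /= in_itv/= cx.
    by right; rewrite /= in_itv/= tx.
  move=> [|] /=; rewrite !in_itv/= => /andP[ax xb].
    by rewrite ax/= (lt_le_trans xb).
  by rewrite (le_trans ct ax).
rewrite Rintegral_setU//; first exact: integrable_mass (measurableU _ _ (measurable_itv _) (measurable_itv _)).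
apply/disj_setPLR => x /=; rewrite !in_itv/= => /andP[_ xt]; apply/negP.
by rewrite negb_and -ltNge xt.
Qed.

Lemma mass_continuous c d : c <= d ->
  {within `[c, d], continuous (fun t => (t - c) * mass c t)}.
Proof.
move=> cd; have massE t : mass c t = \int[leb]_(x in `[c, t]) psi x.
  by rewrite /mass -Rintegral_itv_bndo_bndc//; exact: integrable_mass.
rewrite (_ : (fun t => (t - c) * mass c t) =
  (fun t => (t - c) * \int[leb]_(x in `[c, t]) psi x)); last first.
  by apply/funext => t; rewrite massE.
have c1 : {within `[c, d], continuous (fun t : R => t - c)}.
  by apply: continuous_subspaceT => x; apply: cvgB; [exact: cvg_id|exact: cvg_cst].
have c2 := parameterized_integral_continuous cd (integrable_mass (measurable_itv `[c, d])).
by move=> t; exact: cvgM (c1 t) (c2 t).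
Qed.

(** Cauchy-Schwarz in the plane, in the form [sqrt (x1 y1) + sqrt (x2 y2) <=
sqrt ((x1 + x2) (y1 + y2))]. *)
Lemma split_remainder (x1 y1 x2 y2 k : R) : 0 <= x1 -> 0 <= y1 -> 0 <= x2 -> 0 <= y2 ->
  0 <= k -> x1 * y1 = delta ^+ 2 ->
  (x1 + x2) * (y1 + y2) <= ((k + 1) * delta) ^+ 2 -> x2 * y2 <= (k * delta) ^+ 2.
Proof.
move=> x10 y10 x20 y20 k0 E H.
pose z := Num.sqrt (x2 * y2).
have z0 : 0 <= z by exact: sqrtr_ge0.
have zz : z ^+ 2 = x2 * y2 by rewrite sqr_sqrtr// mulr_ge0.
have cross : 2 * delta * z <= x1 * y2 + x2 * y1.
  rewrite -ler_sqr ?nnegrE; last 2 first.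
  - by rewrite !mulr_ge0// ltW.
  - by rewrite addr_ge0// mulr_ge0.
  have -> : (2 * delta * z) ^+ 2 = 4 * (x1 * y1) * (x2 * y2).
    by rewrite E -zz; ring.
  by have := sqr_ge0 (x1 * y2 - x2 * y1); nra.
have : (delta + z) ^+ 2 <= ((k + 1) * delta) ^+ 2.
  by apply: le_trans H; move: cross zz E; nra.
rewrite ler_sqr ?nnegrE; last 2 first.
- by rewrite addr_ge0// ltW.
- by rewrite mulr_ge0// ?addr_ge0// ltW.
move=> Hz; rewrite -zz ler_sqr ?nnegrE ?mulr_ge0//; last exact: ltW.
by move: Hz; rewrite mulrDl mul1r; lra.
Qed.

(** By continuity, the interval splits into a first cell that uses up exactly [delta]
and a remainder which needs one cell less by [split_remainder].  The cells enter only
through the predicate [Pr], which carries whatever is built on them. *)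
Lemma cell_induction (Pr : nat -> R -> R -> Prop) :
  (forall c d, 0 < c -> c < d -> (d - c) * mass c d <= delta ^+ 2 -> Pr 1 c d) ->
  (forall m c t d, c < t -> t < d -> Pr 1 c t -> Pr m t d -> Pr m.+1 c d) ->
  forall m c d, 0 < c -> c < d -> (d - c) * mass c d <= (m.+1%:R * delta) ^+ 2 ->
  exists2 k, (k <= m.+1)%N & Pr k c d.
Proof.
move=> base step; elim=> [|m IH] c d c0 cd H.
  by exists 1%N => //; apply: base => //; rewrite mul1r in H.
have [small|big] := leP ((d - c) * mass c d) (delta ^+ 2).
  by exists 1%N => //; exact: base.
have d2 : 0 < delta ^+ 2 by rewrite exprn_gt0.
have [|t tcd tE] := IVT (ltW cd) (mass_continuous (ltW cd)) (v := delta ^+ 2).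
  by rewrite subrr mul0r ge_min le_max (ltW d2) (ltW big) orbT.
move: tcd; rewrite in_itv/= => /andP[ct td].
have ct' : c < t.
  rewrite lt_neqAle ct andbT; apply/eqP => E; move: d2.
  by rewrite -tE -E subrr mul0r ltxx.
have td' : t < d.
  rewrite lt_neqAle td andbT; apply/eqP => E; move: big.
  by rewrite -tE -E ltxx.
have [k km Pk] : exists2 k, (k <= m.+1)%N & Pr k t d.
  apply: IH => //; first exact: lt_trans ct'.
  apply: (@split_remainder (t - c) (mass c t)); rewrite ?mass_ge0 ?subr_ge0//.
  rewrite -massD// (_ : t - c + (d - t) = d - c); last by ring.
  by apply: le_trans H _; rewrite -(natrD _ m.+1 1) addn1.
exists k.+1; first by rewrite ltnS.
by apply: (step _ _ t) => //; apply: base => //; rewrite tE.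
Qed.

End cell_induction.

Section nonneg_kernels.
Variable R : realType.
Local Notation leb := (@lebesgue_measure R).
Local Notation Rp := (@Rplus R).
Local Notation mRp := (@measurable_Rplus R).
Local Notation Rp2 := (Rp `*` Rp).
Local Notation T := (measurableTypeR R).

(** A bound on L2 for the nonnegative kernel [W], with norm the square root of [c]. *)
Definition kernel_bound (W : T * T -> \bar R) (c : R) : Prop :=
  forall (h : T -> \bar R) (X : R), measurable_fun Rp h -> (forall x, Rp x -> (0 <= h x)%E) ->
  0 <= X -> (\int[leb]_(y in Rp) h y ^+ 2 <= X%:E)%E ->
  (\int[leb]_(x in Rp) (\int[leb]_(y in Rp) (W (x, y) * h y)) ^+ 2 <= (c * X)%:E)%E.

Variables (W : T * T -> \bar R) (c : R).
Hypothesis mW : measurable_fun Rp2 W.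
Hypothesis W0 : forall z, Rp2 z -> (0 <= W z)%E.
Hypothesis c0 : 0 <= c.
Hypothesis Wc : kernel_bound W c.
Local Open Scope ereal_scope.

Let mWfst (f : T -> \bar R) : measurable_fun Rp f ->
  measurable_fun Rp2 (fun z => W z * f z.1).
Proof. by move=> mf; exact: (emeasurable_funM mW (measurable_comp_fst mRp mf)). Qed.

Let mWsnd (f : T -> \bar R) : measurable_fun Rp f ->
  measurable_fun Rp2 (fun z => W z * f z.2).
Proof. by move=> mf; exact: (emeasurable_funM mW (measurable_comp_snd mRp mf)). Qed.

Let trunc (H : T -> \bar R) (N : nat) (y : T) : \bar R :=
  mine (H y) N%:R%:E * ((y < N%:R)%R%:R)%:E.

Let measurable_trunc H N : measurable_fun Rp H -> measurable_fun Rp (trunc H N).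
Proof.
move=> mH; apply: emeasurable_funM; first exact: measurable_mine.
apply/measurable_EFinP.
rewrite (_ : (fun y : T => _) = \1_(`]-oo, N%:R[%classic : set T)).
  exact: measurable_indic.
apply/funext => y; rewrite indicE; congr ((_ : bool)%:R).
by apply/idP/idP => [yN|/set_mem]; [apply/mem_set|]; rewrite /= in_itv.
Qed.

Let trunc_cvg H y : 0 <= H y -> trunc H N y @[N --> \oo] --> H y.
Proof.
rewrite /trunc; case: (H y) => [r| |] // r0.
  apply: cvg_near_cst; exists (Num.truncn (Num.max r y)).+1 => //= N /= mN.
  have : (Num.max r y < N%:R)%R.
    by apply: lt_le_trans (truncnS_gt _) _; rewrite ler_nat.
  rewrite gt_max => /andP[rN yN]; rewrite yN mule1.
  by apply/min_idPl; rewrite lee_fin ltW.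
apply/cvgeyPge => A; exists (Num.truncn (Num.max A y)).+1 => //= N /= mN.
have : (Num.max A y < N%:R)%R.
  by apply: lt_le_trans (truncnS_gt _) _; rewrite ler_nat.
rewrite gt_max => /andP[AN yN]; rewrite yN mule1.
by rewrite min_r ?leey// lee_fin ltW.
Qed.

(** Pair the image with itself, exchange the integrals and apply the bound of [W]; the
image is truncated first, so that the factor to be cancelled is finite. *)
Lemma kernel_bound_transpose (f : T -> \bar R) (X : R) :
  measurable_fun Rp f -> (forall x, Rp x -> 0 <= f x) -> (0 <= X)%R ->
  \int[leb]_(x in Rp) f x ^+ 2 <= X%:E ->
  \int[leb]_(y in Rp) (\int[leb]_(x in Rp) (W (x, y) * f x)) ^+ 2 <= (c * X)%:E.
Proof.
move=> mf f0 X0 fX.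
pose H y := \int[leb]_(x in Rp) (W (x, y) * f x).
have H0 y : Rp y -> 0 <= H y.
  by move=> Dy; apply: integral_ge0 => x Dx; rewrite mule_ge0 ?f0// W0.
have mH : measurable_fun Rp H.
  apply: (measurable_int_section2 leb mRp mRp (mWfst mf)) => z [Dz1 Dz2].
  by rewrite mule_ge0 ?f0// W0.
have mtr N : measurable_fun Rp (trunc H N) by exact: measurable_trunc.
have tr0 N y : Rp y -> 0 <= trunc H N y.
  by move=> Dy; rewrite mule_ge0 ?lee_fin// le_min H0//= lee_fin.
have trH N y : Rp y -> trunc H N y <= H y.
  move=> Dy; rewrite /trunc; case: (y < N%:R)%R; rewrite ?mule1 ?mule0 ?H0//.
  by rewrite ge_min lexx.
have tr_bound N : \int[leb]_(y in Rp) trunc H N y ^+ 2 <= (c * X)%:E.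
  have fin : \int[leb]_(y in Rp) trunc H N y ^+ 2 < +oo.
    apply: (@le_lt_trans _ _ (\int[leb]_(y in Rp) (N%:R%:E ^+ 2 * (\1_(`]0%R, N%:R[%classic : set T) y)%:E))).
      apply: ge0_le_integral.
      - exact: mRp.
      - by move=> y _; exact: sqre_ge0.
      - exact: measurable_sqre.
      - apply: measurable_funeM; apply/measurable_EFinP; exact: measurable_indic.
      move=> y Dy; have y0 : (0 < y)%R by move: Dy; rewrite /Rplus/= in_itv/= andbT.
      rewrite indicE.
      rewrite (_ : (y \in _) = (y < N%:R)%R); last first.
        by apply/idP/idP => [/set_mem|?]; [|apply/mem_set]; rewrite /= in_itv/= y0.
      rewrite /trunc; case: (y < N%:R)%R; rewrite ?mule1 ?mule0.
        rewrite lee_sqr ?lee_fin//; last by rewrite le_min H0//= lee_fin.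
        by rewrite ge_min lexx orbT.
      by rewrite expe2 mule0.
    have mI : measurable_fun Rp (fun y => (\1_(`]0%R, N%:R[%classic : set T) y : R)%:E).
      by apply/measurable_EFinP; exact: measurable_indic.
    rewrite (@ge0_integralZl _ _ _ leb Rp mRp _ mI) ?sqre_ge0//.
    rewrite integral_indic//; last exact: mRp.
    apply: lte_mul_pinfty; rewrite ?sqre_ge0// -?EFin_expe//.
    apply: (@le_lt_trans _ _ (leb `]0%R, N%:R[%classic)).
      by apply: le_measure; rewrite ?inE//; apply: measurableI => //; exact: mRp.
    by rewrite lebesgue_measure_itv/=; case: ifP => // _; rewrite -EFinB ltry.
  have int0 : 0 <= \int[leb]_(y in Rp) trunc H N y ^+ 2.
    by apply: integral_ge0 => y _; exact: sqre_ge0.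
  have [Y [Y0 YE]] : exists Y : R, (0 <= Y)%R /\ \int[leb]_(y in Rp) trunc H N y ^+ 2 = Y%:E.
    by exists (fine (\int[leb]_(y in Rp) trunc H N y ^+ 2)); rewrite fine_ge0// fineK// ge0_fin_numE.
  pose V x := \int[leb]_(y in Rp) (W (x, y) * trunc H N y).
  have V0 x : Rp x -> 0 <= V x.
    by move=> Dx; apply: integral_ge0 => y Dy; rewrite mule_ge0 ?tr0// W0.
  have mV : measurable_fun Rp V.
    apply: (measurable_int_section1 leb mRp mRp (mWsnd (mtr N))) => z [Dz1 Dz2].
    by rewrite mule_ge0 ?tr0// W0.
  have le1 : Y%:E <= \int[leb]_(x in Rp) (f x * V x).
    rewrite -YE; apply: (@le_trans _ _ (\int[leb]_(y in Rp) (H y * trunc H N y))).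
      apply: ge0_le_integral.
      - exact: mRp.
      - by move=> y _; exact: sqre_ge0.
      - exact: measurable_sqre.
      - exact: emeasurable_funM.
      - by move=> y Dy; rewrite expe2; apply: lee_wpmul2r; [exact: tr0|exact: trH].
    have mF : measurable_fun Rp2 (fun z => W z * f z.1 * trunc H N z.2).
      apply: emeasurable_funM; first exact: mWfst.
      exact: (measurable_comp_snd mRp (mtr N)).
    have F0 z : Rp2 z -> 0 <= W z * f z.1 * trunc H N z.2.
      by move=> [Dz1 Dz2]; apply: mule_ge0; [apply: mule_ge0; [exact: W0|exact: f0]|exact: tr0].
    have := tonelli_swap leb leb mRp mRp mF F0 => /= swp.
    rewrite (_ : \int[leb]_(y in Rp) (H y * trunc H N y) =
      \int[leb]_(y in Rp) \int[leb]_(x in Rp) (W (x, y) * f x * trunc H N y)); last first.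
      apply: eq_integral => y /set_mem Dy; apply/esym.
      have ms := measurable_section2 mRp mRp (mWfst mf) Dy.
      apply: (@ge0_integralZr _ _ _ leb Rp mRp _ ms (trunc H N y)); last exact: tr0.
      move=> x Dx; have h1 : 0 <= W (x, y) by apply: W0; split.
      have h2 : 0 <= f x by exact: f0.
      exact: (mule_ge0 h1 h2).
    rewrite -swp le_eqVlt; apply/orP; left; apply/eqP.
    apply: eq_integral => x /set_mem Dx.
    have ms := measurable_section1 mRp mRp (mWsnd (mtr N)) Dx.
    rewrite /V -(@ge0_integralZl _ _ _ leb Rp mRp _ ms (f x)).
    - apply: eq_integral => y _ /=; by rewrite [RHS]muleA [f x * _]muleC.
    - move=> y Dy; have h1 : 0 <= W (x, y) by apply: W0; split.
      exact: (mule_ge0 h1 (tr0 N y Dy)).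
    - exact: f0.
  have fV0 : 0 <= \int[leb]_(x in Rp) (f x * V x).
    by apply: integral_ge0 => x Dx; rewrite mule_ge0 ?f0 ?V0.
  have le2 : (Y ^+ 2)%:E <= X%:E * (c * Y)%:E.
    apply: (@le_trans _ _ ((\int[leb]_(x in Rp) (f x * V x)) ^+ 2)).
      by rewrite EFin_expe lee_sqr// lee_fin.
    apply: (le_trans (@cauchy_schwarz_ge0 _ _ _ leb Rp mRp f V mf mV f0 V0)).
    apply: lee_pmul => //; try by apply: integral_ge0 => x _; exact: sqre_ge0.
    by apply: Wc => //; [exact: tr0|rewrite YE].
  rewrite YE lee_fin; move: le2; rewrite -EFinM lee_fin.
  have [->|Yn0] := eqVneq Y 0%R; first by rewrite mulr_ge0.
  have Yp : (0 < Y)%R by rewrite lt_neqAle eq_sym Yn0.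
  by rewrite mulrA expr2 ler_pM2r// mulrC.
rewrite (_ : \int[leb]_(y in Rp) (\int[leb]_(x in Rp) (W (x, y) * f x)) ^+ 2 =
    \int[leb]_(y in Rp) limn (fun N => trunc H N y ^+ 2)); last first.
  apply: eq_integral => y /set_mem Dy; apply/esym/cvg_lim => //.
  by apply: cvg_sqre; apply: trunc_cvg; exact: H0.
have nd y : Rp y -> nondecreasing_seq (fun N => trunc H N y ^+ 2).
  move=> Dy M N MN; rewrite lee_sqr ?tr0//.
  have MNR : (M%:R <= N%:R :> R)%R by rewrite ler_nat.
  rewrite /trunc; have [yM|My] := ltP y M%:R%R.
    rewrite (lt_le_trans yM MNR) !mule1 le_min ge_min lexx/=.
    by rewrite ge_min lee_fin MNR orbT.
  by rewrite mule0 mule_ge0 ?lee_fin// le_min H0//= lee_fin.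
have msq N : measurable_fun Rp (fun y => trunc H N y ^+ 2) by exact: measurable_sqre.
have mcv := @cvg_monotone_convergence _ _ _ leb Rp mRp (fun N y => trunc H N y ^+ 2)
  msq (fun N y _ => sqre_ge0 _) nd.
rewrite -(cvg_lim _ mcv)//; apply: lime_le; first by apply/cvg_ex; eexists; exact: mcv.
by apply: nearW => N; exact: tr_bound.
Qed.

Variable k : T * T -> R[i].
Hypothesis mk : measurable_cfun Rp2 k.
Hypothesis kW : forall x y, Rp x -> Rp y -> (normc (k (x, y)))%:E <= W (x, y) + W (y, x).

Let mWsw (f : T -> \bar R) : measurable_fun Rp f ->
  measurable_fun Rp2 (fun z => W (z.2, z.1) * f z.2).
Proof.
move=> mf; have mD : measurable Rp2 by exact: measurable_Rp2.
apply: emeasurable_funM; last exact: (measurable_comp_snd mRp mf).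
rewrite (_ : (fun z => W (z.2, z.1)) = W \o (fun z : T * T => (z.2, z.1)))//.
apply: (measurable_comp mD _ mW); first by move=> _ [[x y] [Dx Dy] <-].
by apply: measurable_funS (@measurable_swap _ _ T T).
Qed.

Let nf (f : cfun R) (y : T) : \bar R := (normc (f y))%:E.

Lemma int_sqr_kernel_le (f : cfun R) (X : R) : L2p f -> (0 <= X)%R ->
  sqnorm leb Rp f <= X%:E ->
  \int[leb]_(x in Rp) (\int[leb]_(y in Rp) ((normc (k (x, y)))%:E * (normc (f y))%:E)) ^+ 2
    <= (4 * c * X)%:E.
Proof.
move=> Lf X0 fX.
have mf : measurable_fun Rp (nf f) by apply: measurable_EFin_normc; exact: L2p_measurable.
have f0 x : Rp x -> 0 <= nf f x by move=> _; rewrite lee_fin normc_ge0.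
have fX2 : \int[leb]_(x in Rp) nf f x ^+ 2 <= X%:E by move: fX; rewrite sqnormE.
have WW := Wc mf f0 X0 fX2; have WT := kernel_bound_transpose mf f0 X0 fX2.
pose F x := \int[leb]_(y in Rp) (W (x, y) * nf f y).
pose G x := \int[leb]_(y in Rp) (W (y, x) * nf f y).
have F0 x : Rp x -> 0 <= F x.
  by move=> Dx; apply: integral_ge0 => y Dy; rewrite mule_ge0 ?f0// W0.
have G0 x : Rp x -> 0 <= G x.
  by move=> Dx; apply: integral_ge0 => y Dy; rewrite mule_ge0 ?f0// W0.
have mF : measurable_fun Rp F.
  apply: (measurable_int_section1 leb mRp mRp (mWsnd mf)) => z [Dz1 Dz2].
  by rewrite mule_ge0 ?f0// W0.
have mG : measurable_fun Rp G.
  apply: (measurable_int_section1 leb mRp mRp (mWsw mf)) => z [Dz1 Dz2].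
  by rewrite mule_ge0 ?f0// W0.
pose q := Num.sqrt (c * X).
have q0 : (0 <= q)%R by exact: sqrtr_ge0.
have qq : (q ^+ 2 = c * X)%R by rewrite sqr_sqrtr// mulr_ge0.
have mkf : measurable_fun Rp2 (fun z => (normc (k z))%:E * nf f z.2).
  apply: emeasurable_funM; first exact: measurable_EFin_normc.
  exact: (measurable_comp_snd mRp mf).
rewrite (_ : (4 * c * X = (q + q) ^+ 2)%R); last first.
  by have -> : ((q + q) ^+ 2 = 4 * q ^+ 2)%R; [ring|rewrite qq; ring].
apply: (@le_trans _ _ (\int[leb]_(x in Rp) (F x + G x) ^+ 2)); last first.
  by apply: (@minkowski2 _ _ _ leb Rp mRp F G q q mF mG F0 G0 q0 q0); rewrite qq; [exact: WW|exact: WT].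
apply: ge0_le_integral.
- exact: mRp.
- by move=> x _; exact: sqre_ge0.
- apply: measurable_sqre; apply: (measurable_int_section1 leb mRp mRp mkf) => z [Dz1 Dz2].
  by rewrite mule_ge0 ?f0// lee_fin normc_ge0.
- by apply: measurable_sqre; exact: emeasurable_funD.
move=> x Dx; rewrite lee_sqr; last 2 first.
- by apply: integral_ge0 => y Dy; rewrite mule_ge0 ?f0// lee_fin normc_ge0.
- by rewrite adde_ge0 ?F0 ?G0.
have mA := measurable_section1 mRp mRp (mWsnd mf) Dx.
have mB := measurable_section1 mRp mRp (mWsw mf) Dx.
have A0 y : Rp y -> 0 <= W (x, y) * nf f y.
  by move=> Dy; apply: mule_ge0; [apply: W0; split|exact: f0].
have B0 y : Rp y -> 0 <= W (y, x) * nf f y.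
  by move=> Dy; apply: mule_ge0; [apply: W0; split|exact: f0].
rewrite /F /G -(@ge0_integralD _ _ _ leb Rp mRp _ _ A0 mA B0 mB).
apply: ge0_le_integral.
- exact: mRp.
- by move=> y Dy; rewrite mule_ge0 ?f0// lee_fin normc_ge0.
- exact: (measurable_section1 mRp mRp mkf Dx).
- exact: emeasurable_funD mA mB.
- move=> y Dy; rewrite /= -ge0_muleDl.
  + by apply: lee_wpmul2r; [exact: f0|exact: kW].
  + by apply: W0; split.
  + by apply: W0; split.
Qed.

Lemma kernel_op_integrable (f : cfun R) : L2p f ->
  {ae leb, forall x, Rp x -> cintegrable leb Rp (fun y => k (x, y) * f y)%R}.
Proof.
move=> Lf; have [v v0 fv] := L2_sqnorm_le Lf.
have := @int_sqr_kernel_le f (v ^+ 2)%R Lf (sqr_ge0 _).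
rewrite fv lexx => /(_ isT) bnd.
have mkf : measurable_fun Rp2 (fun z => (normc (k z))%:E * nf f z.2).
  apply: emeasurable_funM; first exact: measurable_EFin_normc.
  exact: (measurable_comp_snd mRp (measurable_EFin_normc (L2p_measurable Lf))).
pose F x := \int[leb]_(y in Rp) ((normc (k (x, y)))%:E * nf f y).
have F0 x : 0 <= F x.
  by apply: integral_ge0 => y Dy; rewrite mule_ge0 ?lee_fin ?normc_ge0.
have mF : measurable_fun Rp F.
  apply: (measurable_int_section1 leb mRp mRp mkf) => z _.
  by rewrite mule_ge0 ?lee_fin ?normc_ge0.
have /integrable_ae : leb.-integrable Rp (fun x => F x ^+ 2).
  apply/integrableP; split; first exact: measurable_sqre.
  apply: le_lt_trans (ltry (4 * c * v ^+ 2)); apply: le_trans bnd.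
  by under eq_integral do rewrite gee0_abs ?sqre_ge0//.
move=> /(_ mRp); apply: filterS => x Fx Dx; split.
  apply: mcfunM; last exact: L2p_measurable.
  exact: (mcfun_section1 mRp mRp mk Dx).
have := Fx Dx; rewrite (_ : \int[leb]_(y in Rp) (normc (k (x, y) * f y)%R)%:E = F x); last first.
  by apply: eq_integral => y _; rewrite Normc.normcM EFinM.
by case: (F x) (F0 x) => [r| |] //; rewrite ?ltry.
Qed.

Lemma kernel_op_bound : op_bound (kernel_op k) (2 * Num.sqrt c)%R.
Proof.
move=> f Lf; have [v v0 fv] := L2_sqnorm_le Lf.
apply: le_trans (sqnorm_kernel_le leb leb mRp mRp mk (L2p_measurable Lf)) _.
have := @int_sqr_kernel_le f (v ^+ 2)%R Lf (sqr_ge0 _).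
rewrite fv lexx => /(_ isT) /le_trans; apply.
by rewrite -EFinM lee_fin exprMn sqr_sqrtr// -natrX.
Qed.

Lemma linear_kernel_op : linear_op (kernel_op k).
Proof.
split.
  move=> f Lf; apply/L2P; split.
    by apply: mcfun_kernel_op.
  apply: le_lt_trans (kernel_op_bound Lf) _.
  by have [v v0 ->] := L2_sqnorm_le Lf; rewrite -EFinM ltry.
move=> a f g Lf Lg.
apply: filterS2 (kernel_op_integrable Lf) (kernel_op_integrable Lg) => x fx gx Dx.
rewrite /kernel_op -(cintegralZ mRp a (fx Dx)).
rewrite -(cintegralD mRp (cintegrableZ mRp a (fx Dx)) (gx Dx)).
by congr cintegral; apply/funext => y; ring.
Qed.

End nonneg_kernels.

Section cells.
Variable R : realType.
Local Notation leb := (@lebesgue_measure R).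
Local Notation Rp := (@Rplus R).
Local Notation mRp := (@measurable_Rplus R).
Local Notation T := (measurableTypeR R).
Implicit Types (s : seq (R * R)) (h : T -> \bar R).

(** The pairs [y < c <= x < d] with [(c, d)] a cell of [s]: the part of the lower
triangle on which a kernel depending on the larger variable only is replaced by finitely
many rank one pieces. *)
Definition step s (x y : R) : R :=
  \sum_(p <- s) ((p.1 <= x < p.2)%R%:R * (y < p.1)%R%:R).

(** What the steps leave of the lower triangle; over a cell it is carried by the cell. *)
Definition gap s (x y : R) : R := `|(y <= x)%R%:R - step s x y|.

Definition gap_int s h (x : R) : \bar R :=
  (\int[leb]_(y in Rp) ((gap s x y)%:E * h y))%E.

Lemma gap_ge0 s x y : 0 <= gap s x y. Proof. exact: normr_ge0. Qed.

Lemma step_cat s s' x y : step (s ++ s') x y = step s x y + step s' x y.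
Proof. by rewrite /step big_cat. Qed.

Lemma measurable_step s : measurable_fun setT (fun z : T * T => step s z.1 z.2).
Proof.
rewrite /step; elim: s => [|p s IH].
  by rewrite (_ : (fun z => _) = cst 0)//; apply/funext => z; rewrite big_nil.
rewrite (_ : (fun z : T * T => _) = (fun z : T * T => \1_(`[p.1, p.2[%classic : set R) z.1 *
   \1_(`]-oo, p.1[%classic : set R) z.2 + step s z.1 z.2)); last first.
  apply/funext => z; rewrite /step big_cons !indicE; congr ((_ : bool)%:R * (_ : bool)%:R + _).
    by apply/idP/idP => [?|/set_mem]; [apply/mem_set|]; rewrite /= in_itv.
  by apply/idP/idP => [?|/set_mem]; [apply/mem_set|]; rewrite /= in_itv.
apply: measurable_funD => //; apply: measurable_funM.
  by apply: measurableT_comp measurable_fst; exact: measurable_indic.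
by apply: measurableT_comp measurable_snd; exact: measurable_indic.
Qed.

Lemma measurable_gap s : measurable_fun setT (fun z : T * T => gap s z.1 z.2).
Proof.
apply: measurableT_comp => //; apply: measurable_funB; last exact: measurable_step.
rewrite (_ : (fun z : T * T => _) = \1_(~` [set z : T * T | z.1 < z.2])); last first.
  apply/funext => z; rewrite indicE; congr ((_ : bool)%:R); rewrite leNgt.
  apply/idP/idP => [/negP zz|/set_mem /= /negP//]; exact/mem_set.
by apply: measurable_indic; apply: measurableC; exact: measurable_lt_set.
Qed.

Lemma measurable_gap_int s h : measurable_fun Rp h -> (forall y, Rp y -> (0 <= h y)%E) ->
  measurable_fun Rp (gap_int s h).
Proof.
move=> mh h0.
apply: (measurable_int_section1 leb mRp mRp (F := fun z => ((gap s z.1 z.2)%:E * h z.2)%E)).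
  apply: emeasurable_funM; last exact: (measurable_comp_snd mRp mh).
  by apply/measurable_EFinP; apply: measurable_funTS; exact: measurable_gap.
by move=> z [_ Dz]; rewrite mule_ge0 ?h0// lee_fin gap_ge0.
Qed.

Lemma gap_int_ge0 s h x : (forall y, Rp y -> (0 <= h y)%E) -> (0 <= gap_int s h x)%E.
Proof. by move=> h0; apply: integral_ge0 => y Dy; rewrite mule_ge0 ?h0// lee_fin gap_ge0. Qed.

Lemma eq_gap_int s s' h x : (forall y, step s x y = step s' x y) ->
  gap_int s h x = gap_int s' h x.
Proof. by move=> E; apply: eq_integral => y _; rewrite /gap E. Qed.

Lemma gap_int_le s h x (A : set T) : measurable A -> A `<=` Rp ->
  measurable_fun Rp h -> (forall y, Rp y -> (0 <= h y)%E) ->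
  (forall y, Rp y -> gap s x y <= \1_A y) ->
  (gap_int s h x <= \int[leb]_(y in A) h y)%E.
Proof.
move=> mA sub mh h0 H.
rewrite [leRHS](_ : _ = \int[leb]_(y in Rp) (h y * (\1_A y)%:E))%E; last first.
  rewrite -[A in LHS](setIidr sub) integral_mkcondr; apply: eq_integral => y _.
  by rewrite epatch_indic.
apply: ge0_le_integral.
- exact: mRp.
- by move=> y Dy; rewrite mule_ge0 ?h0// lee_fin gap_ge0.
- apply: emeasurable_funM => //; apply/measurable_EFinP.
  apply: measurable_funTS; exact: (measurable_fun_pair2 x (measurable_gap s)).
- apply: emeasurable_funM => //; apply/measurable_EFinP.
  by apply: measurable_funTS; exact: measurable_indic.
by move=> y Dy; rewrite muleC lee_wpmul2l ?h0// lee_fin H.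
Qed.

Section energy.
Variables (psi : R -> R).
Hypothesis ipsi : leb.-integrable setT (EFin \o psi).
Hypothesis psi0 : forall x, 0 <= psi x.

Definition energy (A : set T) s h : \bar R :=
  (\int[leb]_(x in A) ((psi x)%:E * gap_int s h x ^+ 2))%E.

Lemma measurable_energy s h : measurable_fun Rp h -> (forall y, Rp y -> (0 <= h y)%E) ->
  measurable_fun Rp (fun x => (psi x)%:E * gap_int s h x ^+ 2)%E.
Proof.
move=> mh h0; apply: emeasurable_funM.
  by apply: measurable_funTS; have /integrableP[] := ipsi.
by apply: measurable_sqre; exact: measurable_gap_int.
Qed.

Let cell_Rplus (c d : R) : 0 < c -> (`[c, d[%classic : set T) `<=` Rp.
Proof.
move=> c0 x; rewrite /Rplus/= !in_itv/= andbT => /andP[cx _].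
exact: lt_le_trans cx.
Qed.

Lemma energy_le (c d : R) (J : \bar R) s h : 0 < c -> (0 <= J)%E ->
  measurable_fun Rp h -> (forall y, Rp y -> (0 <= h y)%E) ->
  (forall x, c <= x < d -> (gap_int s h x ^+ 2 <= J)%E) ->
  (energy `[c, d[ s h <= (mass psi c d)%:E * J)%E.
Proof.
move=> c0 J0 mh h0 H; have icd := integrable_mass ipsi (measurable_itv `[c, d[).
have mcd : measurable (`[c, d[%classic : set T) by exact: measurable_itv.
have mpsi : measurable_fun (`[c, d[%classic : set T) (EFin \o psi).
  by case/integrableP: icd.
rewrite /mass fineK; last exact: integrable_fin_num.
rewrite -(@ge0_integralZr _ _ _ leb _ mcd _ mpsi J)//; last first.
  by move=> x _; rewrite lee_fin.
apply: ge0_le_integral => //.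
- by move=> x _; rewrite mule_ge0 ?lee_fin ?sqre_ge0.
- by apply: measurable_funS (measurable_energy s mh h0); [exact: mRp|exact: cell_Rplus].
- exact: emeasurable_funM.
by move=> x; rewrite /= in_itv/= => /H; apply: lee_wpmul2l; rewrite lee_fin.
Qed.

Let cells_spec (delta : R) (k : nat) (c d : R) := 0 < c -> exists s, [/\ size s = k,
  forall p, p \in s -> (c <= p.1) && (p.2 <= d),
  forall x y, ~~ (c <= x < d) -> step s x y = 0 &
  forall h, measurable_fun Rp h -> (forall y, Rp y -> (0 <= h y)%E) ->
   (energy `[c, d[ s h <= (delta ^+ 2)%:E * \int[leb]_(x in `[c, d[) h x ^+ 2)%E].

(** Over a single cell the gap integrates [h] over at most the cell, and Cauchy-Schwarz
turns this into the product of its length and its mass. *)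
Let one_cell (delta c d : R) : 0 < delta -> c < d ->
  (d - c) * mass psi c d <= delta ^+ 2 -> cells_spec delta 1 c d.
Proof.
move=> delta0 cd H c0; exists [:: (c, d)]; split => //.
- by move=> p; rewrite inE => /eqP ->; rewrite !lexx.
- by move=> x y /negbTE xcd; rewrite /step big_seq1 /= xcd mul0r.
move=> h mh h0; pose I : set T := `[c, d[%classic.
have mI : measurable I by exact: measurable_itv.
have sI : I `<=` Rp by exact: cell_Rplus.
have J0 : (0 <= \int[leb]_(y in I) h y)%E.
  by apply: integral_ge0 => y /sI; exact: h0.
have X0 : (0 <= \int[leb]_(y in I) h y ^+ 2)%E.
  by apply: integral_ge0 => y _; exact: sqre_ge0.
apply: (@le_trans _ _ ((mass psi c d)%:E * (\int[leb]_(y in I) h y) ^+ 2)%E).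
  apply: energy_le => //; first exact: sqre_ge0.
  move=> x xcd; rewrite lee_sqr ?gap_int_ge0//.
  apply: gap_int_le => // y _; rewrite /gap /step big_seq1 /= xcd mul1r indicE.
  rewrite (_ : (y \in I) = (c <= y < d)); last first.
    by apply/idP/idP => [/set_mem|?]; [|apply/mem_set]; rewrite /I/= in_itv.
  case: (leP y x) => yx; case: (ltP y c) => yc /=; rewrite ?subrr ?subr0 ?normr0 ?normr1//.
    by case/andP: xcd => _ xd; rewrite (le_lt_trans yx xd).
  by case/andP: xcd => cx _; have := lt_le_trans yc cx; rewrite ltNge (ltW yx).
apply: (@le_trans _ _ ((mass psi c d)%:E * ((d - c)%:E * \int[leb]_(y in I) h y ^+ 2))%E).
  apply: lee_wpmul2l; first by rewrite lee_fin mass_ge0.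
  apply: le_trans (sqr_integral_le mh h0 mI sI) _.
  by rewrite /I lebesgue_measure_itv/= lte_fin cd -EFinB.
rewrite muleA -EFinM; apply: lee_wpmul2r => //.
by rewrite lee_fin mulrC.
Qed.

Let cat_cells (delta : R) m c t d : c < t -> t < d ->
  cells_spec delta 1 c t -> cells_spec delta m t d -> cells_spec delta m.+1 c d.
Proof.
move=> ct td H1 H2 c0; have [s1 [z1 p1 v1 e1]] := H1 c0.
have [s2 [z2 p2 v2 e2]] := H2 (lt_trans c0 ct).
exists (s1 ++ s2); split.
- by rewrite size_cat z1 z2.
- move=> p; rewrite mem_cat => /orP[/p1/andP[cp pt]|/p2/andP[tp pd]].
    by rewrite cp (le_trans pt)// ltW.
  by rewrite pd (le_trans _ tp)// ltW.
- move=> x y; rewrite negb_and => /orP xcd; rewrite step_cat v1 ?v2 ?addr0// negb_and;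
    case: xcd; rewrite -?ltNge -?leNgt => xc.
  + by rewrite (lt_trans xc).
  + by rewrite xc orbT.
  + by rewrite xc.
  + by rewrite (le_trans (ltW td) xc) orbT.
move=> h mh h0.
have E : `[c, d[%classic = `[c, t[%classic `|` `[t, d[%classic :> set T.
  apply/seteqP; split => x /=.
    rewrite in_itv/= => /andP[cx xd]; have [xt|tx] := ltP x t.
      by left; rewrite /= in_itv/= cx.
    by right; rewrite /= in_itv/= tx.
  move=> [|] /=; rewrite !in_itv/= => /andP[ax xb].
    by rewrite ax/= (lt_trans xb).
  by rewrite (le_trans (ltW ct) ax).
have dis : [disjoint (`[c, t[%classic : set T) & (`[t, d[%classic : set T)].
  apply/disj_setPLR => x /=; rewrite !in_itv/= => /andP[_ xt]; apply/negP.
  by rewrite negb_and -ltNge xt.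
have mct : measurable (`[c, t[%classic : set T) by exact: measurable_itv.
have mtd : measurable (`[t, d[%classic : set T) by exact: measurable_itv.
have sub : (`[c, t[%classic `|` `[t, d[%classic : set T) `<=` Rp by rewrite -E; exact: cell_Rplus.
have split_int f : measurable_fun Rp f -> (forall x, Rp x -> (0 <= f x)%E) ->
  (\int[leb]_(x in `[c, d[) f x = \int[leb]_(x in `[c, t[) f x + \int[leb]_(x in `[t, d[) f x)%E.
  move=> mf f0; rewrite E; apply: ge0_integral_setU => //.
    by apply: measurable_funS mf; [exact: mRp|exact: sub].
  by move=> x /sub; exact: f0.
rewrite /energy split_int; last 2 first.
- exact: measurable_energy.
- by move=> x _; rewrite mule_ge0 ?lee_fin ?sqre_ge0.
rewrite (split_int (fun x => h x ^+ 2)%E); last 2 first.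
- exact: measurable_sqre.
- by move=> x _; exact: sqre_ge0.
rewrite ge0_muleDr; try by apply: integral_ge0 => x _; exact: sqre_ge0.
apply: leeD.
  apply: le_trans (e1 h mh h0); rewrite le_eqVlt; apply/orP; left; apply/eqP.
  apply: eq_integral => x /set_mem/=; rewrite in_itv/= => /andP[_ xt].
  congr (_ * _ ^+ 2)%E; apply: eq_gap_int => y.
  by rewrite step_cat (v2 x) ?addr0// negb_and -ltNge xt.
apply: le_trans (e2 h mh h0); rewrite le_eqVlt; apply/orP; left; apply/eqP.
apply: eq_integral => x /set_mem/=; rewrite in_itv/= => /andP[tx _].
congr (_ * _ ^+ 2)%E; apply: eq_gap_int => y.
by rewrite step_cat (v1 x) ?add0r// negb_and -leNgt tx orbT.
Qed.

Lemma cells_exist (delta : R) m c d : 0 < delta -> 0 < c -> c < d ->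
  (d - c) * mass psi c d <= (m.+1%:R * delta) ^+ 2 ->
  exists s, [/\ (size s <= m.+1)%N,
    forall p, p \in s -> (c <= p.1) && (p.2 <= d),
    forall x y, ~~ (c <= x < d) -> step s x y = 0 &
    forall h, measurable_fun Rp h -> (forall y, Rp y -> (0 <= h y)%E) ->
     (energy `[c, d[ s h <= (delta ^+ 2)%:E * \int[leb]_(x in `[c, d[) h x ^+ 2)%E].
Proof.
move=> delta0 c0 cd H.
have [| |k km /(_ c0) [s [zs ps vs es]]] := cell_induction ipsi psi0 delta0
  (Pr := cells_spec delta) _ _ c0 cd H.
- by move=> c1 d1 c10 cd1 H1; exact: one_cell.
- by move=> m1 c1 t1 d1 ct td; exact: cat_cells.
by exists s; split => //; rewrite zs.
Qed.

End energy.
End cells.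

Section gap_kernel.
Variable R : realType.
Local Notation leb := (@lebesgue_measure R).
Local Notation Rp := (@Rplus R).
Local Notation mRp := (@measurable_Rplus R).
Local Notation T := (measurableTypeR R).
Implicit Types (s : seq (R * R)) (h : T -> \bar R).

Variable phi : cfun R.
Hypothesis mphi : measurable_cfun Rp phi.

Let sq (x : R) : R := normc (phi x) ^+ 2.

(** A shell with [b <= delta] is left uncut and contributes a Hardy term.  Otherwise
[b / delta] rounded up is at most [2 b / delta], which bounds the number of cells. *)
Lemma block_cells (r b delta : R) : 0 < r -> 0 <= b -> 0 < delta ->
  (r%:E * sqnorm leb (shell r) phi <= (b ^+ 2)%:E)%E ->
  exists s, [/\ (size s)%:R * delta <= 2 * b, b <= delta -> s = [::],
    forall p, p \in s -> (r <= p.1) && (p.2 <= 2 * r),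
    forall x y, ~~ (r <= x < 2 * r) -> step s x y = 0 &
    forall h, measurable_fun Rp h -> (forall y, Rp y -> (0 <= h y)%E) ->
     (\int[leb]_(x in shell r) ((sq x)%:E * gap_int s h x ^+ 2) <=
      (delta ^+ 2)%:E * (\int[leb]_(x in shell r) h x ^+ 2 +
        (r^-1)%:E * (\int[leb]_(x in below (2 * r)) h x) ^+ 2))%E].
Proof.
move=> r0 b0 delta0 H.
have sub : shell r `<=` Rp by exact: shell_Rplus.
have mr : measurable (shell r) by exact: measurable_shell.
have msq : measurable_fun (shell r) (fun x => (sq x)%:E).
  by apply: measurable_funS (measurable_EFin_normc_sqr mphi); [exact: mRp|exact: sub].
have N0 : (0 <= sqnorm leb (shell r) phi)%E by exact: sqnorm_ge0.
have Nfin : sqnorm leb (shell r) phi \is a fin_num.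
  rewrite ge0_fin_numE// ltNge leye_eq; apply/negP => /eqP E; move: H.
  by rewrite E gt0_muley ?lte_fin// leye_eq.
pose psi (x : R) : R := sq x * \1_(shell r) x.
have psi0 x : 0 <= psi x by rewrite mulr_ge0// ?sqr_ge0// indicE.
have psiE : (EFin \o psi) = (fun x => (sq x)%:E) \_ (shell r).
  by apply/funext => x; rewrite epatch_indic /psi/= EFinM.
have ipsi : leb.-integrable setT (EFin \o psi).
  rewrite psiE; apply/(integrable_mkcond _ mr); apply/integrableP; split => //.
  rewrite (_ : (\int[leb]_(x in shell r) _)%E = sqnorm leb (shell r) phi).
    by rewrite -ge0_fin_numE.
  by apply: eq_integral => x _; rewrite gee0_abs// lee_fin sqr_ge0.
have massE : (mass psi r (2 * r))%:E = sqnorm leb (shell r) phi.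
  rewrite /mass fineK; last first.
    by apply: integrable_fin_num => //; exact: integrable_mass.
  by apply: eq_integral => x xr; rewrite /psi indicE (_ : (_ \in shell r) = true)// mulr1.
have energyE s h : energy psi (shell r) s h =
    (\int[leb]_(x in shell r) ((sq x)%:E * gap_int s h x ^+ 2))%E.
  by apply: eq_integral => x xr; rewrite /psi indicE (_ : (_ \in shell r) = true)// mulr1.
have rm : r * mass psi r (2 * r) <= b ^+ 2 by rewrite -lee_fin EFinM massE.
have r2 : r < 2 * r by lra.
have i0 h A : (0 <= \int[leb]_(x in A) h x ^+ 2)%E by apply: integral_ge0 => x _; exact: sqre_ge0.
have [bd|db] := leP b delta.
  exists [::]; split => //.
  - by rewrite mul0r mulr_ge0.
  - by move=> x y _; rewrite /step big_nil.
  move=> h mh h0; rewrite -energyE.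
  set J := (\int[leb]_(x in below (2 * r)) h x)%E.
  have J0 : (0 <= J)%E by apply: integral_ge0 => x /below_Rplus; exact: h0.
  apply: (@le_trans _ _ ((mass psi r (2 * r))%:E * J ^+ 2)%E).
    apply: energy_le => //; first exact: sqre_ge0.
    move=> x /andP[rx xr]; rewrite lee_sqr ?gap_int_ge0//; apply: gap_int_le => //.
    - exact: measurable_below.
    - exact: below_Rplus.
    move=> y; rewrite /Rplus/= in_itv/= andbT => y0.
    rewrite /gap /step big_nil subr0 indicE in_below// ger0_norm//.
    by case: (leP y x) => //= yx; rewrite (le_lt_trans yx xr).
  rewrite ge0_muleDr ?i0 ?mule_ge0 ?lee_fin ?invr_ge0 ?sqre_ge0//; last exact: ltW.
  apply: (@le_trans _ _ ((delta ^+ 2)%:E * ((r^-1)%:E * J ^+ 2))%E); last first.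
    by rewrite leeDr// mule_ge0// lee_fin sqr_ge0.
  rewrite [leRHS]muleA -EFinM; apply: lee_wpmul2r; first exact: sqre_ge0.
  rewrite lee_fin -ler_pdivrMr ?invr_gt0// invrK mulrC; apply: le_trans rm _.
  by rewrite ler_sqr ?nnegrE// ltW.
pose m := Num.truncn (b / delta).
have /andP[m1 m2] : m%:R <= b / delta < m.+1%:R.
  by apply: truncn_itv; rewrite divr_ge0// ltW.
have bm : b <= m.+1%:R * delta by rewrite -ler_pdivrMr// ltW.
have [s [zs ps vs es]] : exists s, [/\ (size s <= m.+1)%N,
    forall p, p \in s -> (r <= p.1) && (p.2 <= 2 * r),
    forall x y, ~~ (r <= x < 2 * r) -> step s x y = 0 &
    forall h, measurable_fun Rp h -> (forall y, Rp y -> (0 <= h y)%E) ->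
     (energy psi (shell r) s h <= (delta ^+ 2)%:E * \int[leb]_(x in shell r) h x ^+ 2)%E].
  apply: cells_exist => //.
  rewrite (_ : 2 * r - r = r); last by lra.
  by apply: le_trans rm _; rewrite ler_sqr ?nnegrE// mulr_ge0// ltW.
exists s; split => //.
- apply: (@le_trans _ _ (m.+1%:R * delta)); first by rewrite ler_pM2r// ler_nat.
  rewrite -natr1; move: m1; rewrite ler_pdivlMr// => m1.
  by rewrite mulrDl mul1r; lra.
move=> h mh h0; rewrite -energyE; apply: le_trans (es h mh h0) _.
have q0 : (0 <= (r^-1)%:E * (\int[leb]_(x in below (2 * r)) h x) ^+ 2)%E.
  by apply: mule_ge0; [rewrite lee_fin invr_ge0 ltW|exact: sqre_ge0].
rewrite [leRHS]ge0_muleDr//.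
by rewrite leeDl// mule_ge0// lee_fin sqr_ge0.
Qed.

Variables (b : nat -> R) (S : R).
Hypothesis b0 : forall n, 0 <= b n.
Hypothesis bphi : forall n, ((dyad R n)%:E * sqnorm leb (shell (dyad R n)) phi <= (b n ^+ 2)%:E)%E.
Hypothesis bS : forall N, \sum_(0 <= n < N) b n <= S.

Let b_small (delta : R) : 0 < delta -> exists N, forall n, (N <= n)%N -> b n <= delta.
Proof.
move=> delta0.
have : cvgn (series b).
  apply: nondecreasing_is_cvgn; first by apply: nondecreasing_series => n _ _; exact: b0.
  by exists S => _ [N _ <-]; rewrite /series/=; exact: bS.
move/cvg_series_cvg_0 => /cvgrPdist_lt /(_ _ delta0)[N _ NP].
exists N => n Nn; have := NP n Nn; rewrite sub0r normrN ger0_norm// => /ltW; exact.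
Qed.

(** Only finitely many shells have [b n > delta], so the list of all cells is finite.  The
factor 17 is 1 for the cells plus 16 from Hardy on the uncut shells. *)
Lemma gap_kernel_exists (delta : R) : 0 < delta -> exists s,
  [/\ (size s)%:R * delta <= 2 * S,
      forall p, p \in s -> 0 < p.1 /\ (sqnorm leb `[p.1, p.2[ phi < +oo)%E &
      kernel_bound (fun z => (normc (phi z.1) * gap s z.1 z.2)%:E) (17 * delta ^+ 2)].
Proof.
move=> delta0; have [N Nsmall] := b_small delta0.
have d0 n : 0 < dyad R n by exact: dyad_gt0.
have [s_ Hs] := choice (fun n => block_cells (d0 n) (b0 n) delta0 (bphi n)).
pose s := flatten [seq s_ n | n <- iota 0 N].
have stepE m x y : dyad R m <= x < 2 * dyad R m -> step s x y = step (s_ m) x y.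
  move=> xm; rewrite /step /s big_flatten/= big_map.
  have -> : \sum_(n <- iota 0 N) \sum_(p <- s_ n) ((p.1 <= x < p.2)%R%:R * (y < p.1)%R%:R) =
      if (m < N)%N then step (s_ m) x y else 0.
    rewrite -[N in iota 0 N]subn0 -/(index_iota 0 N).
    elim: N {Nsmall s} => [|M IH]; first by rewrite big_nil.
    rewrite big_nat_recr//= IH ltnS -/(step (s_ M) x y).
    have [mM|Mm|->] := ltngtP m M.
    - have [_ _ _ v0 _] := Hs M; rewrite (v0 x y) ?addr0//.
      by apply/negP => xM; have := dyad_inj xm xM => E; rewrite E ltnn in mM.
    - have [_ _ _ v0 _] := Hs M; rewrite (v0 x y) ?addr0//.
      by apply/negP => xM; have := dyad_inj xm xM => E; rewrite E ltnn in Mm.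
    - by rewrite add0r.
  have [//|Nm] := ltnP m N.
  by have [_ -> //] := Hs m; [rewrite /step big_nil|exact: Nsmall].
exists s; split.
- rewrite /s size_flatten sumnE big_map big_map natr_sum mulr_suml.
  apply: (@le_trans _ _ (\sum_(n <- iota 0 N) 2 * b n)).
    by apply: ler_sum => n _; have [] := Hs n.
  rewrite -mulr_sumr ler_pM2l// -[N in iota 0 N]subn0 -/(index_iota 0 N); exact: bS.
- move=> p /flattenP[_ /mapP[n _ ->] pn]; have [_ _ /(_ p pn)/andP[np pn2] _ _] := Hs n.
  have sub : (`[p.1, p.2[%classic : set T) `<=` shell (dyad R n).
    move=> x; rewrite /shell/= !in_itv/= => /andP[px xp].
    by rewrite (le_trans np px)/= (lt_le_trans xp pn2).
  split; first exact: lt_le_trans np.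
  apply: (@le_lt_trans _ _ (sqnorm leb (shell (dyad R n)) phi)).
    apply: ge0_subset_integral => //.
    + exact: measurable_shell.
    + apply: measurable_funS (measurable_EFin_normc_sqr mphi); first exact: mRp.
      exact: shell_Rplus.
    + by move=> x _; rewrite lee_fin sqr_ge0.
  rewrite ltNge leye_eq; apply/negP => /eqP E; have := bphi n.
  by rewrite E gt0_muley ?lte_fin// leye_eq.
move=> h X mh h0 X0 hX.
have msq : measurable_fun Rp (fun x => (sq x)%:E) by exact: measurable_EFin_normc_sqr.
have E1 : (\int[leb]_(x in Rp)
      (\int[leb]_(y in Rp) ((normc (phi x) * gap s x y)%:E * h y)) ^+ 2 =
    \int[leb]_(x in Rp) ((sq x)%:E * gap_int s h x ^+ 2))%E.
  apply: eq_integral => x _.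
  have mg : measurable_fun Rp (fun y => (gap s x y)%:E * h y)%E.
    apply: emeasurable_funM => //; apply/measurable_EFinP.
    by apply: measurable_funTS; exact: (measurable_fun_pair2 x (measurable_gap s)).
  rewrite (_ : (\int[leb]_(y in Rp) _)%E = (normc (phi x))%:E * gap_int s h x)%E.
    by rewrite expe2 muleACA -expe2 /sq EFin_expe.
  rewrite /gap_int -(@ge0_integralZl _ _ _ leb Rp mRp _ mg).
  - by apply: eq_integral => y _; rewrite EFinM muleA.
  - by move=> y Dy; rewrite mule_ge0 ?h0// lee_fin gap_ge0.
  - by rewrite lee_fin normc_ge0.
rewrite [leLHS]E1 integral_shells; last 2 first.
- by apply: emeasurable_funM => //; apply: measurable_sqre; exact: measurable_gap_int.
- by move=> x _; rewrite mule_ge0 ?lee_fin ?sqr_ge0 ?sqre_ge0.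
pose A n := (\int[leb]_(x in shell (dyad R n)) h x ^+ 2)%E.
pose B n := (((dyad R n)^-1)%:E * (\int[leb]_(x in below (2 * dyad R n)) h x) ^+ 2)%E.
have A0 n : (0 <= A n)%E by apply: integral_ge0 => x _; exact: sqre_ge0.
have B0 n : (0 <= B n)%E by rewrite mule_ge0 ?sqre_ge0// lee_fin invr_ge0 ltW.
apply: (@le_trans _ _ (\sum_(0 <= n <oo) ((delta ^+ 2)%:E * (A n + B n)))%E).
  apply: lee_nneseries => n _.
    by move=> _; apply: integral_ge0 => x _; rewrite mule_ge0 ?lee_fin ?sqr_ge0 ?sqre_ge0.
  have [_ _ _ _ /(_ h mh h0)] := Hs n; apply: le_trans; rewrite le_eqVlt; apply/orP; left.
  apply/eqP/eq_integral => x /set_mem; rewrite /shell/= in_itv/= => xn.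
  by congr (_ * _ ^+ 2)%E; apply: eq_gap_int => y; exact: stepE.
rewrite nneseriesZl; last by move=> n _; exact: adde_ge0.
rewrite (@nneseriesD _ A B)//.
have AX : (\sum_(0 <= n <oo) A n <= X%:E)%E.
  rewrite /A -integral_shells//; first exact: measurable_sqre.
  by move=> x _; exact: sqre_ge0.
have BX : (\sum_(0 <= n <oo) B n <= (16 * X)%:E)%E by exact: dyadic_hardy.
rewrite (_ : 17 * delta ^+ 2 * X = delta ^+ 2 * (X + 16 * X)); last by ring.
rewrite [leRHS]EFinM; apply: lee_wpmul2l; first by rewrite lee_fin sqr_ge0.
by rewrite EFinD; exact: leeD.
Qed.

End gap_kernel.

(** * Singular numbers of operators with kernel phi(max(x, y)) *)

Section ae_operators.
Variable R : realType.
Local Notation leb := (@lebesgue_measure R).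
Local Notation Rp := (@Rplus R).
Local Notation mRp := (@measurable_Rplus R).
Variables A B : op R.
Hypothesis LA : forall f, L2p f -> L2p (A f).
Hypothesis AB : forall f, L2p f -> ae_eq leb Rp (A f) (B f).
Hypothesis lB : linear_op B.

Lemma ae_eq_linear_op : linear_op A.
Proof.
split=> // a f g Lf Lg.
have Lafg : L2p (fun x => a * f x + g x).
  by apply: L2D => //; [exact: mRp|apply: L2Z => //; exact: mRp].
apply: filterS2 (filterI (AB Lafg) (lB.2 a f g Lf Lg)) (filterI (AB Lf) (AB Lg)).
move=> x [Ax Bx] [Af Ag] Dx.
by rewrite Ax// Bx// Af// Ag.
Qed.

Lemma ae_eq_op_bound (M : R) : op_bound B M -> op_bound A M.
Proof.
move=> BM f Lf; rewrite (ae_eq_sqnorm mRp _ _ (AB Lf)); first exact: BM.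
  exact: L2p_measurable (LA Lf).
exact: L2p_measurable (lB.1 _ Lf).
Qed.

End ae_operators.

Section max_kernel_operator.
Variable R : realType.
Local Notation leb := (@lebesgue_measure R).
Local Notation Rp := (@Rplus R).
Local Notation mRp := (@measurable_Rplus R).
Local Notation Rp2 := (Rp `*` Rp).
Local Notation T := (measurableTypeR R).
Local Notation cpairp := (cpair leb Rp).
Implicit Types (s : seq (R * R)) (p : R * R) (f : cfun R).

Variable phi : cfun R.
Hypothesis mphi : measurable_cfun Rp phi.

(** Together with [cell_fun], the two factors of the rank one piece attached to a cell. *)
Definition head_fun p : cfun R := fun x => ((x < p.1)%R%:R)%:C.
Definition cell_fun p : cfun R := fun x => ((p.1 <= x < p.2)%R%:R)%:C * phi x.
Definition cell_op s : op R := fun f x =>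
  \sum_(0 <= i < size s) (cpairp f (head_fun (nth (0, 0) s i)) * cell_fun (nth (0, 0) s i) x +
                          cpairp f (cell_fun (nth (0, 0) s i)) * head_fun (nth (0, 0) s i) x).

Definition step_kernel s (z : T * T) : R[i] :=
  phi z.1 * (step s z.1 z.2)%:C + phi z.2 * (step s z.2 z.1)%:C.

Definition residual s (z : T * T) : R[i] := phi (Num.max z.1 z.2) - step_kernel s z.

Definition gap_weight s (z : T * T) : \bar R := (normc (phi z.1) * gap s z.1 z.2)%:E.

Lemma mcfun_itv (I : interval R) (b : T -> bool) : (forall x, b x = (x \in I)) ->
  measurable_cfun Rp (fun x => ((b x)%:R : R)%:C).
Proof.
move=> bI; apply: mcfun_real; rewrite (_ : (fun x => _) = \1_([set` I] : set R)); last first.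
  by apply/funext => x; rewrite indicE; congr ((_ : bool)%:R); rewrite bI mem_setE.
by apply: measurable_funTS; apply: measurable_indic; exact: measurable_itv.
Qed.

Lemma mcfun_head_fun p : measurable_cfun Rp (head_fun p).
Proof. by apply: (mcfun_itv (I := `]-oo, p.1[)) => x; rewrite in_itv. Qed.

Lemma mcfun_cell_fun p : measurable_cfun Rp (cell_fun p).
Proof.
apply: mcfunM => //.
by apply: (mcfun_itv (I := `[p.1, p.2[)) => x; rewrite in_itv.
Qed.

Lemma L2_head_fun p : L2p (head_fun p).
Proof.
apply/L2P; split; first exact: mcfun_head_fun.
rewrite /sqnorm (_ : (\int[leb]_(x in Rp) _)%E =
  (\int[leb]_(x in Rp) (\1_(`]0%R, p.1[%classic : set R) x)%:E)%E); last first.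
  apply: eq_integral => x /set_mem; rewrite /Rplus/= in_itv/= andbT => x0.
  rewrite indicE (_ : (x \in _) = (x < p.1)); last first.
    by apply/idP/idP => [/set_mem|?]; [|apply/mem_set]; rewrite /= in_itv/= x0.
  by case: (x < p.1); rewrite ?expr1n expr0n ?addr0 ?sqrtr1 ?sqrtr0 ?expr1n ?expr0n.
rewrite integral_indic//; last exact: mRp.
apply: (@le_lt_trans _ _ (leb `]0%R, p.1[%classic)).
  by apply: le_measure; rewrite ?inE//; apply: measurableI => //; exact: mRp.
by rewrite lebesgue_measure_itv/=; case: ifP => // _; rewrite -EFinB ltry.
Qed.

Lemma L2_cell_fun p : 0 < p.1 -> (sqnorm leb `[p.1, p.2[ phi < +oo)%E -> L2p (cell_fun p).
Proof.
move=> p0 H; apply/L2P; split; first exact: mcfun_cell_fun.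
apply: le_lt_trans H.
have sub : (`[p.1, p.2[%classic : set T) `<=` Rp.
  by move=> x; rewrite /Rplus/= !in_itv/= andbT => /andP[px _]; exact: lt_le_trans px.
rewrite [leRHS](_ : _ = (\int[leb]_(x in Rp `&` `[p.1, p.2[) (normc (phi x) ^+ 2)%:E)%E); last first.
  by rewrite setIidr.
rewrite integral_mkcondr le_eqVlt; apply/orP; left; apply/eqP.
apply: eq_integral => x _; rewrite epatch_indic /= indicE.
rewrite (_ : (x \in _) = (p.1 <= x < p.2)); last first.
  by apply/idP/idP => [/set_mem|?]; [|apply/mem_set]; rewrite /= in_itv.
rewrite /cell_fun; case: (p.1 <= x < p.2) => /=; first by rewrite mul1r mule1.
by rewrite mul0r Normc.normc0 expr0n mule0.
Qed.

(** The lower and the upper triangle are each bounded by a copy of the gap; on the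
diagonal the steps vanish. *)
Lemma residual_le s x y : Rp x -> Rp y ->
  ((normc (residual s (x, y)))%:E <= gap_weight s (x, y) + gap_weight s (y, x))%E.
Proof.
move=> _ _; rewrite -EFinD lee_fin /=.
have tri (u v : R[i]) (a b : R) : normc (u * a%:C + v * b%:C) <= normc u * `|a| + normc v * `|b|.
  by apply: le_trans (le_normcD _ _) _; rewrite !Normc.normcM !normc_real.
rewrite /residual /step_kernel /gap /=.
have [yx|xy|<-] := ltgtP y x.
- rewrite (_ : _ - _ = phi x * (1 - step s x y)%:C + phi y * (0 - step s y x)%:C).
    exact: tri.
  by rewrite !rmorphB/= rmorph1 rmorph0; ring.
- rewrite (_ : _ - _ = phi x * (0 - step s x y)%:C + phi y * (1 - step s y x)%:C).
    exact: tri.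
  by rewrite !rmorphB/= rmorph1 rmorph0; ring.
have s0 : step s y y = 0.
  rewrite /step big1// => p _; case: (ltP y p.1) => yp; last by rewrite mulr0.
  by rewrite /= mul0r.
rewrite s0 !rmorph0 !mulr0 addr0 !subr0 normr1 mulr1.
by rewrite lerDl normc_ge0.
Qed.

Lemma measurable_gap_weight s : measurable_fun Rp2 (gap_weight s).
Proof.
apply/measurable_EFinP; apply: measurable_funM.
  exact: (measurable_comp_fst mRp (measurable_normc mphi)).
by apply: measurable_funTS; exact: measurable_gap.
Qed.

Lemma gap_weight_ge0 s z : (0 <= gap_weight s z)%E.
Proof. by rewrite lee_fin mulr_ge0 ?normc_ge0 ?gap_ge0. Qed.

Lemma mcfun_max : measurable_cfun Rp2 (fun z => phi (Num.max z.1 z.2)).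
Proof.
have mmax : measurable_fun Rp2 (fun z : T * T => Num.max z.1 z.2 : T).
  by apply: measurable_funTS; apply: measurable_maxr.
have max_sub : (fun z : T * T => Num.max z.1 z.2 : T) @` Rp2 `<=` Rp.
  move=> _ [[x y] [/= Dx Dy] <-]; rewrite /Rplus/= in_itv/= andbT lt_max.
  by move: Dx; rewrite /Rplus/= in_itv/= andbT => ->.
by case: mphi => m1 m2; split; [exact: (measurable_comp mRp max_sub m1 mmax)|
  exact: (measurable_comp mRp max_sub m2 mmax)].
Qed.

Lemma mcfun_Q_op f : L2p f -> measurable_cfun Rp (Q_op phi f).
Proof. exact: mcfun_kernel_op mcfun_max. Qed.

Lemma mcfun_residual s : measurable_cfun Rp2 (residual s).
Proof.
have mst : measurable_fun Rp2 (fun z : T * T => step s z.1 z.2).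
  by apply: measurable_funTS; exact: measurable_step.
have mst' : measurable_fun Rp2 (fun z : T * T => step s z.2 z.1).
  apply: measurable_funTS.
  apply: (@measurableT_comp _ _ _ _ _ _ _ _ (fun z : T * T => (z.2, z.1)) (measurable_step s)).
  exact: (@measurable_swap _ _ T T).
apply: mcfunB; first exact: mcfun_max.
apply: mcfunD; apply: mcfunM.
- exact: (mcfun_fst _ mRp mphi).
- exact: mcfun_real.
- exact: (mcfun_snd _ mRp mphi).
- exact: mcfun_real.
Qed.

Section fixed_cells.
Variables (s : seq (R * R)) (c : R).
Hypothesis c0 : 0 <= c.
Hypothesis sc : kernel_bound (gap_weight s) c.
Hypothesis Ls : forall i, L2p (cell_fun (nth (0, 0) s i)).

Lemma linear_residual : linear_op (kernel_op (residual s)).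
Proof.
exact: (linear_kernel_op (measurable_gap_weight s) (fun z _ => gap_weight_ge0 s z) c0 sc
  (mcfun_residual s) (@residual_le s)).
Qed.

Lemma residual_bound : op_bound (kernel_op (residual s)) (2 * Num.sqrt c).
Proof.
exact: (kernel_op_bound (measurable_gap_weight s) (fun z _ => gap_weight_ge0 s z) c0 sc
  (mcfun_residual s) (@residual_le s)).
Qed.

Lemma L2_cell_op f : L2p f -> L2p (cell_op s f).
Proof.
move=> Lf; apply: L2_sum; first exact: mRp.
move=> i; apply: L2D; first exact: mRp.
  by apply: L2Z; [exact: mRp|exact: Ls].
by apply: L2Z; [exact: mRp|exact: L2_head_fun].
Qed.

Lemma linear_cell_op : linear_op (cell_op s).
Proof.
split; first exact: L2_cell_op.
move=> a f g Lf Lg; apply: aeW => x _; rewrite /cell_op mulr_sumr -big_split/=.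
have La : L2p (fun x => a * f x) by apply: L2Z => //; exact: mRp.
apply: eq_bigr => i _.
have Lh := L2_head_fun (nth (0, 0) s i); have Lc := Ls i.
rewrite (cpairDl mRp La Lg Lh) (cpairDl mRp La Lg Lc) (cpairZl mRp _ Lf Lh) (cpairZl mRp _ Lf Lc).
by ring.
Qed.

Lemma rank_le_cell_op : rank_le (size s + size s) (cell_op s).
Proof.
have -> : cell_op s = (fun f x =>
  (\sum_(0 <= i < size s) cpairp f (head_fun (nth (0, 0) s i)) * cell_fun (nth (0, 0) s i) x) -
  (\sum_(0 <= i < size s) - cpairp f (cell_fun (nth (0, 0) s i)) * head_fun (nth (0, 0) s i) x)).
  apply/funext => f; apply/funext => x; rewrite /cell_op big_split/= -sumrN; congr (_ + _).
  by apply: eq_bigr => i _; rewrite mulNr opprK.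
apply: rank_leB; apply/rank_leP.
  exists (fun i => cell_fun (nth (0, 0) s i)); split => // f Lf.
  by exists (fun i => cpairp f (head_fun (nth (0, 0) s i))); exact: aeW.
exists (fun i => head_fun (nth (0, 0) s i)); split; first by move=> i; exact: L2_head_fun.
move=> f Lf; exists (fun i => - cpairp f (cell_fun (nth (0, 0) s i))); exact: aeW.
Qed.

Let step_kernelE x y : step_kernel s (x, y) =
  \sum_(0 <= i < size s) (cell_fun (nth (0, 0) s i) x * head_fun (nth (0, 0) s i) y +
                          head_fun (nth (0, 0) s i) x * cell_fun (nth (0, 0) s i) y).
Proof.
have E (u v : R) : (step s u v)%:C =
    \sum_(0 <= i < size s) ((((nth (0, 0) s i).1 <= u < (nth (0, 0) s i).2)%R%:R)%:C *
       ((v < (nth (0, 0) s i).1)%R%:R)%:C).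
  rewrite /step (big_nth (0, 0)) rmorph_sum/=; apply: eq_bigr => i _.
  by rewrite rmorphM.
rewrite /step_kernel/= !E !mulr_sumr -big_split/=; apply: eq_bigr => i _.
by rewrite /cell_fun /head_fun; ring.
Qed.

Lemma Q_op_residual f : L2p f ->
  ae_eq leb Rp (fun x => Q_op phi f x - cell_op s f x) (kernel_op (residual s) f).
Proof.
move=> Lf.
have := kernel_op_integrable (measurable_gap_weight s) (fun z _ => gap_weight_ge0 s z) c0 sc
  (mcfun_residual s) (@residual_le s) Lf.
apply: filterS => x /= ri Dx; have {}ri := ri Dx.
pose F i y := (cell_fun (nth (0, 0) s i) x * (f y * head_fun (nth (0, 0) s i) y) +
  head_fun (nth (0, 0) s i) x * (f y * cell_fun (nth (0, 0) s i) y)).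
have ih i : cintegrable leb Rp (fun y => f y * head_fun (nth (0, 0) s i) y).
  exact: (cintegrableM mRp Lf (L2_head_fun _)).
have ic i : cintegrable leb Rp (fun y => f y * cell_fun (nth (0, 0) s i) y).
  exact: (cintegrableM mRp Lf (Ls i)).
have iF i : cintegrable leb Rp (F i).
  exact: (cintegrableD mRp (cintegrableZ mRp _ (ih i)) (cintegrableZ mRp _ (ic i))).
have -> : cell_op s f x = cintegral leb Rp (fun y => \sum_(0 <= i < size s) F i y).
  rewrite (cintegral_sum mRp _ iF); apply: eq_bigr => i _.
  rewrite cintegralD; [|exact: mRp|by apply: cintegrableZ => //; exact: mRp..].
  rewrite !cintegralZ//; try exact: mRp.
  by rewrite /cpair; ring.
have -> : Q_op phi f x = cintegral leb Rp
    (fun y => residual s (x, y) * f y + \sum_(0 <= i < size s) F i y).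
  apply: eq_cintegral => y _.
  rewrite (_ : \sum_(0 <= i < size s) F i y = step_kernel s (x, y) * f y).
    by rewrite /residual/=; ring.
  rewrite step_kernelE mulr_suml; apply: eq_bigr => i _.
  by rewrite /F; ring.
rewrite cintegralD//; last 2 first.
- exact: mRp.
- by apply: cintegrable_sum => //; exact: mRp.
by rewrite addrK.
Qed.

End fixed_cells.

End max_kernel_operator.

Section singular_numbers_of_Q.
Variable R : realType.
Local Notation leb := (@lebesgue_measure R).
Local Notation Rp := (@Rplus R).
Local Notation mRp := (@measurable_Rplus R).

Variables (phi : cfun R) (b : nat -> R) (S : R).
Hypothesis mphi : measurable_cfun Rp phi.
Hypothesis b0 : forall n, 0 <= b n.
Hypothesis bphi : forall n,
  ((dyad R n)%:E * sqnorm leb (shell (dyad R n)) phi <= (b n ^+ 2)%:E)%E.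
Hypothesis bS : forall N, \sum_(0 <= n < N) b n <= S.
Hypothesis S0 : 0 < S.

Let two_sqrt17_le (delta : R) : 0 < delta -> 2 * Num.sqrt (17 * delta ^+ 2) <= 9 * delta.
Proof.
move=> d0; have d9 : 0 <= 9 * delta by rewrite mulr_ge0// ltW.
have s0 : 0 <= 17 * delta ^+ 2 by rewrite mulr_ge0// sqr_ge0.
have l0 : 0 <= 2 * Num.sqrt (17 * delta ^+ 2) by rewrite mulr_ge0// sqrtr_ge0.
rewrite -ler_sqr ?nnegrE// exprMn sqr_sqrtr//.
by have := sqr_ge0 delta; nra.
Qed.

Let approx (delta : R) : 0 < delta -> exists s, [/\ (size s)%:R * delta <= 2 * S,
  forall i, L2p (cell_fun phi (nth (0, 0) s i)) &
  kernel_bound (gap_weight phi s) (17 * delta ^+ 2)].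
Proof.
move=> d0; have [s [zs ps ks]] := gap_kernel_exists mphi b0 bphi bS d0.
exists s; split => // i; have [si|si] := ltnP i (size s).
  have [p0 pN] := ps _ (mem_nth (0, 0) si); exact: L2_cell_fun.
rewrite nth_default// (_ : cell_fun phi (0, 0) = fun=> 0); first exact: L2_0.
apply/funext => x; rewrite /cell_fun/= (_ : (0 <= x < 0) = false) ?mul0r//.
by apply/negP => /andP[x0 x0']; have := le_lt_trans x0 x0'; rewrite ltxx.
Qed.

Let no_cells : exists2 c, 0 <= c & kernel_bound (gap_weight phi [::]) c.
Proof.
have d0 : 0 < 8 * S by rewrite mulr_gt0.
have [s [zs _ ks]] := approx d0; exists (17 * (8 * S) ^+ 2).
  by rewrite mulr_ge0// sqr_ge0.
suff -> : [::] = s by [].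
apply/esym/eqP; rewrite -size_eq0; have : (size s)%:R * 4 <= 1 :> R.
  by rewrite -(ler_pM2l d0); lra.
by rewrite -natrM (ler_nat _ _ 1); case: (size s).
Qed.

Let Q_op_residual_nil : Q_op phi = kernel_op (residual phi [::]).
Proof.
apply/funext => f; apply/funext => x; rewrite /Q_op /kernel_op; congr cintegral.
by apply/funext => y; rewrite /residual /step_kernel /step/= !big_nil rmorph0 !mulr0 addr0 subr0.
Qed.

Lemma linear_Q_op : linear_op (Q_op phi).
Proof. by have [c c0 kc] := no_cells; rewrite Q_op_residual_nil; exact: linear_residual kc. Qed.

Lemma Q_op_bound : exists2 M, 0 <= M & op_bound (Q_op phi) M.
Proof.
have [c c0 kc] := no_cells; exists (2 * Num.sqrt c); first by rewrite mulr_ge0// sqrtr_ge0.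
by rewrite Q_op_residual_nil; exact: residual_bound kc.
Qed.

Let Q_split n : exists s, [/\ (size s + size s <= n)%N,
  linear_op (cell_op phi s), rank_le n (cell_op phi s),
  linear_op (fun f x => Q_op phi f x - cell_op phi s f x) &
  op_bound (fun f x => Q_op phi f x - cell_op phi s f x) (72 * S / n.+1%:R)].
Proof.
(* [2 (size s) <= 4 S / delta = (n + 1) / 2 <= n], since the left-hand side is an integer. *)
pose delta := 8 * S / n.+1%:R.
have n0 : 0 < n.+1%:R :> R by rewrite ltr0n.
have d0 : 0 < delta by rewrite !mulr_gt0// invr_gt0.
have [s [zs Ls ks]] := approx d0.
have c0 : 0 <= 17 * delta ^+ 2 by rewrite mulr_ge0// sqr_ge0.
have sn : (size s + size s <= n)%N.
  have : (size s)%:R * 4 <= n.+1%:R :> R.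
    move: zs; rewrite /delta mulrA ler_pdivrMr// (_ : 2 * S * _ = S * (2 * n.+1%:R)); last by ring.
    rewrite (_ : (size s)%:R * (8 * S) = S * (2 * ((size s)%:R * 4))); last by ring.
    by rewrite ler_pM2l// ler_pM2l.
  rewrite -natrM ler_nat; lia.
have H := Q_op_residual mphi c0 ks Ls.
have lR := linear_residual mphi c0 ks; have bR := residual_bound mphi c0 ks.
have lK := linear_cell_op Ls.
have LQ f : L2p f -> L2p (fun x => Q_op phi f x - cell_op phi s f x).
  move=> Lf; apply: L2B; [exact: mRp|exact: linear_Q_op.1|exact: lK.1].
exists s; split => //.
- by apply: rank_le_mono sn _; exact: rank_le_cell_op.
- exact: ae_eq_linear_op LQ H lR.
apply: ae_eq_op_bound LQ H lR _ _; apply: op_bound_le bR; first by rewrite mulr_ge0// sqrtr_ge0.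
apply: le_trans (two_sqrt17_le d0) _; rewrite le_eqVlt; apply/orP; left; apply/eqP.
by rewrite /delta; field; rewrite gt_eqF.
Qed.

(** Take [delta = 8 S / (n + 1)]: the steps then have rank at most [(n + 1) / 2], which
is at most [n], also for [n = 0] where it forces the list of cells to be empty. *)
Lemma Q_op_singular_number n : (singular_number (Q_op phi) n <= (72 * S / n.+1%:R)%:E)%E.
Proof.
have [s [sn lK rK lD bD]] := Q_split n.
have M0 : 0 <= 72 * S / n.+1%:R by rewrite !mulr_ge0// ?invr_ge0// ltW.
apply: le_trans (op_bound_opnorm M0 bD); apply: ereal_inf_lbound.
exists (cell_op phi s) => //; split => //.
have [M M1 bQ] := Q_op_bound.
apply: (@linear_bounded_op _ _ (M + 72 * S / n.+1%:R)) => //; first exact: addr_ge0.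
move=> f Lf; have := op_boundB linear_Q_op lD M1 M0 bQ bD Lf.
by rewrite (_ : (fun x => _) = cell_op phi s f)//; apply/funext => x; ring.
Qed.

Lemma Q_op_weak_schatten1 : weak_schatten1 (Q_op phi).
Proof.
split; first by have [M M1 bQ] := Q_op_bound; exact: linear_bounded_op M1 linear_Q_op bQ.
apply: (@le_lt_trans _ _ (72 * S)%:E); last exact: ltry.
apply: ub_ereal_sup => _ [n _ <-].
apply: (@le_trans _ _ (n.+1%:R%:E * (72 * S / n.+1%:R)%:E)%E).
  by apply: lee_wpmul2l; [rewrite lee_fin|exact: Q_op_singular_number].
by rewrite -EFinM lee_fin mulrC divfK// pnatr_eq0.
Qed.

End singular_numbers_of_Q.

Section weak_type.
Variable R : realType.
Local Notation leb := (@lebesgue_measure R).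

Lemma kernel_ofP (A : op R) s : is_L2_kernel A s -> is_L2_kernel A (kernel_of A).
Proof. by move=> As; exact: (xgetPex (fun=> 0) (ex_intro _ s As)). Qed.

(** The constants are those of the singular numbers, of the symbol estimate and of the
nuclear representation; [e] comes from approximating singular numbers by near optimal
finite rank operators. *)
Lemma averaging_projection_estimate (A : op R) (e : R) : schatten 1 A -> 0 < e ->
  weak_schatten1 (averaging_projection A) /\
  forall n, (singular_number (averaging_projection A) n <=
    (72 * (34 * 12) * (fine (schatten_norm 1 A) + e) / n.+1%:R)%:E)%E.
Proof.
move=> SA e0; have [u [g [p nu]]] := schatten_nuclear SA e0.
have LA : forall f, L2p f -> L2p (A f) by case: SA => [[]].
have [s [As sle]] := nuclear_L2_kernel LA nu.
have Ak := kernel_ofP As; have ks := L2_kernel_unique Ak As.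
have mk : measurable_cfun (@Rplus R `*` @Rplus R) (kernel_of A) by case: Ak => Lk _; exact: L2_measurable Lk.
case: nu => p0 uP gP pP AP.
set P := 12 * _ in pP.
have N0 : 0 <= fine (schatten_norm 1 A) by rewrite fine_ge0// poweR_ge0.
have P0 : 0 < P by rewrite /P mulr_gt0// ltr_wpDl.
have kle : {ae (leb \x leb)%E, forall z, (@Rplus R `*` @Rplus R) z ->
    ((normc (kernel_of A z))%:E <= \sum_(0 <= m <oo) (normc (u m z.1) * normc (g m z.2))%:E)%E}.
  by apply: filterS2 ks sle => z kz sz Dz; rewrite kz//; exact: sz.
have [b [b0 bphi bS]] := averaging_symbol_estimate mk (fun m => L2p_measurable (uP m).1)
  (fun m => L2p_measurable (gP m).1) kle p0 (fun m => (uP m).2) (fun m => (gP m).2) pP.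
have mphi := mcfun_averaging_symbol mk.
have S0 : 0 < 34 * P by rewrite mulr_gt0.
split; first exact: Q_op_weak_schatten1 mphi b0 bphi bS S0.
move=> n; apply: le_trans (Q_op_singular_number mphi b0 bphi bS S0 n) _.
by rewrite lee_fin /P !mulrA.
Qed.

Lemma averaging_projection_weak_type (A : op R) : schatten 1 A ->
  weak_schatten1 (averaging_projection A) /\
  forall n : nat, (singular_number (averaging_projection A) n <=
    (72 * (34 * 12) * (1 + n%:R)^-1)%:E * schatten_norm 1 A)%E.
Proof.
move=> SA; split; first by have [] := averaging_projection_estimate SA ltr01.
move=> n; have Nfin : schatten_norm 1 A \is a fin_num.
  by rewrite ge0_fin_numE ?poweR_ge0//; case: SA.
rewrite -(fineK Nfin) -EFinM; apply/lee_addgt0Pr => e e0.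
have n0 : 0 < n.+1%:R :> R by rewrite ltr0n.
have C0 : 0 < 72 * (34 * 12) :> R by rewrite !mulr_gt0.
have e'0 : 0 < e / (72 * (34 * 12)) * n.+1%:R by rewrite mulr_gt0// divr_gt0.
have [_ /(_ n)] := averaging_projection_estimate SA e'0.
move/le_trans; apply; rewrite -EFinD lee_fin le_eqVlt; apply/orP; left; apply/eqP.
rewrite nat1r; move: (fine _) => N; move: n0 C0; clear.
move: (n.+1%:R) (72 * (34 * 12)) => m C m0 C0.
by field; rewrite !gt_eqF.
Qed.

End weak_type.

(** * Complex exponentials on intervals of length 2 pi *)

Section complex_exponentials.
Variable R : realType.
Local Notation leb := (@lebesgue_measure R).
Local Notation T := (measurableTypeR R).
Implicit Types (m n a b x : R).

Definition cexp m : T -> R[i] := fun x => cos (m * x) +i* sin (m * x).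

Lemma cexpD m n x : cexp (m + n) x = cexp m x * cexp n x.
Proof. by apply: complex_ext; rewrite !cReImE/= mulrDl ?cosD ?sinD; ring. Qed.

Lemma cexp0 x : cexp 0 x = 1.
Proof. by rewrite /cexp mul0r cos0 sin0. Qed.

Lemma cexp_conj m x : (cexp m x)^* = cexp (- m) x.
Proof. by apply: complex_ext; rewrite !cReImE/= mulNr ?cosN ?sinN. Qed.

Lemma normc_cexp m x : normc (cexp m x) = 1.
Proof. by rewrite /cexp/= cos2Dsin2 sqrtr1. Qed.

(** At integer frequencies the exponentials take the value 1 at the ends of the intervals
on which they are tested. *)
Lemma cexp_2pi (j i : nat) : cexp j%:R (2 * pi * i%:R) = 1.
Proof.
have E k : cos (2 * pi * k%:R) = 1 :> R /\ sin (2 * pi * k%:R) = 0 :> R.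
  elim: k => [|k [IHc IHs]]; first by rewrite mulr0 cos0 sin0.
  have -> : 2 * pi * k.+1%:R = 2 * pi * k%:R + pi *+ 2 :> R.
    by rewrite -[k.+1]addn1 natrD -[pi *+ 2]mulr_natl mulrDr mulr1.
  by rewrite cosD2pi sinD2pi IHc IHs.
have -> : cexp j%:R (2 * pi * i%:R) = cos (2 * pi * (j * i)%:R) +i* sin (2 * pi * (j * i)%:R).
  by rewrite /cexp natrM (_ : j%:R * _ = 2 * pi * (j%:R * i%:R))//; ring.
by have [-> ->] := E (j * i)%N.
Qed.

Lemma continuous_cos_scale m : continuous (fun x : R => cos (m * x)).
Proof.
by move=> x; apply: continuous_comp; [exact: mulrl_continuous|exact: continuous_cos].
Qed.

Lemma continuous_sin_scale m : continuous (fun x : R => sin (m * x)).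
Proof.
by move=> x; apply: continuous_comp; [exact: mulrl_continuous|exact: continuous_sin].
Qed.

Lemma mcfun_cexp m (D : set T) : measurable_cfun D (cexp m).
Proof.
by split; apply: measurable_funTS; apply: continuous_measurable_fun;
  [exact: continuous_cos_scale|exact: continuous_sin_scale].
Qed.

Lemma cintegrable_cexp m a b : cintegrable leb `[a, b[ (cexp m).
Proof.
split; first exact: mcfun_cexp.
under eq_integral do rewrite normc_cexp.
rewrite integral_cst//= mul1e.
by rewrite lebesgue_measure_itv/=; case: ifP => // _; rewrite -EFinB ltry.
Qed.

Let Rintegral_FTC (f F : R -> R) a b : a < b -> continuous f ->
  (forall x, is_derive x 1 F (f x)) -> \int[leb]_(x in `[a, b[) f x = F b - F a.
Proof.
move=> ab cf dF.
have cF : continuous F.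
  move=> x; apply: differentiable_continuous; apply/derivable1_diffP.
  by have [] := dF x.
have iab : leb.-integrable `[a, b] (EFin \o f).
  apply: continuous_compact_integrable; first exact: segment_compact.
  exact: continuous_subspaceT.
rewrite Rintegral_itv_bndo_bndc; last first.
  by apply: integrableS iab => //; by move=> x /=; rewrite !in_itv/= => /andP[-> /ltW].
rewrite /Rintegral (@continuous_FTC2 _ f F a b ab).
- by rewrite -EFinB.
- exact: continuous_subspaceT.
- split; first by move=> x _; have [] := dF x.
    by apply: cvg_at_right_filter; exact: cF.
  by apply: cvg_at_left_filter; exact: cF.
- by move=> x _; rewrite derive1E; exact: derive_val.
Qed.

Lemma cintegral_cexp m a b : a <= b -> m != 0 ->
  cintegral leb `[a, b[ (cexp m) = (0 -i* m^-1) * (cexp m b - cexp m a).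
Proof.
rewrite le_eqVlt => /predU1P[<- _|ab m0].
  rewrite subrr mulr0; apply: complex_ext => /=;
  by rewrite set_itvco0// Rintegral_set0.
have ic : \int[leb]_(x in `[a, b[) cos (m * x) = m^-1 * sin (m * b) - m^-1 * sin (m * a).
  apply: (Rintegral_FTC (F := fun x => m^-1 * sin (m * x)) ab).
    exact: continuous_cos_scale.
  move=> x; apply: is_derive_eq; rewrite /GRing.scale/=.
  by rewrite !mulr1; field.
have is_ : \int[leb]_(x in `[a, b[) sin (m * x) = - m^-1 * cos (m * b) - - m^-1 * cos (m * a).
  apply: (Rintegral_FTC (F := fun x => - m^-1 * cos (m * x)) ab).
    exact: continuous_sin_scale.
  move=> x; apply: is_derive_eq; rewrite /GRing.scale/=.
  by rewrite !mulr1; field.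
by apply: complex_ext; rewrite /= ?ic ?is_; ring.
Qed.

Lemma cintegral_cst1 a b : a <= b -> cintegral leb `[a, b[ (fun=> 1) = (b - a)%:C.
Proof.
move=> ab; apply: complex_ext => /=; rewrite /Rintegral integral_cst//=; last first.
  by rewrite mul0e.
rewrite mul1e lebesgue_measure_itv/= lte_fin; case: ltP => [_|ba] //=.
by rewrite (@le_anti _ _ a b) ?subrr// ab ba.
Qed.

Lemma eq_cintegrable d (U : measurableType d) (mu : {measure set U -> \bar R}) (D : set U)
    (f g : U -> R[i]) : (forall z : U, D z -> f z = g z) ->
  cintegrable mu D f -> cintegrable mu D g.
Proof.
move=> fg [mf foo]; split; first exact: eq_mcfun fg mf.
rewrite (_ : (\int[mu]_(x in D) (normc (g x))%:E)%E = (\int[mu]_(x in D) (normc (f x))%:E)%E)//.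
by apply: eq_integral => x /set_mem Dx; rewrite fg.
Qed.

Lemma cintegral_itv_split a t b (f : T -> R[i]) : a <= t -> t <= b ->
  cintegrable leb `[a, t[ f -> cintegrable leb `[t, b[ f ->
  cintegral leb `[a, b[ f = cintegral leb `[a, t[ f + cintegral leb `[t, b[ f.
Proof.
move=> at_ tb fi1 fi2.
have E : `[a, b[%classic = `[a, t[%classic `|` `[t, b[%classic :> set T.
  apply/seteqP; split => x /=.
    rewrite in_itv/= => /andP[cx xd]; have [xt|tx] := ltP x t.
      by left; rewrite /= in_itv/= cx.
    by right; rewrite /= in_itv/= tx.
  move=> [|] /=; rewrite !in_itv/= => /andP[ax xb].
    by rewrite ax/= (lt_le_trans xb).
  by rewrite (le_trans at_ ax).
have dis : [disjoint (`[a, t[%classic : set T) & (`[t, b[%classic : set T)].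
  apply/disj_setPLR => x /=; rewrite !in_itv/= => /andP[_ xt]; apply/negP.
  by rewrite negb_and -ltNge xt.
have m1 : measurable (`[a, t[%classic : set T) by exact: measurable_itv.
have m2 : measurable (`[t, b[%classic : set T) by exact: measurable_itv.
have mab : measurable (`[a, b[%classic : set T) by exact: measurable_itv.
have fi : cintegrable leb (`[a, t[%classic `|` `[t, b[%classic) f.
  have mf : measurable_cfun (`[a, t[%classic `|` `[t, b[%classic) f.
    case: fi1 fi2 => [[r1 i1] _] [[r2 i2] _].
    by split; apply/measurable_funU.
  split => //; rewrite ge0_integral_setU//.
  - by apply: lte_add_pinfty; [case: fi1|case: fi2].
  - exact: measurable_EFin_normc.
  - by move=> x _; rewrite lee_fin normc_ge0.
have mU : measurable (`[a, t[%classic `|` `[t, b[%classic : set T) by exact: measurableU.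
have iR := cintegrable_Re mU fi; have iI := cintegrable_Im mU fi.
by apply: complex_ext; rewrite !cReImE /= E Rintegral_setU.
Qed.

End complex_exponentials.

(** * Entries of a trace class operator between orthogonal families *)

Section nuclear_pairing.
Variable R : realType.
Local Notation leb := (@lebesgue_measure R).
Local Notation Rp := (@Rplus R).
Local Notation mRp := (@measurable_Rplus R).
Local Notation sqnormp := (sqnorm leb Rp).
Local Notation cpairp := (cpair leb Rp).
Implicit Types (p q : nat -> cfun R) (c : nat -> R[i]) (h : cfun R).

Lemma L2_comb n c p : (forall j, L2p (p j)) -> L2p (fun x => \sum_(0 <= j < n) c j * p j x).
Proof. by move=> Lp; apply: L2_sum => [|j]; [exact: mRp|apply: L2Z; [exact: mRp|exact: Lp]]. Qed.

Lemma cpair_suml n c p h : (forall j, L2p (p j)) -> L2p h ->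
  cpairp (fun x => \sum_(0 <= j < n) c j * p j x) h = \sum_(0 <= j < n) c j * cpairp (p j) h.
Proof.
move=> Lp Lh; rewrite /cpair; under eq_cintegral => x _ do rewrite mulr_suml.
rewrite (cintegral_sum mRp); last first.
  by move=> j; exact: (cintegrableM mRp (L2Z mRp (c j) (Lp j)) Lh).
by apply: eq_bigr => j _; exact: (cpairZl mRp (c j) (Lp j) Lh).
Qed.

Definition orthogonal_family n (K : R) p := (forall j, L2p (p j)) /\
  forall i j, (i < n)%N -> (j < n)%N ->
    cpairp (p i) (fun x => (p j x)^*) = (if i == j then K else 0)%:C.

Lemma sqnorm_orthogonal n K p c : orthogonal_family n K p ->
  sqnormp (fun x => \sum_(0 <= j < n) c j * p j x) = (K * \sum_(0 <= j < n) normc (c j) ^+ 2)%:E.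
Proof.
move=> [Lp op]; rewrite -L2_rip_EFin; last exact: L2_comb.
congr EFin; rewrite /rip cpair_suml//; last by apply: L2_conj; exact: L2_comb.
rewrite cRe_sum mulr_sumr; apply: eq_big_nat => i /andP[_ ni].
rewrite cpairC (_ : (fun x => _) = (fun x => \sum_(0 <= j < n) (c j)^* * (p j x)^*)); last first.
  by apply/funext => x; rewrite rmorph_sum/=; apply: eq_bigr => j _; rewrite rmorphM.
have Lc j : L2p (fun x => (p j x)^*) by apply: L2_conj; exact: Lp.
rewrite (cpair_suml n (fun j => (c j)^*) Lc (Lp i)).
rewrite (_ : \sum_(0 <= j < n) _ = (c i)^* * K%:C).
  by rewrite normc_sqr !cReImE/=; ring.
rewrite (eq_big_nat _ _ (F2 := fun j => if j == i then (c i)^* * K%:C else 0)).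
  by rewrite -big_mkcond/= big_nat1_eq ni.
move=> j /andP[_ nj]; rewrite cpairC op// eq_sym.
by case: eqP => [->|]//; rewrite mulr0.
Qed.

(** Duality: the coefficient sum is itself a pairing of [h] with a combination of the
family, to which Cauchy-Schwarz applies. *)
Lemma bessel n K p h (H : R) : 0 <= K -> orthogonal_family n K p -> L2p h ->
  (sqnormp h <= H%:E)%E -> \sum_(0 <= j < n) normc (cpairp h (p j)) ^+ 2 <= K * H.
Proof.
move=> K0 op Lh hH; have [Lp _] := op.
have H0 : 0 <= H by rewrite -lee_fin; apply: le_trans hH; exact: sqnorm_ge0.
set s := \sum_(0 <= j < n) _.
have s0 : 0 <= s by apply: sumr_ge0 => j _; exact: sqr_ge0.
pose c j := (cpairp h (p j))^*.
have Lg := L2_comb n c Lp.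
have E : cpairp (fun x => \sum_(0 <= j < n) c j * p j x) h = s%:C.
  rewrite cpair_suml// /s rmorph_sum; apply: eq_bigr => j _.
  rewrite [cpairp (p j) h]cpairC /c normc_sqr; move: (cpairp h (p j)) => z.
  by apply: complex_ext; rewrite !cReImE/=; ring.
have := cpair_cauchy_schwarz mRp Lg Lh; rewrite E normc_real real_normK ?num_real//.
rewrite (sqnorm_orthogonal c op) (_ : \sum_(0 <= j < n) _ = s); last first.
  by apply: eq_bigr => j _; rewrite normc_conj.
move=> cs; have : ((s ^+ 2)%:E <= (K * s)%:E * H%:E)%E.
  apply: le_trans cs _; apply: lee_wpmul2l => //.
  by rewrite lee_fin mulr_ge0.
rewrite -EFinM lee_fin; have [->|sn0] := eqVneq s 0; first by rewrite mulr_ge0.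
have sp : 0 < s by rewrite lt_neqAle eq_sym sn0.
by rewrite expr2 mulrAC ler_pM2r.
Qed.

(** Each rank one term contributes at most [K] times its weight, by Bessel in both
families and the mean inequality. *)
Lemma nuclear_pairing_sum A (u g : nat -> cfun R) w (P K : R) n p q :
  linear_op A -> nuclear_rep A u g w P -> 0 <= K ->
  orthogonal_family n K p -> orthogonal_family n K q ->
  \sum_(0 <= j < n) normc (cpairp (A (p j)) (q j)) <= K * P.
Proof.
move=> lA [w0 uw gw wP AP] K0 op oq; have [Lp _] := op; have [Lq _] := oq.
pose t j k := normc (cpairp (p j) (g k)) * normc (cpairp (u k) (q j)).
have t0 j k : 0 <= t j k by rewrite mulr_ge0 ?normc_ge0.
have entry j : ((normc (cpairp (A (p j)) (q j)))%:E <= \sum_(0 <= k <oo) (t j k)%:E)%E.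
  have [v v0 qv] := L2_sqnorm_le (Lq j).
  apply/lee_addgt0Pr => e e0.
  pose eta := (e / (v + 1)) ^+ 2.
  have v1 : 0 < v + 1 by rewrite ltr_wpDl.
  have eta0 : 0 < eta by rewrite exprn_gt0// divr_gt0.
  have [N _ HN] := AP _ eta 0%N (Lp j) eta0.
  set S := (fun x => \sum_(0 <= k < N) cpairp (p j) (g k) * u k x).
  have Lu k : L2p (u k) by case: (uw k).
  have LS : L2p S by exact: L2_comb.
  have LAp : L2p (A (p j)) by exact: lA.1.
  have LD : L2p (fun x => A (p j) x - S x) by apply: L2B => //; exact: mRp.
  have E : cpairp (A (p j)) (q j) = cpairp (fun x => A (p j) x - S x) (q j) + cpairp S (q j).
    rewrite -(cpairDl mRp LD LS (Lq j)); congr cpairp; apply/funext => x.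
    by rewrite subrK.
  have d : normc (cpairp (fun x => A (p j) x - S x) (q j)) <= e.
    have := cpair_cauchy_schwarz mRp LD (Lq j); rewrite qv => cs.
    have : ((normc (cpairp (fun x => A (p j) x - S x) (q j)) ^+ 2)%:E <= eta%:E * (v ^+ 2)%:E)%E.
      by apply: le_trans cs _; apply: lee_wpmul2r => //; rewrite lee_fin sqr_ge0.
    rewrite -EFinM lee_fin -exprMn ler_sqr ?nnegrE ?normc_ge0//; last first.
      by rewrite mulr_ge0// divr_ge0// ltW.
    move/le_trans; apply; rewrite mulrAC ler_pdivrMr// ler_pM2l//.
    by rewrite lerDl.
  have sS : normc (cpairp S (q j)) <= \sum_(0 <= k < N) t j k.
    rewrite /S cpair_suml//; apply: le_trans (normc_sum _ _ _) _.
    by apply: ler_sum => k _; rewrite Normc.normcM.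
  apply: (@le_trans _ _ (\sum_(0 <= k < N) (t j k)%:E + e%:E)%E).
    rewrite sumEFin -EFinD lee_fin E; apply: le_trans (le_normcD _ _) _.
    by rewrite addrC lerD.
  by apply: leeD => //; apply: nneseries_lim_ge => k _ _; rewrite lee_fin.
rewrite -lee_fin -sumEFin; apply: (@le_trans _ _ (\sum_(0 <= j < n) \sum_(0 <= k <oo) (t j k)%:E)%E).
  by apply: lee_sum => j _.
rewrite -nneseries_sum; last by move=> j k _; rewrite lee_fin.
apply: lime_le; first by apply: is_cvg_nneseries => k _ _; apply: sume_ge0 => j _; rewrite lee_fin.
apply: nearW => N /=.
apply: (@le_trans _ _ (\sum_(0 <= k < N) (K * w k)%:E)%E).
  apply: lee_sum => k _; rewrite sumEFin lee_fin.
  apply: (@le_trans _ _ (2^-1 * \sum_(0 <= j < n) normc (cpairp (g k) (p j)) ^+ 2 +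
                         2^-1 * \sum_(0 <= j < n) normc (cpairp (u k) (q j)) ^+ 2)).
    rewrite !mulr_sumr -big_split/=; apply: ler_sum => j _.
    have amgm (a b : R) : a * b <= 2^-1 * a ^+ 2 + 2^-1 * b ^+ 2.
      by have := sqr_ge0 (a - b); nra.
    by rewrite /t [cpairp (p j) _]cpairC; exact: amgm.
  have [[Lu uwk] [Lg gwk]] := (uw k, gw k).
  have avg (x y z : R) : x <= z -> y <= z -> 2^-1 * x + 2^-1 * y <= z by lra.
  by apply: avg; [exact: bessel op Lg gwk|exact: bessel oq Lu uwk].
rewrite sumEFin lee_fin -mulr_sumr; apply: ler_wpM2l => //.
Qed.

End nuclear_pairing.

(** * Entries of the averaged operator on modulated intervals *)

Section wave_packets.
Variable R : realType.
Local Notation leb := (@lebesgue_measure R).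
Local Notation Rp := (@Rplus R).
Local Notation mRp := (@measurable_Rplus R).
Local Notation T := (measurableTypeR R).
Local Notation cpairp := (cpair leb Rp).

Definition turn (i : nat) : set T := `[2 * pi * i%:R, 2 * pi * i.+1%:R[%classic.

Lemma measurable_turn i : measurable (turn i).
Proof. exact: measurable_itv. Qed.

Let two_pi : 0 < 2 * pi :> R. Proof. by rewrite mulr_gt0// pi_gt0. Qed.

Lemma turnS (i : nat) : 2 * pi * i.+1%:R = 2 * pi * i%:R + 2 * pi :> R.
Proof. by rewrite -[i.+1]addn1 natrD mulrDr mulr1. Qed.

Lemma turn_le (i : nat) : 2 * pi * i%:R <= 2 * pi * i.+1%:R :> R.
Proof. by rewrite turnS lerDl ltW. Qed.

Lemma turn_Rplus i : (0 < i)%N -> turn i `<=` Rp.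
Proof.
move=> i0 x; rewrite /turn /Rplus/= !in_itv/= andbT => /andP[ix _].
by apply: lt_le_trans ix; rewrite mulr_gt0// ltr0n.
Qed.

Lemma lebesgue_turn i : leb (turn i) = (2 * pi)%:E.
Proof.
rewrite /turn lebesgue_measure_itv/= lte_fin turnS ltrDl two_pi -EFinB.
by rewrite addrAC subrr add0r.
Qed.

(** Exponentials cut off to an interval of length [2 pi]; on the interval itself they are
orthogonal at integer frequencies. *)
Definition packet (i : nat) (m : R) : cfun R := fun x => (\1_(turn i) x : R)%:C * cexp m x.

Lemma mcfun_packet i m : measurable_cfun Rp (packet i m).
Proof.
apply: mcfunM; last exact: mcfun_cexp.
apply: mcfun_real; apply: measurable_funTS; apply: measurable_indic; exact: measurable_turn.
Qed.

Lemma cpair_packet i m n : (0 < i)%N ->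
  cpairp (packet i m) (packet i n) = cintegral leb (turn i) (cexp (m + n)).
Proof.
move=> i0; rewrite (cintegral_restrict _ _ (turn_Rplus i0)); congr cintegral.
apply/funext => x; rewrite /packet cexpD mulrACA; congr (_ * _).
by rewrite indicE; case: (x \in _); rewrite ?mulr0 ?mulr1.
Qed.

Lemma L2_packet i m : (0 < i)%N -> L2p (packet i m).
Proof.
move=> i0; apply/L2P; split; first exact: mcfun_packet.
have E : (fun x => (normc (packet i m x) ^+ 2)%:E) = (fun x => (\1_(turn i) x : R)%:E).
  apply/funext => x; rewrite /packet Normc.normcM normc_cexp mulr1 normc_real indicE.
  by case: (x \in _); rewrite ?normr0 ?normr1 ?expr0n ?expr1n.
rewrite /sqnorm E integral_indic//; [|exact: mRp|exact: measurable_turn].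
apply: (@le_lt_trans _ _ (leb (turn i))).
  apply: le_measure; rewrite ?inE//; [|exact: measurable_turn].
  by apply: measurableI; [exact: measurable_turn|exact: mRp].
by rewrite lebesgue_turn ltry.
Qed.

Lemma packet_conj i m x : (packet i m x)^* = packet i (- m) x.
Proof. by apply: complex_ext; rewrite /packet !cReImE/= mulNr ?cosN ?sinN; ring. Qed.

Lemma cexp_turn (m : nat) (i : nat) : cexp (- m%:R) (2 * pi * i%:R : R) = 1.
Proof. by rewrite -cexp_conj cexp_2pi conjc1. Qed.

Lemma cexp_period (m k i : nat) : m != k ->
  cintegral leb (turn i) (cexp (m%:R - k%:R)) = 0.
Proof.
move=> mk; rewrite /turn cintegral_cexp ?turn_le//; last by rewrite subr_eq0 eqr_nat.
by rewrite !cexpD !cexp_2pi !cexp_turn !mulr1 subrr mulr0.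
Qed.

Lemma cexp_full i : cintegral leb (turn i) (cexp 0) = (2 * pi)%:C.
Proof.
rewrite (_ : cexp 0 = fun=> 1); last by apply/funext => x; rewrite cexp0.
by rewrite /turn cintegral_cst1 ?turn_le// turnS addrAC subrr add0r.
Qed.

Lemma orthogonal_packets i n (w : nat -> nat) : (0 < i)%N -> injective w ->
  orthogonal_family n (2 * pi) (fun j => packet i (w j)%:R) /\
  orthogonal_family n (2 * pi) (fun j => packet i (- (w j)%:R)).
Proof.
move=> i0 wI; split; split => [j|j k _ _]; try exact: L2_packet.
  rewrite (_ : (fun x => (packet i (w k)%:R x)^*) = packet i (- (w k)%:R)); last first.
    by apply/funext => x; rewrite packet_conj.
  rewrite cpair_packet//; case: eqP => [->|jk]; first by rewrite subrr cexp_full.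
  by rewrite cexp_period//; apply/eqP => /wI.
rewrite (_ : (fun x => (packet i (- (w k)%:R) x)^*) = packet i (w k)%:R); last first.
  by apply/funext => x; rewrite packet_conj opprK.
rewrite cpair_packet// addrC; case: eqP => [->|jk]; first by rewrite subrr cexp_full.
by rewrite cexp_period//; apply/eqP => /wI /esym.
Qed.

End wave_packets.

Section packet_pairing.
Variable R : realType.
Local Notation leb := (@lebesgue_measure R).
Local Notation Rp := (@Rplus R).
Local Notation T := (measurableTypeR R).
Local Notation cpairp := (cpair leb Rp).
Local Notation turn := (@turn R).

Variables (psi : cfun R) (i N j : nat) (c : R).
Hypothesis i0 : (0 < i)%N.
Hypothesis j0 : (0 < j)%N.
Hypothesis psiE : forall x, turn i x -> psi x = c%:C * cexp (- N%:R) x.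

Let r (m : nat) : R[i] := 0 +i* m%:R^-1.

Let mj : - (j%:R) != 0 :> R. Proof. by rewrite oppr_eq0 pnatr_eq0 -lt0n. Qed.
Let mNj : - (N + j)%:R != 0 :> R.
Proof. by rewrite oppr_eq0 pnatr_eq0 -lt0n addn_gt0 j0 orbT. Qed.

Let rE m : 0 -i* (- m%:R)^-1 = r m :> R[i].
Proof. by rewrite /r invrN opprK. Qed.

(** Left of [x] the symbol is the constant [psi x]; right of [x] it multiplies the packet
and shifts its frequency by [- N]. *)
Lemma Q_op_packet x : turn i x -> Q_op psi (packet i (- j%:R)) x =
  c%:C * (r j * (cexp (- (N + j)%:R) x - cexp (- N%:R) x) +
          r (N + j) * (1 - cexp (- (N + j)%:R) x)).
Proof.
move=> ix; have := ix; rewrite /turn/= in_itv/= => /andP[ax xb].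
have -> : Q_op psi (packet i (- j%:R)) x =
    cintegral leb (turn i) (fun y => psi (Num.max x y) * cexp (- j%:R) y).
  rewrite (cintegral_restrict _ _ (turn_Rplus i0)); congr cintegral.
  by apply/funext => y; rewrite /packet; ring.
have E1 y : (`[2 * pi * i%:R, x[%classic : set T) y ->
    psi x * cexp (- j%:R) y = psi (Num.max x y) * cexp (- j%:R) y.
  by rewrite /= in_itv/= => /andP[_ yx]; rewrite max_l// ltW.
have E2 y : (`[x, 2 * pi * i.+1%:R[%classic : set T) y ->
    c%:C * cexp (- (N + j)%:R) y = psi (Num.max x y) * cexp (- j%:R) y.
  rewrite /= in_itv/= => /andP[xy yb]; rewrite max_r// psiE.
    by rewrite natrD opprD cexpD; ring.
  by rewrite /turn/= in_itv/= yb (le_trans ax xy).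
have mE (a b : R) : measurable (`[a, b[%classic : set T) by exact: measurable_itv.
rewrite /turn (cintegral_itv_split ax (ltW xb)).
- rewrite -(eq_cintegral _ E1) -(eq_cintegral _ E2).
  rewrite !(cintegralZ (mE _ _) _ (cintegrable_cexp _ _ _)).
  rewrite !cintegral_cexp ?(ltW xb)// !rE psiE//.
  rewrite -[(i.+1)]/(i.+1) !cexp_turn natrD opprD cexpD; ring.
- exact: eq_cintegrable E1 (cintegrableZ (mE _ _) _ (cintegrable_cexp _ _ _)).
- exact: eq_cintegrable E2 (cintegrableZ (mE _ _) _ (cintegrable_cexp _ _ _)).
Qed.

(** The frequency [N + j] of the second packet makes two of the four terms constant and
leaves nonzero frequencies, which integrate to 0, in the others. *)
Lemma cpair_Q_op_packet :
  cpairp (Q_op psi (packet i (- j%:R))) (packet i (N + j)%:R) =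
  c%:C * ((2 * pi)%:C * (r j - r (N + j))).
Proof.
rewrite /cpair.
rewrite (_ : (fun x => _) = (fun x => (\1_(turn i) x : R)%:C *
    (Q_op psi (packet i (- j%:R)) x * cexp (N + j)%:R x))); last first.
  by apply/funext => x; rewrite /packet; ring.
rewrite -(cintegral_restrict _ _ (turn_Rplus i0)).
have mT : measurable (turn i) by exact: measurable_turn.
pose k1 := c%:C * r j; pose k2 := c%:C * r (N + j).
have cc (x : R) : cexp (- (N + j)%:R) x * cexp (N + j)%:R x = 1.
  by rewrite -cexpD addNr cexp0.
have E x : turn i x -> (k1 - k2) * cexp 0 x + (- k1 * cexp (j%:R - 0%:R) x +
    k2 * cexp ((N + j)%:R - 0%:R) x) = Q_op psi (packet i (- j%:R)) x * cexp (N + j)%:R x.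
  move=> ix; rewrite Q_op_packet// !subr0 cexp0.
  have cj : cexp (- N%:R) x * cexp (N + j)%:R x = cexp j%:R x.
    by rewrite -cexpD natrD addKr.
  rewrite -cj /k1 /k2; have := cc x.
  move: (cexp (- (N + j)%:R) x) (cexp (N + j)%:R x) (cexp (- N%:R) x) => a b d ab.
  move: (r j) (r (N + j)) c%:C => r1 r2 c'.
  transitivity ((c' * r1 - c' * r2) * (a * b) - c' * r1 * (d * b) + c' * r2 * b).
    by rewrite ab; ring.
  by ring.
rewrite -(eq_cintegral _ E).
have ie (k : R[i]) (m : R) : cintegrable leb (turn i) (fun x => k * cexp m x).
  exact: (cintegrableZ mT k (cintegrable_cexp _ _ _)).
rewrite (cintegralD mT (ie _ _) (cintegrableD mT (ie _ _) (ie _ _))).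
rewrite (cintegralD mT (ie _ _) (ie _ _)) !(cintegralZ mT _ (cintegrable_cexp _ _ _)).
have nz (m : nat) : (0 < m)%N -> m != 0%N by rewrite -lt0n.
have Nj0 : (0 < N + j)%N by rewrite addn_gt0 j0 orbT.
rewrite cexp_full (cexp_period R i (nz _ j0)) (cexp_period R i (nz _ Nj0)).
by rewrite /k1 /k2; ring.
Qed.

Lemma normc_cpair_Q_op_packet : 0 <= c -> (j <= N)%N ->
  pi * c * j%:R^-1 <= normc (cpairp (Q_op psi (packet i (- j%:R))) (packet i (N + j)%:R)).
Proof.
move=> c0 jN; rewrite cpair_Q_op_packet !Normc.normcM !normc_real.
have -> : r j - r (N + j) = 0 +i* (j%:R^-1 - (N + j)%:R^-1).
  by apply: complex_ext; rewrite !cReImE/= ?subr0.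
rewrite /= expr0n add0r sqrtr_sqr.
have jp : 0 < j%:R :> R by rewrite ltr0n.
have half : 2^-1 * j%:R^-1 <= j%:R^-1 - (N + j)%:R^-1 :> R.
  have : (N + j)%:R^-1 <= 2^-1 * j%:R^-1 :> R.
    rewrite -invfM lef_pV2 ?posrE ?mulr_gt0 ?ltr0n ?addn_gt0 ?j0 ?orbT//.
    by rewrite -natrM ler_nat mul2n -addnn leq_add2r.
  have aux (x y : R) : y <= 2^-1 * x -> 2^-1 * x <= x - y by lra.
  exact: aux.
have p0 : 0 < pi :> R by exact: pi_gt0.
rewrite (ger0_norm c0) ger0_norm ?mulr_ge0 ?(ltW p0)// ger0_norm; last first.
  by apply: le_trans half; rewrite mulr_ge0// invr_ge0 ltW.
apply: (@le_trans _ _ (c * (2 * pi * (2^-1 * j%:R^-1)))).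
  by rewrite le_eqVlt; apply/orP; left; apply/eqP; field; rewrite gt_eqF.
by rewrite ler_wpM2l// ler_wpM2l// mulr_ge0// ltW.
Qed.

End packet_pairing.

(** * A trace class operator with an averaged operator outside the trace class *)

Section rank_one.
Variable R : realType.
Local Notation leb := (@lebesgue_measure R).
Local Notation Rp := (@Rplus R).
Local Notation mRp := (@measurable_Rplus R).
Local Notation cpairp := (cpair leb Rp).

Variables (f g : cfun R).
Hypotheses (Lf : L2p f) (Lg : L2p g).

Definition rank_one : op R := fun h x => cpairp h g * f x.

Lemma linear_rank_one : linear_op rank_one.
Proof.
split=> [h Lh|a h k Lh Lk]; first by apply: L2Z => //; exact: mRp.
apply: aeW => x _; rewrite /rank_one.
rewrite (cpairDl mRp (L2Z mRp a Lh) Lk Lg) (cpairZl mRp a Lh Lg); ring.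
Qed.

Lemma rank_one_bound : exists2 M, 0 <= M & op_bound rank_one M.
Proof.
have [v v0 fv] := L2_sqnorm_le Lf; have [w w0 gw] := L2_sqnorm_le Lg.
exists (v * w) => [|h Lh]; first exact: mulr_ge0.
have [t t0 ht] := L2_sqnorm_le Lh.
rewrite /rank_one (@sqnormZ _ _ _ leb _ mRp _ _ (L2p_measurable Lf)).
have := cpair_cauchy_schwarz mRp Lh Lg; rewrite fv gw ht -!EFinM !lee_fin => H.
by rewrite exprMn; have := sqr_ge0 v; nra.
Qed.

Lemma rank_le_rank_one n : (0 < n)%N -> rank_le n rank_one.
Proof.
move=> n0; apply: (rank_le_mono n0); apply/rank_leP.
exists (fun=> f); split => // h Lh; exists (fun=> cpairp h g).
by apply: aeW => x _; rewrite big_nat1.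
Qed.

(** All singular numbers but the first vanish. *)
Lemma schatten_rank_one : schatten 1 rank_one.
Proof.
have [M M0 bM] := rank_one_bound; have lA := linear_rank_one.
have bA : bounded_op rank_one by exact: linear_bounded_op M0 lA bM.
split => //; rewrite schatten1E//.
have s0 n : (0 <= singular_number rank_one n)%E by exact: singular_number_ge0.
have sn n : (0 < n)%N -> singular_number rank_one n = 0%E.
  move=> n0; apply/eqP; rewrite eq_le s0 andbT.
  have b0 : op_bound (fun h x => rank_one h x - rank_one h x) 0.
    move=> h Lh; rewrite expr0n mul0e (_ : (fun x => _) = fun=> 0).
      by rewrite /sqnorm integral0_eq// => x _; rewrite Normc.normc0 expr0n.
    by apply/funext => x; rewrite subrr.
  apply: le_trans (op_bound_opnorm (lexx 0) b0); apply: ereal_inf_lbound.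
  by exists rank_one => //; split => //; exact: rank_le_rank_one.
apply: (@le_lt_trans _ _ (singular_number rank_one 0)); last first.
  apply: le_lt_trans (ltry M); apply: (@le_trans _ _ (opnorm rank_one)); last exact: op_bound_opnorm.
  apply: ereal_inf_lbound; exists (fun _ _ => 0); last first.
    by congr opnorm; apply/funext => h; apply/funext => x; rewrite subr0.
  split.
    apply: (@linear_bounded_op _ _ 0) => //.
      split => [h _|a h k _ _]; first exact: L2_0.
      by apply: aeW => x _; rewrite mulr0 addr0.
    move=> h _; rewrite expr0n mul0e /sqnorm integral0_eq// => x _.
    by rewrite Normc.normc0 expr0n.
  apply/rank_leP; exists (fun=> f); split => // h _; exists (fun=> 0).
  by apply: aeW => x _; rewrite big_nil.
apply: lime_le; first by apply: is_cvg_nneseries.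
apply: nearW => -[|n] /=; first by rewrite big_nil.
rewrite big_nat_recl//= big1_seq ?adde0// => k _; exact: sn.
Qed.

Lemma rank_one_kernel : is_L2_kernel rank_one (fun z => f z.1 * g z.2).
Proof.
split.
  apply/L2P; split.
    by apply: mcfunM; [exact: (mcfun_fst _ mRp (L2p_measurable Lf))|
                       exact: (mcfun_snd _ mRp (L2p_measurable Lg))].
  rewrite (sqnorm_tensor leb leb mRp mRp (L2p_measurable Lf) (L2p_measurable Lg)).
  by have [v v0 ->] := L2_sqnorm_le Lf; have [w w0 ->] := L2_sqnorm_le Lg; rewrite -EFinM ltry.
move=> h Lh; apply: aeW => x _; rewrite /rank_one mulrC /cpair.
rewrite -(cintegralZ mRp _ (cintegrableM mRp Lh Lg)); congr cintegral.
by apply/funext => y /=; ring.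
Qed.

End rank_one.

Section ae_symbol.
Variable R : realType.
Local Notation leb := (@lebesgue_measure R).
Local Notation leb2 := (leb \x leb)%E.
Local Notation Rp := (@Rplus R).
Local Notation Rp2 := (Rp `*` Rp).
Local Notation mRp := (@measurable_Rplus R).
Local Notation T := (measurableTypeR R).

Lemma ae_eq_averaging_symbol (k k' : T * T -> R[i]) :
  measurable_cfun Rp2 k -> measurable_cfun Rp2 k' -> ae_eq leb2 Rp2 k k' ->
  ae_eq leb Rp (averaging_symbol k) (averaging_symbol k').
Proof.
move=> mk mk' kk'.
apply: filterS2 (ae_product_section1 kk') (ae_product_section2 kk') => x k1 k2 Dx.
have sub : (`]0, x[%classic : set T) `<=` Rp by exact: (@below_Rplus R x).
have mb : measurable (`]0, x[%classic : set T) by exact: measurable_itv.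
rewrite /averaging_symbol; congr (_ * (_ + _)); apply: ae_eq_cintegral => //.
- exact: mcfunS mRp sub (mcfun_section1 mRp mRp mk Dx).
- exact: mcfunS mRp sub (mcfun_section1 mRp mRp mk' Dx).
- by apply: filterS k1 => y ky /sub Dy; apply: ky.
- exact: mcfunS mRp sub (mcfun_section2 mRp mRp mk Dx).
- exact: mcfunS mRp sub (mcfun_section2 mRp mRp mk' Dx).
- by apply: filterS k2 => y ky /sub Dy; apply: ky.
Qed.

(** Almost everywhere equality of the symbols is enough because [max x y] is [x] or
[y], each off a null set. *)
Lemma ae_eq_Q_op (phi psi : cfun R) h : measurable_cfun Rp phi -> measurable_cfun Rp psi ->
  L2p h -> ae_eq leb Rp phi psi -> ae_eq leb Rp (Q_op phi h) (Q_op psi h).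
Proof.
move=> mphi mpsi Lh E; apply: filterS (E) => x Ex Dx.
have mm (v : cfun R) : measurable_cfun Rp v ->
    measurable_cfun Rp (fun y => v (Num.max x y) * h y).
  move=> mv; apply: mcfunM; last exact: L2p_measurable.
  exact: (mcfun_section1 mRp mRp (mcfun_max mv) Dx).
apply: ae_eq_cintegral; [exact: mRp|exact: mm|exact: mm|].
apply: filterS E => y Ey Dy; congr (_ * _).
by case: (leP x y) => _; [exact: Ey|exact: Ex].
Qed.

End ae_symbol.

Section chirp.
Variable R : realType.
Local Notation leb := (@lebesgue_measure R).
Local Notation Rp := (@Rplus R).
Local Notation mRp := (@measurable_Rplus R).
Local Notation T := (measurableTypeR R).
Local Notation turn := (@turn R).

(** The factor [(i + 1)^-1] compensates the weight [2 x] of [chirp_column], and [2^-i]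
makes the squares summable.  The value 0 at [i = 0] keeps the support of the chirp
away from the unit interval on which the rank one operator integrates. *)
Definition amp (i : nat) : R := if i == 0%N then 0 else (i.+1%:R)^-1 * 2^-1 ^+ i.

Lemma amp_ge0 i : 0 <= amp i.
Proof. by rewrite /amp; case: ifP => // _; rewrite mulr_ge0// ?invr_ge0// exprn_ge0// invr_ge0. Qed.

Lemma amp_gt0 i : (0 < i)%N -> 0 < amp i.
Proof. by case: i => // i _; rewrite /amp/= mulr_gt0// ?invr_gt0// exprn_gt0// invr_gt0. Qed.

Lemma amp_le i : i.+1%:R * amp i <= 2^-1 ^+ i.
Proof.
rewrite /amp; case: ifP => _; first by rewrite mulr0 exprn_ge0// invr_ge0.
by rewrite mulrA divff ?mul1r// pnatr_eq0.
Qed.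

Lemma harmonic_unbounded (M : R) : exists n, M <= \sum_(0 <= j < n) j.+1%:R^-1.
Proof.
apply: contrapT => H; apply: (@dvg_harmonic R); apply: nondecreasing_is_cvgn.
  by apply: nondecreasing_series => n _ _; exact: harmonic_ge0.
exists M => _ [n _ <-]; rewrite leNgt; apply/negP => /ltW Mn.
by apply: H; exists n.
Qed.

(** However small the amplitudes, a long enough harmonic sum outweighs them. *)
Lemma long_frequencies : exists N : nat -> nat, forall i, (0 < i)%N ->
  i%:R <= amp i * \sum_(0 <= j < N i) j.+1%:R^-1.
Proof.
have H i : exists n, (0 < i)%N -> i%:R <= amp i * \sum_(0 <= j < n) j.+1%:R^-1.
  have [n Hn] := harmonic_unbounded (i%:R / amp i); exists n => i0.
  by move: Hn; rewrite ler_pdivrMr ?amp_gt0// mulrC.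
by have [N HN] := choice H; exists N.
Qed.

Variable N : nat -> nat.

Let turn_of (x : R) : nat := Num.truncn (x / (2 * pi)).

Let two_pi : 0 < 2 * pi :> R. Proof. by rewrite mulr_gt0// pi_gt0. Qed.

Let turn_of_turn i x : turn i x -> turn_of x = i.
Proof.
rewrite /turn/= in_itv/= => /andP[ix xi]; apply: truncn_def.
by rewrite ler_pdivlMr// ltr_pdivrMr// mulrC ix mulrC.
Qed.

Let turn_turn_of x : 0 <= x -> turn (turn_of x) x.
Proof.
move=> x0; rewrite /turn/= in_itv/=.
have /andP[] := truncn_itv (divr_ge0 x0 (ltW two_pi)).
by rewrite -/(turn_of x) ler_pdivlMr// ltr_pdivrMr// ![2 * pi * _]mulrC => -> ->.
Qed.

(** The symbol: on the [i]-th interval of length [2 pi] it oscillates at the frequency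
[N i]. *)
Definition chirp : cfun R := fun x =>
  (amp (turn_of x))%:C * cexp (- (N (turn_of x))%:R) x.

Lemma chirpE i x : turn i x -> chirp x = (amp i)%:C * cexp (- (N i)%:R) x.
Proof. by move=> /turn_of_turn; rewrite /chirp => ->. Qed.

Let turn_cover : Rp `<=` \bigcup_i turn i.
Proof.
move=> x; rewrite /Rplus/= in_itv/= andbT => /ltW x0.
by exists (turn_of x) => //; exact: turn_turn_of.
Qed.

Let mU : measurable (\bigcup_i turn i).
Proof. by apply: bigcup_measurable => i _; exact: measurable_turn. Qed.

Lemma mcfun_chirp : measurable_cfun (\bigcup_i turn i) chirp.
Proof.
have H i : measurable_cfun (turn i) chirp.
  apply: (@eq_mcfun _ _ _ _ (fun x => (amp i)%:C * cexp (- (N i)%:R) x)).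
    by move=> x /chirpE.
  by apply: mcfunM; [exact: mcfun_cst|exact: mcfun_cexp].
by split; apply/(measurable_fun_bigcup _ (@measurable_turn R)) => i; case: (H i).
Qed.

Lemma chirp_eq0 x : 0 < x -> x < 1 -> chirp x = 0.
Proof.
move=> x0 x1; rewrite (@chirpE 0) /amp ?eqxx ?mul0r//.
rewrite /turn/= in_itv/= mulr0 mulr1 (ltW x0)/=; apply: lt_le_trans x1 _.
by have := pi_ge2 R; lra.
Qed.

Definition chirp_column : cfun R := fun x => (2 * x)%:C * chirp x.

Lemma mcfun_chirp_column : measurable_cfun (\bigcup_i turn i) chirp_column.
Proof.
apply: mcfunM; last exact: mcfun_chirp.
apply: mcfun_real; apply: measurable_funTS.
by apply: continuous_measurable_fun; exact: mulrl_continuous.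
Qed.

Lemma L2_chirp_column : L2p chirp_column.
Proof.
have m2 := mcfun_chirp_column.
apply/L2P; split; first exact: mcfunS mU turn_cover m2.
have msq := measurable_EFin_normc_sqr m2.
have sq0 x : (0 <= (normc (chirp_column x) ^+ 2)%:E)%E by rewrite lee_fin sqr_ge0.
apply: (@le_lt_trans _ _ (\int[leb]_(x in \bigcup_i turn i) (normc (chirp_column x) ^+ 2)%:E)%E).
  by apply: ge0_subset_integral => //; exact: mRp.
rewrite ge0_integral_bigcup//; last 2 first.
- exact: measurable_turn.
- apply/trivIsetP => i k _ _ ik; apply/seteqP; split => x //= -[].
  by move=> /turn_of_turn ix /turn_of_turn kx; move: ik; rewrite -ix -kx eqxx.
pose q : R := (4 * pi) ^+ 2 * (2 * pi).
have q0 : 0 <= q by rewrite mulr_ge0 ?sqr_ge0// ltW.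
apply: (@le_lt_trans _ _ (q * 2)%:E); last exact: ltry.
apply: lime_le.
  by apply: is_cvg_nneseries => i _ _; apply: integral_ge0.
apply: nearW => n; apply: (@le_trans _ _ (\sum_(0 <= i < n) (q * 2^-1 ^+ i)%:E)%E).
  apply: lee_sum => i _.
  apply: (@le_trans _ _ (\int[leb]_(x in turn i) ((4 * pi * 2^-1 ^+ i) ^+ 2)%:E)%E).
    apply: ge0_le_integral => //.
    - exact: measurable_turn.
    - by apply: measurable_funS msq => //; exact: bigcup_sup.
    move=> x ix; rewrite lee_fin.
    have [xi xS] : 2 * pi * i%:R <= x /\ x <= 2 * pi * i.+1%:R.
      by move: ix; rewrite /turn/= in_itv/= => /andP[? /ltW ?].
    have x0 : 0 <= x by apply: le_trans xi; rewrite mulr_ge0// ltW.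
    have b0 : 0 <= 4 * pi * 2^-1 ^+ i :> R.
      by rewrite mulr_ge0 ?exprn_ge0 ?invr_ge0// mulr_ge0// ltW// pi_gt0.
    rewrite ler_sqr ?nnegrE ?normc_ge0// /chirp_column (chirpE ix) !Normc.normcM normc_cexp !normc_real.
    rewrite mulr1 (ger0_norm (amp_ge0 i)) ger0_norm ?mulr_ge0//.
    apply: (@le_trans _ _ (2 * (2 * pi * i.+1%:R) * amp i)).
      by rewrite ler_wpM2r ?amp_ge0// ler_wpM2l.
    rewrite (_ : 2 * (2 * pi * i.+1%:R) * amp i = 4 * pi * (i.+1%:R * amp i)); last by ring.
    by rewrite ler_wpM2l ?amp_le// mulr_ge0// ltW// pi_gt0.
  rewrite integral_cst; last exact: measurable_turn.
  rewrite [X in (_ * X <= _)%E](_ : _ = (2 * pi)%:E); last exact: lebesgue_turn.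
  rewrite -EFinM lee_fin.
  rewrite (_ : (4 * pi * 2^-1 ^+ i) ^+ 2 * (2 * pi) = q * (2^-1 ^+ i) ^+ 2); last first.
    by rewrite /q; ring.
  apply: ler_wpM2l => //.
  rewrite expr2 ler_piMl ?exprn_ge0 ?invr_ge0// exprn_ile1 ?invr_ge0//.
  by rewrite invf_le1// ler1n.
rewrite sumEFin lee_fin -mulr_sumr ler_wpM2l//.
have -> : \sum_(0 <= i < n) 2^-1 ^+ i = 2 - 2 * 2^-1 ^+ n :> R.
  elim: n => [|n IH]; first by rewrite big_nil expr0 mulr1 subrr.
  by rewrite big_nat_recr//= IH exprS; field.
by rewrite gerBl mulr_ge0// exprn_ge0// invr_ge0.
Qed.

Let one : cfun R := head_fun (1, 0).

(** For [x >= 1] the horizontal average is [chirp_column x / (2 x)] and the vertical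
one vanishes; for [x < 1] both vanish because the chirp does. *)
Lemma averaging_symbol_chirp x : Rp x ->
  averaging_symbol (fun z => chirp_column z.1 * one z.2) x = chirp x.
Proof.
rewrite /Rplus/= in_itv/= andbT => x0.
rewrite /averaging_symbol/=.
have [x1|x1] := ltP x 1.
  rewrite chirp_eq0// (@eq_cintegral _ _ _ leb _ _ (fun=> 0)); last first.
    by move=> y _; rewrite /chirp_column chirp_eq0// mulr0 mul0r.
  rewrite [X in _ + X](@eq_cintegral _ _ _ leb _ _ (fun=> 0)); last first.
    move=> y; rewrite /= in_itv/= => /andP[y0 yx].
    by rewrite /chirp_column chirp_eq0 ?mulr0 ?mul0r// (lt_trans yx).
  by rewrite cintegral0 addr0 mulr0.
rewrite [X in _ + X](@eq_cintegral _ _ _ leb _ _ (fun=> 0)); last first.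
  by move=> y _; rewrite /one /head_fun/= ltNge x1 mulr0.
rewrite cintegral0 addr0.
have mx : measurable (`]0, x[%classic : set T) by exact: measurable_itv.
have sub : (`]0%R, 1%R[%classic : set T) `<=` `]0, x[%classic.
  by move=> y; rewrite /= !in_itv/= => /andP[-> y1]; exact: lt_le_trans x1.
have one_int : cintegral leb `]0, x[ one = 1.
  rewrite (_ : cintegral leb `]0, x[ one = cintegral leb `]0, x[
      (fun y => (\1_(`]0%R, 1%R[%classic : set T) y : R)%:C * 1)).
    rewrite -cintegral_restrict//; apply: complex_ext => /=; rewrite /Rintegral integral_cst//=.
      by rewrite mul1e lebesgue_measure_itv/= lte01 sube0.
    by rewrite mul0e.
  apply: eq_cintegral => y; rewrite /= in_itv/= => /andP[y0 yx].
  rewrite mulr1 /one /head_fun indicE; congr (((_ : bool)%:R : R)%:C).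
  by apply/idP/idP => [y1|/set_mem]; [apply/mem_set|]; rewrite /= in_itv/= y0.
rewrite (cintegralZ mx).
  rewrite one_int mulr1 /chirp_column mulrA -rmorphM/= mulVf ?rmorph1 ?mul1r//.
  by rewrite mulf_neq0// gt_eqF.
split; first by apply: mcfunS mRp _ (mcfun_head_fun _); exact: (@below_Rplus R x).
apply: (@le_lt_trans _ _ (\int[leb]_(y in (`]0%R, x[%classic : set T)) (cst 1%:E y))%E).
  apply: ge0_le_integral => //.
  - by move=> y _; rewrite lee_fin normc_ge0.
  - apply: measurable_EFin_normc; apply: mcfunS mRp _ (mcfun_head_fun _).
    exact: (@below_Rplus R x).
  move=> y _; rewrite lee_fin /one /head_fun normc_real.
  by case: (y < _); rewrite ?normr0 ?normr1.
have L : leb `]0%R, x[ = x%:E by rewrite lebesgue_measure_itv/= lte_fin x0 sube0.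
by rewrite integral_cst// mul1e [ltLHS](_ : _ = x%:E) ?ltry//; exact: L.
Qed.

End chirp.

Section not_trace_class.
Variable R : realType.
Local Notation leb := (@lebesgue_measure R).
Local Notation Rp := (@Rplus R).
Local Notation Rp2 := (Rp `*` Rp).
Local Notation mRp := (@measurable_Rplus R).
Local Notation T := (measurableTypeR R).
Local Notation cpairp := (cpair leb Rp).

(** If the averaged operator were trace class, its entries between the packets of the
[i]-th interval would have a sum bounded independently of [i], but [N] is chosen so
that this sum is at least [pi * i]. *)
Lemma averaging_projection_not_trace_class :
  exists A : op R, schatten 1 A /\ ~ schatten 1 (averaging_projection A).
Proof.
have [N HN] := long_frequencies R.
pose one : cfun R := head_fun (1, 0).
have Lone : L2p one by exact: L2_head_fun.
have Lf := L2_chirp_column R N.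
pose s (z : T * T) := chirp_column N z.1 * one z.2.
exists (rank_one (chirp_column N) one); split; first exact: schatten_rank_one.
have Ks : is_L2_kernel (rank_one (chirp_column N) one) s by exact: rank_one_kernel.
have Ak := kernel_ofP Ks.
set psi := averaging_symbol (kernel_of (rank_one (chirp_column N) one)).
have ms : measurable_cfun Rp2 s by case: Ks => /L2_measurable.
have mk : measurable_cfun Rp2 (kernel_of (rank_one (chirp_column N) one)).
  by case: Ak => /L2_measurable.
have mpsi : measurable_cfun Rp psi by exact: mcfun_averaging_symbol.
have mchirp : measurable_cfun Rp (chirp N).
  apply: (@eq_mcfun _ _ _ _ (averaging_symbol s)); last exact: mcfun_averaging_symbol.
  by move=> x Dx; exact: averaging_symbol_chirp.
have psiE : ae_eq leb Rp psi (chirp N).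
  have := ae_eq_averaging_symbol mk ms (L2_kernel_unique Ak Ks).
  by apply: filterS => x + Dx => /(_ Dx) Ex; rewrite /psi Ex; exact: averaging_symbol_chirp.
rewrite /averaging_projection -/psi => SQ.
have lQ : linear_op (Q_op psi) by case: SQ => /bounded_linear_op.
have [u [g [w nu]]] := schatten_nuclear SQ (@ltr01 R).
set P := 12 * _ in nu.
have P0 : 0 <= P.
  by case: nu => _ _ _ /(_ 0%N); rewrite big_nil.
suff bnd i : (0 < i)%N -> i%:R <= 2 * P.
  have := bnd (Num.truncn (2 * P)).+1 isT; rewrite leNgt truncnS_gt//.
move=> i0.
have p0 : 0 < pi :> R by exact: pi_gt0.
have K0 : 0 <= 2 * pi :> R by rewrite mulr_ge0// ltW.
have [_ op] := orthogonal_packets R (N i) i0 succn_inj.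
have shift_inj : injective (fun j => N i + j.+1)%N by move=> j k /addnI[].
have [oq _] := orthogonal_packets R (N i) i0 shift_inj.
have := nuclear_pairing_sum lQ nu K0 op oq.
have low : pi * i%:R <= \sum_(0 <= j < N i)
    normc (cpairp (Q_op psi (packet i (- j.+1%:R))) (packet i (N i + j.+1)%:R)).
  apply: (@le_trans _ _ (\sum_(0 <= j < N i) pi * amp R i * j.+1%:R^-1)).
    by rewrite -mulr_sumr -mulrA ler_pM2l// HN.
  apply: ler_sum_nat => j /andP[_ jN].
  have LQ := lQ.1 _ (L2_packet (- j.+1%:R) i0).
  have EQ := ae_eq_Q_op mpsi mchirp (L2_packet (- j.+1%:R) i0) psiE.
  rewrite (@ae_eq_cpair _ _ (Q_op (chirp N) (packet i (- j.+1%:R)))).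
  - apply: normc_cpair_Q_op_packet => //; last exact: amp_ge0.
    by move=> x; exact: chirpE.
  - exact: LQ.
  - apply/L2P; split; first by apply: mcfun_Q_op => //; exact: L2_packet.
    rewrite -(ae_eq_sqnorm mRp _ _ EQ); first by have /L2P[] := LQ.
      exact: L2p_measurable LQ.
    by apply: mcfun_Q_op => //; exact: L2_packet.
  - exact: L2_packet.
  - exact: EQ.
move=> up; have := le_trans low up.
by rewrite (_ : 2 * pi * P = pi * (2 * P)) ?ler_pM2l//; ring.
Qed.

End not_trace_class.

Theorem theorem11p3 (R : realType) :
  (exists A : op R,
     schatten 1 A /\ ~ schatten 1 (averaging_projection A)) /\
  (exists C : R, forall A : op R, schatten 1 A ->
     weak_schatten1 (averaging_projection A) /\
     forall n : nat,
       (singular_number (averaging_projection A) n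
          <= (C * (1 + n%:R)^-1)%:E * schatten_norm 1 A)%E).
Proof.
split; first exact: averaging_projection_not_trace_class.
exists (72 * (34 * 12)) => A; exact: averaging_projection_weak_type.
Qed.
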